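(* Let $L>2\pi\sqrt{\frac{\sqrt5}{\sqrt5-1}}$ be fixed and consider $c\in\left(0,\frac12\sqrt{5-\frac{L^4}{(L^2-4\pi^2)^2}}\right)$. Let $\phi=\phi_c$ be the $L$-periodic dnoidal wave defined in the context. The operator $$\mathcal D=\begin{pmatrix}-5\partial_x^2+1-3\phi^2-5\phi^4&-4c\,\partial_x^2+c\\ -4c\,\partial_x^2+c&-4\partial_x^2+1\end{pmatrix},$$ defined in $\mathbb L^2_{per}=L^2_{per}([0,L])\times L^2_{per}([0,L])$ with domain $\mathbb H^2_{per}=H^2_{per}([0,L])\times H^2_{per}([0,L])$, has a unique negative eigenvalue, which is simple, and zero is a simple eigenvalue with eigenfunction $(\phi',-c\phi')$. Moreover, the remainder of the spectrum of $\mathcal D$ is constituted by a discrete set of eigenvalues bounded away from zero.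
   Context: $L^2_{per}([0,L])$ and $H^2_{per}([0,L])$ are the $L$-periodic Lebesgue and Sobolev spaces. Let $r=1-c^2$, $s=5-4c^2$. For $\alpha_4\in\left(\frac{-1+\sqrt{1+4r}}2,\frac{-3+\sqrt{9+48r}}4\right)$ put $\beta=-4\alpha_4^2-4\alpha_4+3+16r$, $\alpha_1=\frac{-2\alpha_4-3-\sqrt3\sqrt\beta}4$, $\alpha_3=\frac{-2\alpha_4-3+\sqrt3\sqrt\beta}4$ (so $\alpha_1<0<\alpha_3<\alpha_4$), $k\in(0,1)$ with $k^2=\frac{-\alpha_1(\alpha_4-\alpha_3)}{\alpha_4(\alpha_3-\alpha_1)}$, and $$\phi(x)=\frac{\sqrt{\alpha_4}\,\mathrm{dn}(\gamma x,k)}{\sqrt{1+\frac{\alpha_4k^2}{-\alpha_1}\mathrm{sn}^2(\gamma x,k)}},\quad\gamma=\sqrt{\frac{\alpha_4(\alpha_3-\alpha_1)}{3s}},\quad T(\alpha_4,c)=\frac{2\sqrt{3s}\,K(k)}{\sqrt{\alpha_4(\alpha_3-\alpha_1)}},$$ with Jacobi elliptic functions $\mathrm{sn},\mathrm{dn}$ of modulus $k$ and $K(k)=\int_0^1\frac{dt}{\sqrt{(1-k^2t^2)(1-t^2)}}$. For $L,c$ as in the claim, $\phi_c$ is the function $\phi$ for the unique $\alpha_4\in\left(\frac{-1+\sqrt{1+4r}}2,\frac{-3+\sqrt{9+48r}}4\right)$ with $T(\alpha_4,c)=L$; it has fundamental period $L$ and solves $-\phi''+\frac rs\phi-\frac1s(\phi^3+\phi^5)=0$.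 *)

(* Defs.v *)
From HB Require Import structures.
From mathcomp Require Import all_boot all_order all_algebra.
From mathcomp Require Import all_classical all_reals all_analysis.
From mathcomp Require Import complex.

Set Implicit Arguments.
Unset Strict Implicit.
Unset Printing Implicit Defensive.

Import Order.TTheory GRing.Theory Num.Theory.
Import numFieldNormedType.Exports.

Local Open Scope classical_set_scope.
Local Open Scope ring_scope.
Local Open Scope complex_scope.

Section JacobiElliptic.
Variable R : realType.
Local Notation mu := (@lebesgue_measure R).

Definition ellipticK (k : R) : R :=
  \int[mu]_(t in `[0, 1]) (Num.sqrt ((1 - k ^+ 2 * t ^+ 2) * (1 - t ^+ 2)))^-1.

(* Incomplete integral of the first kind; oriented, so that it is odd in t. *)
Definition ellipticF (k t : R) : R :=
  let I a b := \int[mu]_(s in `[a, b]) (Num.sqrt (1 - k ^+ 2 * sin s ^+ 2))^-1 in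
  if 0 <= t then I 0 t else - I t 0.

(* For 0 <= k < 1 the map ellipticF k is a bijection of R, and the Jacobi
   amplitude is its inverse. *)
Definition jacobi_am (k u : R) : R := xget 0 [set t | ellipticF k t = u].

Definition jacobi_sn (k u : R) : R := sin (jacobi_am k u).

Definition jacobi_dn (k u : R) : R :=
  Num.sqrt (1 - k ^+ 2 * jacobi_sn k u ^+ 2).

End JacobiElliptic.

Section DnoidalWave.
Variables (R : realType) (a4 c : R).

Definition rr : R := 1 - c ^+ 2.
Definition ss : R := 5 - 4 * c ^+ 2.

Definition alpha4_min : R := (-1 + Num.sqrt (1 + 4 * rr)) / 2.
Definition alpha4_max : R := (-3 + Num.sqrt (9 + 48 * rr)) / 4.

Definition dn_beta : R := -4 * a4 ^+ 2 - 4 * a4 + 3 + 16 * rr.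
Definition alpha1 : R := (-2 * a4 - 3 - Num.sqrt 3 * Num.sqrt dn_beta) / 4.
Definition alpha3 : R := (-2 * a4 - 3 + Num.sqrt 3 * Num.sqrt dn_beta) / 4.

Definition modulus : R :=
  Num.sqrt (- alpha1 * (a4 - alpha3) / (a4 * (alpha3 - alpha1))).

Definition wave_gamma : R := Num.sqrt (a4 * (alpha3 - alpha1) / (3 * ss)).

Definition dnoidal (x : R) : R :=
  Num.sqrt a4 * jacobi_dn modulus (wave_gamma * x) /
  Num.sqrt (1 + a4 * modulus ^+ 2 / (- alpha1)
                * jacobi_sn modulus (wave_gamma * x) ^+ 2).

Definition dnoidal_period : R :=
  2 * Num.sqrt (3 * ss) * ellipticK modulus / Num.sqrt (a4 * (alpha3 - alpha1)).

End DnoidalWave.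

(* Complex-valued L-periodic functions; an element of a function space is
   represented by a pointwise L-periodic function on R, and two such functions
   are identified when they agree almost everywhere. *)
Section PeriodicSpaces.
Variables (R : realType) (L : R).
Local Notation mu := (@lebesgue_measure R).
Local Notation C := R[i].

Definition periodic (T : Type) (f : R -> T) : Prop := forall x, f (x + L) = f x.

Definition cint (f : R -> C) : C :=
  (\int[mu]_(x in `[0%R, L]) complex.Re (f x))
  +i* (\int[mu]_(x in `[0%R, L]) complex.Im (f x)).

Definition sqmod (z : C) : R := complex.Re z ^+ 2 + complex.Im z ^+ 2.

Definition L2per (f : R -> C) : Prop :=
  [/\ periodic f,
      measurable_fun setT (fun x => complex.Re (f x)),
      measurable_fun setT (fun x => complex.Im (f x)) &
      mu.-integrable `[0%R, L] (fun x => (sqmod (f x))%:E)].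

(* Smooth real L-periodic test functions; real ones suffice by linearity. *)
Definition test_fun (psi : R -> R) : Prop :=
  periodic psi /\ forall n x, derivable (derive1n n psi) x 1.

Definition is_wderiv (f g : R -> C) : Prop :=
  L2per g /\ forall psi, test_fun psi ->
    cint (fun x => f x * (derive1 psi x)%:C) = - cint (fun x => g x * (psi x)%:C).

Definition H2per (f : R -> C) : Prop :=
  L2per f /\ exists g h, is_wderiv f g /\ is_wderiv g h.

(* A representative of the weak derivative, unique up to a null set when it
   exists (and zero otherwise). *)
Definition wderiv (f : R -> C) : R -> C := xget (cst 0) [set g | is_wderiv f g].

Definition vfun : Type := ((R -> C) * (R -> C))%type.

Definition LL2per (U : vfun) : Prop := L2per U.1 /\ L2per U.2.
Definition HH2per (U : vfun) : Prop := H2per U.1 /\ H2per U.2.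

Definition vae_eq (U V : vfun) : Prop :=
  (\forall x \ae mu, `[0%R, L]%classic x -> U.1 x = V.1 x) /\
  (\forall x \ae mu, `[0%R, L]%classic x -> U.2 x = V.2 x).

Definition vzero : vfun := (cst 0, cst 0).
Definition vscale (z : C) (U : vfun) : vfun :=
  (fun x => z * U.1 x, fun x => z * U.2 x).
Definition vsub (U V : vfun) : vfun :=
  (fun x => U.1 x - V.1 x, fun x => U.2 x - V.2 x).

Definition vnorm (U : vfun) : R :=
  Num.sqrt (\int[mu]_(x in `[0%R, L]) (sqmod (U.1 x) + sqmod (U.2 x))).

(* Spectral notions for an operator in LL2per with domain HH2per; only the
   values of A on HH2per matter. *)
Section Spectrum.
Variable A : vfun -> vfun.

Definition eigenfunction (lam : C) (U : vfun) : Prop :=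
  [/\ HH2per U, ~ vae_eq U vzero & vae_eq (A U) (vscale lam U)].

Definition is_eigenvalue (lam : C) : Prop := exists U, eigenfunction lam U.

Definition simple_eigenvalue (lam : C) : Prop :=
  exists2 U, eigenfunction lam U &
    forall V, eigenfunction lam V -> exists z : C, vae_eq V (vscale z U).

Definition shifted (lam : C) (U : vfun) : vfun := vsub (A U) (vscale lam U).

Definition resolvent_set : set C := [set lam |
  [/\ forall U, HH2per U -> vae_eq (shifted lam U) vzero -> vae_eq U vzero,
      forall F, LL2per F -> exists2 U, HH2per U & vae_eq (shifted lam U) F &
      exists M : R, forall U, HH2per U -> vnorm U <= M * vnorm (shifted lam U)]].

Definition spectrum : set C := ~` resolvent_set.

End Spectrum.

Definition opD (phi : R -> R) (c : R) (U : vfun) : vfun :=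
  let f := U.1 in let g := U.2 in
  let f2 := wderiv (wderiv f) in let g2 := wderiv (wderiv g) in
  (fun x => - 5%:R * f2 x
            + (1 - 3 * phi x ^+ 2 - 5 * phi x ^+ 4)%:C * f x
            + ((- 4 * c)%:C * g2 x + c%:C * g x),
   fun x => ((- 4 * c)%:C * f2 x + c%:C * f x)
            + (- 4%:R * g2 x + g x)).

End PeriodicSpaces.

(* Main.v *)
Require Import Defs.
From HB Require Import structures.
From mathcomp Require Import all_boot all_order all_algebra.
From mathcomp Require Import all_classical all_reals all_analysis.
From mathcomp Require Import measurable_realfun complex.
From mathcomp Require Import ring lra.

Import Order.TTheory GRing.Theory Num.Theory.
Import numFieldNormedType.Exports.

Local Open Scope classical_set_scope.
Local Open Scope ring_scope.
Local Open Scope complex_scope.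

Set Implicit Arguments.
Unset Strict Implicit.
Unset Printing Implicit Defensive.

(* With h = g + c f, the quadratic form of D is the integral of
   4 h'^2 + h^2 + s (f'^2 + qs f^2), where qs = (r - 3 phi^2 - 5 phi^4) / s is the potential of
   the linearised profile equation w'' = qs w. One solution of that equation is phi', which has
   no zero in ]0, L/2[; a second one, y, is even, has a single zero in ]0, L/2[ and satisfies
   y'(L/2) < 0, so that it is not periodic and the kernel of D is spanned by (phi', - c phi').
   Split an eigenfunction of a negative eigenvalue into its odd and even parts about L/2. Picone's
   identity with phi' excludes the odd part, and Picone's identity with y on both sides of its
   zero makes the form nonnegative on the even functions whose first component vanishes at
   that zero, hence on a subspace of codimension one. A negative eigenvalue exists because the
   determinant of the derivatives at L/2 of the solutions with Neumann data at 0 is negative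
   for mu = 0 and positive for very negative mu.
   Weak eigenfunctions are classical solutions by du Bois-Reymond's lemma, and the Wronskian
   excludes nonreal eigenvalues. Eigenvalues do not accumulate, since normalised Cauchy data of
   eigenfunctions would cluster at those of an eigenfunction orthogonal to itself. Away from the
   eigenvalues the matrix mapping Cauchy data at 0 to the defect of periodicity is invertible,
   which gives the resolvent and its bound. *)

(** * Calculus on the real line *)

(** The decisive sign is that of y'(L/2). It expresses that the period of the orbits of the profile
    equation increases with their energy. To avoid differentiating elliptic integrals in a
    parameter, y is written in closed form with N = V / V'^2, V being the potential of the profile
    equation, and with the primitive of N''(phi) phi'^2; the sign then follows from N'' > 0. Linear
    Cauchy problems on the whole line take the place of variational methods and of compactness of
    the resolvent: existence of eigenvalues, solvability and bounds all become statements on finite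
    matrices of Cauchy data. Complex functions are split into real and imaginary parts, which gives
    real systems of size two or four. Two obstacles shape the details. The right-hand side of the
    resolvent equation is only square integrable, so its second primitive is subtracted from the
    unknown; what remains solves a system with continuous forcing. And the quotient in Picone's
    identity degenerates where phi' or y vanishes, which forces limits at the end points and
    explains the zero imposed there on the first component. *)

Section Calculus.
Variable R : realType.
Implicit Types (f g : R -> R) (a b x : R).
Local Notation mu := (@lebesgue_measure R).

Definition D1 f x (d : R) : Prop := is_derive x (1 : R) f d.

Definition der f g := forall x, D1 f x (g x).

Lemma D1_eq f x (d d' : R) : D1 f x d -> d = d' -> D1 f x d'.
Proof. by move=> + <-. Qed.

Lemma D1_ext f g x (d : R) :
  (forall y, f y = g y) -> D1 f x d -> D1 g x d.
Proof. by move=> /funext ->. Qed.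

Lemma D1_cst (c : R) x : D1 (fun=> c) x (0 : R).
Proof. exact: is_derive_cst. Qed.

Lemma D1_id x : D1 (fun y : R => y) x (1 : R).
Proof. exact: is_derive_id. Qed.

Lemma D1_add f g x (df dg : R) : D1 f x df -> D1 g x dg ->
  D1 (fun y : R => f y + g y) x (df + dg).
Proof. by move=> hf hg; exact: is_deriveD. Qed.

Lemma D1_opp f x (df : R) : D1 f x df ->
  D1 (fun y : R => - f y) x (- df).
Proof. by move=> hf; exact: is_deriveN. Qed.

Lemma D1_mul f g x (df dg : R) : D1 f x df -> D1 g x dg ->
  D1 (fun y : R => f y * g y) x (df * g x + f x * dg).
Proof.
by move=> hf hg; apply: D1_eq (is_deriveM hf hg) _; rewrite /GRing.scale /=; ring.
Qed.

Lemma D1_exp f n x (df : R) : D1 f x df ->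
  D1 (fun y : R => f y ^+ n) x (n%:R * f x ^+ n.-1 * df).
Proof.
move=> hf; have H := @is_deriveX R R f n x (1 : R) df hf.
have E : f ^+ n = (fun y : R => f y ^+ n).
  by apply/funext => y; elim: n {H} => [|n IH] //=; rewrite !exprS -IH.
by rewrite -E; apply: D1_eq H _.
Qed.

Lemma D1_inv f x (df : R) : f x != 0 -> D1 f x df ->
  D1 (fun y : R => (f y)^-1) x (- df / f x ^+ 2).
Proof.
move=> h0 hf; apply: D1_eq (is_deriveV h0 hf) _.
by rewrite /GRing.scale /= mulNr mulrC mulNr.
Qed.

Lemma D1_comp f g x (df dg : R) : D1 f (g x) df -> D1 g x dg ->
  D1 (fun y : R => f (g y)) x (df * dg).
Proof. by move=> hf hg; exact: is_derive1_comp. Qed.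

Lemma D1_sqrt f x (df : R) : 0 < f x -> D1 f x df ->
  D1 (fun y : R => Num.sqrt (f y)) x ((2 * Num.sqrt (f x))^-1 * df).
Proof. by move=> h hf; apply: D1_comp hf; exact: is_derive1_sqrt. Qed.

Lemma D1_sin f x (df : R) : D1 f x df ->
  D1 (fun y : R => sin (f y)) x (cos (f x) * df).
Proof. by move=> hf; apply: D1_comp hf; exact: is_derive_sin. Qed.

Lemma D1_cos f x (df : R) : D1 f x df ->
  D1 (fun y : R => cos (f y)) x (- sin (f x) * df).
Proof. by move=> hf; apply: D1_comp hf; exact: is_derive_cos. Qed.

Lemma D1_expR f x (df : R) : D1 f x df ->
  D1 (fun y : R => expR (f y)) x (expR (f x) * df).
Proof. by move=> hf; apply: D1_comp hf; exact: is_derive_expR. Qed.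

Lemma D1_mull (c : R) x : D1 ( *%R c) x c.
Proof. by apply: D1_eq (D1_mul (D1_cst c x) (D1_id x)) _; ring. Qed.

Lemma D1_addl (c : R) x : D1 ( +%R c) x (1 : R).
Proof. by apply: D1_eq (D1_add (D1_cst c x) (D1_id x)) _; ring. Qed.

Lemma D1_sin1 x : D1 (@sin R) x (cos x).
Proof. exact: is_derive_sin. Qed.

Lemma D1_cos1 x : D1 (@cos R) x (- sin x).
Proof. exact: is_derive_cos. Qed.

Lemma D1_expR1 x : D1 (@expR R) x (expR x).
Proof. exact: is_derive_expR. Qed.

Lemma D1_opp1 x : D1 (@GRing.opp R) x (- 1 : R).
Proof. exact: D1_opp (D1_id x). Qed.

End Calculus.

Ltac D1_hyp := match goal with
  | H : der ?f _ |- D1 ?f _ _ => exact: H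
  | H : der ?f _ |- D1 (fun x => ?f x) _ _ => exact: H
  end.

(** Nonvanishing and positivity conditions are left as goals. The partially applied operations among
    the last alternatives cover bodies that have been eta-reduced. *)
Ltac D1_tac :=
  match goal with
  | |- D1 (fun _ => ?c) _ _ => exact: D1_cst
  | _ => lazymatch goal with
  | |- D1 (fun x => @?f x + @?g x) _ _ => apply: D1_add; D1_tac
  | |- D1 (fun x => - @?f x) _ _ => apply: D1_opp; D1_tac
  | |- D1 (fun x => @?f x * @?g x) _ _ => apply: D1_mul; D1_tac
  | |- D1 (fun x => @?f x ^+ _) _ _ => apply: D1_exp; D1_tac
  | |- D1 (fun x => (@?f x)^-1) _ _ => apply: D1_inv; [ | D1_tac]
  | |- D1 (fun x => Num.sqrt (@?f x)) _ _ => apply: D1_sqrt; [ | D1_tac]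
  | |- D1 (fun x => sin (@?f x)) _ _ => apply: D1_sin; D1_tac
  | |- D1 (fun x => cos (@?f x)) _ _ => apply: D1_cos; D1_tac
  | |- D1 (fun x => expR (@?f x)) _ _ => apply: D1_expR; D1_tac
  | _ => first [D1_hyp | eassumption | exact: D1_id | exact: D1_mull | exact: D1_addl | exact: D1_opp1 | exact: D1_sin1 | exact: D1_cos1 | exact: D1_expR1 | idtac]
  end end.

Ltac D1_solve := apply: D1_eq; [D1_tac | ]; cbv beta.

Section Calculus2.
Variable R : realType.
Implicit Types (f g : R -> R) (a b x : R).
Local Notation mu := (@lebesgue_measure R).

Lemma D1_continuous f x (d : R) : D1 f x d -> {for x, continuous f}.
Proof. by move=> [hd _]; apply/differentiable_continuous/derivable1_diffP. Qed.

Lemma der_continuous f g : der f g -> continuous f.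
Proof. by move=> h x; exact: D1_continuous (h x). Qed.

Lemma der_derive1 f g : der f g -> derive1 f = g.
Proof. by move=> h; apply/funext => x; rewrite derive1E; have [_ <-] := h x. Qed.

Lemma der_cst_eq f g f0 x : der f g -> der f0 g -> f x - f0 x = f 0 - f0 0.
Proof.
move=> h1 h2; apply: (@is_derive_0_is_cst _ (fun y => f y - f0 y)) => y.
by D1_solve; rewrite subrr.
Qed.

Lemma MVT_le f g a b : a <= b -> (forall x, a <= x <= b -> D1 f x (g x)) ->
  exists2 c, a <= c <= b & f b - f a = g c * (b - a).
Proof.
move=> ab h.
have [||c cab ->] := @MVT_segment R f g a b ab.
- by move=> x; rewrite in_itv /= => /andP[/ltW xa /ltW xb]; apply: h; rewrite xa xb.
- apply: derivable_within_continuous => x; rewrite in_itv /= => xab.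
  by have [] := h _ xab.
by exists c => //; move: cab; rewrite in_itv.
Qed.

Lemma MVT_lt f g a b : a < b -> (forall x, a <= x <= b -> D1 f x (g x)) ->
  exists2 c, a < c < b & f b - f a = g c * (b - a).
Proof.
move=> ab h.
have [||c cab ->] := @MVT R f g a b ab.
- by move=> x; rewrite in_itv /= => /andP[/ltW xa /ltW xb]; apply: h; rewrite xa xb.
- apply: derivable_within_continuous => x; rewrite in_itv /= => xab.
  by have [] := h _ xab.
by exists c => //; move: cab; rewrite in_itv.
Qed.

Lemma D1_ndecr f g a b : a <= b ->
  (forall x, a <= x <= b -> D1 f x (g x)) ->
  (forall x, a < x < b -> 0 <= g x) -> f a <= f b.
Proof.
move=> ab h hg; case: (ltgtP a b) ab => // [ab _|-> //].
have [c cab E] := MVT_lt ab h.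
by rewrite -subr_ge0 E mulr_ge0 ?subr_ge0 ?(ltW ab) // hg.
Qed.

Lemma D1_incr f g a b : a < b ->
  (forall x, a <= x <= b -> D1 f x (g x)) ->
  (forall x, a < x < b -> 0 < g x) -> f a < f b.
Proof.
move=> ab h hg; have [c cab E] := MVT_lt ab h.
by rewrite -subr_gt0 E mulr_gt0 ?subr_gt0 // hg.
Qed.

Lemma der_ndecr f g a b : a <= b -> der f g ->
  (forall x, a < x < b -> 0 <= g x) -> f a <= f b.
Proof. by move=> ab h; apply: D1_ndecr. Qed.

Lemma der_incr f g a b : a < b -> der f g ->
  (forall x, a < x < b -> 0 < g x) -> f a < f b.
Proof. by move=> ab h; apply: D1_incr. Qed.

Lemma IVT0 f a b : a <= b -> continuous f -> f a * f b <= 0 ->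
  exists2 c, a <= c <= b & f c = 0.
Proof.
move=> ab cf h.
have [|c cab fc0] := @IVT R f a b 0 ab (continuous_subspaceT cf).
  by case: (leP (f a) (f b)) => fab; rewrite ?ge_min ?le_max; nra.
by exists c => //; move: cab; rewrite in_itv.
Qed.

Lemma continuous_itv_bounded f a b : continuous f ->
  exists2 M, 1 <= M & forall x, a <= x <= b -> `|f x| <= M.
Proof.
move=> cf; case: (leP a b) => ab; last first.
  by exists 1 => // x /andP[h1 h2]; have := le_trans h1 h2; rewrite leNgt ab.
have [|c cab hc] := @EVT_max R (fun x => `|f x|) a b ab.
  by apply: continuous_subspaceT => x; apply: continuous_comp; [exact: cf|exact: norm_continuous].
exists (1 + `|f c|) => [|x xab]; first by rewrite lerDl normr_ge0.
have : x \in `[a, b] by rewrite in_itv.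
by move=> /hc /le_trans; apply; rewrite lerDr.
Qed.

Lemma continuous_gt0_near f x : continuous f -> 0 < f x ->
  exists2 e, 0 < e & forall y, `|y - x| < e -> 0 < f y.
Proof.
move=> cf fx0; have := cf x; move/cvgrPdist_lt/(_ _ fx0) => [e /= e0 he].
exists e => // y hy; have := he y; rewrite /ball /= distrC => /(_ hy).
by rewrite ltr_norml => /andP[_]; rewrite ltrBlDr ltrDl.
Qed.

(** If f were positive at x, it would be positive on a subinterval [c, d] of [a, b], and F would
    increase strictly across it, against F b <= F a. *)
Lemma der_ge0_eq0 F f a b : a < b -> der F f -> continuous f ->
  (forall x, a <= x <= b -> 0 <= f x) -> F b <= F a ->
  forall x, a <= x <= b -> f x = 0.
Proof.
move=> ab dF cf f0 Fba x /andP[ax xb].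
apply/eqP; rewrite eq_le f0 ?ax ?xb // andbT leNgt; apply/negP => fx0.
have [e e0 he] := continuous_gt0_near cf fx0.
pose c := Num.max a (x - e / 2); pose d := Num.min b (x + e / 2).
have xc : x - e / 2 <= c by rewrite le_max lexx orbT.
have xd : d <= x + e / 2 by rewrite ge_min lexx orbT.
have ac : a <= c by rewrite le_max lexx.
have db : d <= b by rewrite ge_min lexx.
have cd : c < d.
  rewrite gt_max !lt_min ab /=; apply/andP; split; first by lra.
  by apply/andP; split; lra.
have cx : c <= x by rewrite ge_max ax /=; lra.
have dx : x <= d by rewrite le_min xb /=; lra.
have h1 : F a <= F c by apply: (der_ndecr ac dF) => y /andP[y1 y2]; apply: f0; lra.
have h2 : F d <= F b by apply: (der_ndecr db dF) => y /andP[y1 y2]; apply: f0; lra.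
have h3 : F c < F d.
  apply: (der_incr cd dF) => y /andP[y1 y2]; apply: he.
  by rewrite ltr_norml; lra.
lra.
Qed.

Definition lint f := forall a b, mu.-integrable `[a, b] (EFin \o f).

Lemma continuous_lint f : continuous f -> lint f.
Proof.
move=> cf a b; apply: continuous_compact_integrable; first exact: segment_compact.
exact: continuous_subspaceT.
Qed.

(** Oriented in the same way as [ellipticF], which is thus an instance of it by conversion. *)
Definition prim f x : R :=
  if 0 <= x then \int[mu]_(t in `[0, x]) f t else - \int[mu]_(t in `[x, 0]) f t.

Lemma prim0 f : prim f 0 = 0.
Proof. by rewrite /prim lexx set_itv1 Rintegral_set1. Qed.

Lemma Rintegral_chasles f a b c : lint f -> a <= b -> b <= c ->
  \int[mu]_(t in `[a, c]) f t = \int[mu]_(t in `[a, b]) f t + \int[mu]_(t in `[b, c]) f t.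
Proof.
move=> lf ab bc; have := @Rintegral_itvB R f (BLeft a) (BRight c) b (lf a c).
rewrite !bnd_simp => /(_ ab bc) E.
rewrite -(@Rintegral_itv_obnd_cbnd R b (BRight c)); last first.
  by apply: integrableS (lf b c) => //; exact: subset_itv_oc_cc.
by rewrite -E; ring.
Qed.

(** A base point to the left of both 0 and x removes the case distinction, so that results on
    integrals with a fixed lower bound apply. *)
Lemma primE f c x : lint f -> c <= 0 -> c <= x ->
  prim f x = \int[mu]_(t in `[c, x]) f t - \int[mu]_(t in `[c, 0]) f t.
Proof.
move=> lf c0 cx; rewrite /prim; case: leP => x0.
  by rewrite (Rintegral_chasles lf c0 x0); ring.
by rewrite (Rintegral_chasles lf cx (ltW x0)); ring.
Qed.

Lemma primB f a b : lint f -> a <= b -> prim f b - prim f a = \int[mu]_(t in `[a, b]) f t.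
Proof.
move=> lf ab; pose c := Num.min 0 a.
have c0 : c <= 0 by rewrite ge_min lexx.
have ca : c <= a by rewrite ge_min lexx orbT.
rewrite (primE lf c0 ca) (primE lf c0 (le_trans ca ab)).
by rewrite (Rintegral_chasles lf ca ab); ring.
Qed.

Lemma prim_continuous f : lint f -> continuous (prim f).
Proof.
move=> lf x; pose c := Num.min 0 x - 1.
have c0 : c < 0 by rewrite /c; apply: (@lt_le_trans _ _ (Num.min 0 x)); [lra|rewrite ge_min lexx].
have cx : c < x by rewrite /c; apply: (@lt_le_trans _ _ (Num.min 0 x)); [lra|rewrite ge_min lexx orbT].
have cx1 : c < x + 1 by lra.
have H := parameterized_integral_continuous (ltW cx1) (lf c (x + 1)).
have [H1 _ _] := (continuous_within_itvP _ cx1).1 H.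
have Hx : {for x, continuous (fun y => \int[mu]_(t in `[c, y]) f t - \int[mu]_(t in `[c, 0]) f t)}.
  apply: continuousB; last exact: cst_continuous.
  by apply: (H1 x); rewrite in_itv /= cx /= ltrDl.
rewrite /continuous_at (primE lf (ltW c0) (ltW cx)).
apply: (cvg_trans _ Hx); apply: near_eq_cvg; near=> y.
rewrite -primE //; first exact: ltW.
by apply: ltW; near: y; exact: lt_nbhsr.
Unshelve. all: by end_near. Qed.

Lemma prim_der f : continuous f -> der (prim f) f.
Proof.
move=> cf x; have lf := continuous_lint cf.
pose c := Num.min 0 x - 1.
have c0 : c < 0 by rewrite /c; apply: (@lt_le_trans _ _ (Num.min 0 x)); [lra|rewrite ge_min lexx].
have cx : c < x by rewrite /c; apply: (@lt_le_trans _ _ (Num.min 0 x)); [lra|rewrite ge_min lexx orbT].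
have xx1 : x < x + 1 by lra.
have [H1 H2] := @continuous_FTC1_closed R f c x (x + 1) xx1 (lf c (x + 1)) cx (cf x).
have e1 : D1 (fun y => \int[mu]_(t in `[c, y]) f t) x (f x).
  by apply: (DeriveDef H1); rewrite -derive1E; exact: H2.
have := D1_add e1 (D1_cst (- \int[mu]_(t in `[c, 0]) f t) x); rewrite addr0.
apply: near_eq_is_derive; near=> y; have cy : c <= y by apply: ltW; near: y; exact: lt_nbhsr.
by rewrite (primE lf (ltW c0) cy).
Unshelve. all: by end_near. Qed.

Lemma prim_unique F f x : continuous f -> der F f -> F x - F 0 = prim f x.
Proof.
move=> cf dF; have := der_cst_eq x dF (prim_der cf).
by rewrite prim0 subr0 => <-; ring.
Qed.

Lemma prim_zero x : prim (fun=> 0) x = 0.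
Proof.
by rewrite -(@prim_unique (fun=> 0) (fun=> 0)) ?subrr // => y; [exact: cst_continuous|exact: D1_cst].
Qed.

Lemma Rintegral_der F f a b : a <= b -> continuous f -> der F f ->
  \int[mu]_(t in `[a, b]) f t = F b - F a.
Proof.
move=> ab cf dF; rewrite -(primB (continuous_lint cf) ab).
by rewrite -!(prim_unique _ cf dF); ring.
Qed.

Lemma D1_sum (I : Type) (r : seq I) (F : I -> R -> R) (dF : I -> R) (x : R) :
  (forall i, D1 (F i) x (dF i)) ->
  D1 (fun y => \sum_(i <- r) F i y) x (\sum_(i <- r) dF i).
Proof.
move=> h; elim: r => [|i r IH].
  by rewrite big_nil; apply: D1_ext (D1_cst 0 x) => y; rewrite big_nil.
rewrite big_cons; apply: D1_ext (D1_add (h i) IH) => y.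
by rewrite big_cons.
Qed.

Lemma cont_add f g : continuous f -> continuous g -> continuous (fun x => f x + g x).
Proof. by move=> hf hg x; apply: continuousD; [exact: hf|exact: hg]. Qed.

Lemma cont_opp f : continuous f -> continuous (fun x => - f x).
Proof. by move=> hf x; apply: continuousN; exact: hf. Qed.

Lemma cont_mul f g : continuous f -> continuous g -> continuous (fun x => f x * g x).
Proof. by move=> hf hg x; apply: continuousM; [exact: hf|exact: hg]. Qed.

Lemma cont_cst (c : R) : continuous (fun _ : R => c).
Proof. by move=> x; exact: cst_continuous. Qed.

Lemma cont_id : continuous (fun x : R => x).
Proof. by move=> x; exact: cvg_id. Qed.

Lemma cont_comp f g : continuous f -> continuous g -> continuous (fun x => f (g x)).
Proof. by move=> hf hg x; apply: continuous_comp; [exact: hg|exact: hf]. Qed.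

Lemma cont_exp f n : continuous f -> continuous (fun x => f x ^+ n).
Proof. by move=> hf; apply: (@cont_comp (fun y => y ^+ n)) => // x; exact: exprn_continuous. Qed.

Lemma cont_sum (I : Type) (r : seq I) (F : I -> R -> R) :
  (forall i, continuous (F i)) -> continuous (fun x => \sum_(i <- r) F i x).
Proof.
move=> h; elim: r => [|i r IH].
  rewrite (_ : (fun x => _) = (fun=> 0)); first exact: cont_cst.
  by apply/funext => x; rewrite big_nil.
rewrite (_ : (fun x => _) = (fun x => F i x + \sum_(j <- r) F j x)).
  by apply: cont_add.
by apply/funext => x; rewrite big_cons.
Qed.

Lemma prim_lin (c d : R) f g x : continuous f -> continuous g ->
  prim (fun t => c * f t + d * g t) x = c * prim f x + d * prim g x.
Proof.
move=> cf cg; have hf := prim_der cf; have hg := prim_der cg.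
have H : der (fun y => c * prim f y + d * prim g y) (fun y => c * f y + d * g y).
  by move=> y; D1_solve; ring.
rewrite -(prim_unique x _ H) ?prim0; first by ring.
by apply: cont_add; apply: cont_mul => //; exact: cont_cst.
Qed.

Lemma primD f g x : continuous f -> continuous g ->
  prim (fun t => f t + g t) x = prim f x + prim g x.
Proof.
move=> cf cg; rewrite -[prim f x]mul1r -[prim g x]mul1r -prim_lin //.
by congr prim; apply/funext => t; rewrite !mul1r.
Qed.

(** In the norm weighted by expR (k |x|), integration from 0 costs a factor 1 / k, which is what
    makes the Picard series converge on intervals of any length. On each side of 0 the bound times
    the weight, plus or minus the primitive, is monotone. *)
Lemma prim_exp_bound f (A k X : R) x : continuous f -> 0 <= A -> 0 < k ->
  (forall t, `|t| <= X -> `|f t| <= A * expR (k * `|t|)) -> `|x| <= X ->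
  `|prim f x| <= A / k * expR (k * `|x|).
Proof.
move=> cf A0 k0 hf xX; have dp := prim_der cf.
have k1 : k != 0 by rewrite gt_eqF.
have Ak : 0 <= A / k by rewrite divr_ge0 // ltW.
case: (leP 0 x) => x0.
  move: (xX); rewrite ger0_norm // => xX'.
  have hb (t : R) : 0 < t < x -> `|f t| <= A * expR (k * t).
    move=> /andP[t0 tx]; have := hf t; rewrite gtr0_norm //; apply.
    exact: le_trans (ltW tx) xX'.
  have h1 : der (fun t => A / k * expR (k * t) + prim f t) (fun t => A * expR (k * t) + f t).
    by move=> t; D1_solve; field.
  have h2 : der (fun t => A / k * expR (k * t) - prim f t) (fun t => A * expR (k * t) - f t).
    by move=> t; D1_solve; field.
  have := der_ndecr x0 h1; have := der_ndecr x0 h2.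
  rewrite /= prim0 mulr0 expR0 => H2 H1.
  have {}H1 : A / k * 1 + 0 <= A / k * expR (k * x) + prim f x.
    by apply: H1 => t /hb; rewrite ler_norml => /andP[]; lra.
  have {}H2 : A / k * 1 - 0 <= A / k * expR (k * x) - prim f x.
    by apply: H2 => t /hb; rewrite ler_norml => /andP[]; lra.
  by rewrite ler_norml; apply/andP; split; lra.
move: (xX); rewrite ltr0_norm // => xX'.
have hb (t : R) : x < t < 0 -> `|f t| <= A * expR (- (k * t)).
  move=> /andP[xt t0]; have := hf t; rewrite ltr0_norm // mulrN; apply; lra.
have h1 : der (fun t => - (A / k * expR (- (k * t)) + prim f t)) (fun t => A * expR (- (k * t)) - f t).
  by move=> t; D1_solve; field.
have h2 : der (fun t => - (A / k * expR (- (k * t)) - prim f t)) (fun t => A * expR (- (k * t)) + f t).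
  by move=> t; D1_solve; field.
have := der_ndecr (ltW x0) h1; have := der_ndecr (ltW x0) h2.
rewrite /= prim0 mulr0 oppr0 expR0 !lerN2 mulrN => H2 H1.
have {}H1 : A / k * 1 + 0 <= A / k * expR (- (k * x)) + prim f x.
  by apply: H1 => t /hb; rewrite ler_norml => /andP[]; lra.
have {}H2 : A / k * 1 + 0 <= A / k * expR (- (k * x)) - prim f x.
  by apply: H2 => t /hb; rewrite ler_norml => /andP[]; lra.
by rewrite ler_norml; apply/andP; split; lra.
Qed.

End Calculus2.

Ltac cont_tac :=
  lazymatch goal with
  | |- {for ?y, continuous ?f} => let H := fresh in have H : continuous f; [cont_tac | exact: H]
  | |- continuous (fun x => @?f x + @?g x) => apply: cont_add; cont_tac
  | |- continuous (fun x => - @?f x) => apply: cont_opp; cont_tac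
  | |- continuous (fun x => @?f x * @?g x) => apply: cont_mul; cont_tac
  | |- continuous (fun x => @?f x ^+ _) => apply: cont_exp; cont_tac
  | _ => first [eassumption | exact: cont_cst | exact: cont_id
     | (match goal with H : der ?f _ |- _ => exact: (der_continuous H) end) | idtac]
  end.

(** * Linear second-order systems *)

Section LinearODE.
Variables (R : realType) (I : finType).
Implicit Types (K : I -> I -> R -> R) (w v b : I -> R -> R) (f g : R -> R) (x : R).

Definition lin K w (i : I) (x : R) : R := \sum_j K i j x * w j x.

Definition ode2 K b w w1 :=
  forall i, der (w i) (w1 i) /\ der (w1 i) (fun x => lin K w i x + b i x).

Definition energy w w1 x : R := \sum_i (w i x ^+ 2 + w1 i x ^+ 2).

Lemma energy_ge0 w w1 x : 0 <= energy w w1 x.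
Proof. by apply: sumr_ge0 => i _; rewrite addr_ge0 ?sqr_ge0. Qed.

Lemma energy_ge w w1 x i : w i x ^+ 2 <= energy w w1 x /\ w1 i x ^+ 2 <= energy w w1 x.
Proof.
rewrite /energy (bigD1 i) //=.
have : 0 <= \sum_(j | j != i) (w j x ^+ 2 + w1 j x ^+ 2).
  by apply: sumr_ge0 => j _; rewrite addr_ge0 ?sqr_ge0.
by have := sqr_ge0 (w i x); have := sqr_ge0 (w1 i x); lra.
Qed.

Definition erate (M : R) : R := 2 + #|I|%:R * M.

(** Gronwall's argument: by the inequality 2 p q <= p ^ 2 + q ^ 2 the energy E has E' <= k (E + c),
    so that expR (- k (y - a)) (E + c) is nonincreasing. *)
Lemma energy_bound K b w w1 (M B a X x : R) : ode2 K b w w1 -> 0 <= M ->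
  (forall i j y, a <= y <= X -> `|K i j y| <= M) ->
  (forall i y, a <= y <= X -> `|b i y| <= B) -> a <= x <= X ->
  energy w w1 x <= expR (erate M * (x - a)) * (energy w w1 a + #|I|%:R * B ^+ 2).
Proof.
move=> hode M0 hK hb /andP[ax xX].
pose k := erate M; pose c : R := #|I|%:R * B ^+ 2.
pose F y := - (expR (- (k * (y - a))) * (energy w w1 y + c)).
pose dE y := \sum_i (2 * w i y * w1 i y + 2 * w1 i y * (lin K w i y + b i y)).
have hE : der (energy w w1) dE.
  move=> y; apply: D1_sum => i; have [h1 h2] := hode i.
  by D1_solve; rewrite /= !expr1; ring.
have hF : der F (fun y => expR (- (k * (y - a))) * (k * (energy w w1 y + c) - dE y)).
  by move=> y; rewrite /F; D1_solve; ring.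
have H : F a <= F x.
  apply: (der_ndecr ax hF) => y /andP[ay yx].
  have yaX : a <= y <= X by rewrite (ltW ay) (le_trans (ltW yx) xX).
  apply: mulr_ge0; first exact: expR_ge0.
  rewrite subr_ge0.
  (* One of the 2 + #|I| M copies of c pays for the squares B ^ 2 of the forcing; the others are
     nonnegative and are dropped. *)
  have -> : k * (energy w w1 y + c) = \sum_i (2 * (w i y ^+ 2 + w1 i y ^+ 2)
      + M * (#|I|%:R * w1 i y ^+ 2 + \sum_j w j y ^+ 2) + B ^+ 2)
      + (1 + #|I|%:R * M) * c.
    have e1 : \sum_(i : I) (\sum_j w j y ^+ 2) = #|I|%:R * \sum_i w i y ^+ 2.
      by rewrite sumr_const mulr_natl.
    have e2 : \sum_(i : I) B ^+ 2 = c by rewrite sumr_const /c mulr_natl.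
    rewrite !big_split /= e2 -!mulr_sumr !big_split /= -!mulr_sumr e1.
    by rewrite /k /erate /energy big_split /=; ring.
  have c0 : 0 <= c by rewrite mulr_ge0 ?ler0n ?sqr_ge0.
  have nM0 : 0 <= #|I|%:R * M by rewrite mulr_ge0 ?ler0n.
  rewrite -[leLHS]addr0; apply: lerD; last by rewrite mulr_ge0 //; lra.
  apply: ler_sum => i _.
  have h1 : 2 * w i y * w1 i y <= w i y ^+ 2 + w1 i y ^+ 2.
    by rewrite -subr_ge0; have := sqr_ge0 (w i y - w1 i y); lra.
  have h2 : 2 * w1 i y * b i y <= w1 i y ^+ 2 + B ^+ 2.
    have := hb i y yaX; rewrite ler_norml => /andP[b1 b2].
    have : b i y ^+ 2 <= B ^+ 2 by nra.
    by have := sqr_ge0 (w1 i y - b i y); lra.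
  have h3 : 2 * w1 i y * lin K w i y <= M * (#|I|%:R * w1 i y ^+ 2 + \sum_j w j y ^+ 2).
    have e3 : #|I|%:R * w1 i y ^+ 2 = \sum_(j : I) w1 i y ^+ 2 by rewrite sumr_const mulr_natl.
    rewrite e3 -big_split /= /lin !mulr_sumr; apply: ler_sum => j _.
    have := hK i j y yaX; rewrite ler_norml => /andP[k1 k2].
    have : 0 <= (M - K i j y) * (w1 i y + w j y) ^+ 2.
      by rewrite mulr_ge0 ?sqr_ge0 //; lra.
    have : 0 <= (M + K i j y) * (w1 i y - w j y) ^+ 2.
      by rewrite mulr_ge0 ?sqr_ge0 //; lra.
    by lra.
  by have := sqr_ge0 (w i y); lra.
move: H; rewrite /F subrr mulr0 oppr0 expR0 mul1r lerN2 expRN => H.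
have c0 : 0 <= c by rewrite mulr_ge0 ?ler0n ?sqr_ge0.
have := expR_gt0 (k * (x - a)) => e0.
have : expR (k * (x - a)) * ((expR (k * (x - a)))^-1 * (energy w w1 x + c))
    <= expR (k * (x - a)) * (energy w w1 a + c) by rewrite ler_pM2l.
by rewrite mulrA divff ?gt_eqF // mul1r -/k -/c; lra.
Qed.

Lemma ode2_lin K (b b' : I -> R -> R) w w1 v v1 (c d : R) :
  ode2 K b w w1 -> ode2 K b' v v1 ->
  ode2 K (fun i x => c * b i x + d * b' i x) (fun i x => c * w i x + d * v i x)
    (fun i x => c * w1 i x + d * v1 i x).
Proof.
move=> hw hv i; have [h1 h2] := hw i; have [h3 h4] := hv i; split.
  by move=> x; D1_solve; ring.
move=> x; D1_solve.
have -> : lin K (fun j y => c * w j y + d * v j y) i x = c * lin K w i x + d * lin K v i x.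
  by rewrite /lin !mulr_sumr -big_split /=; apply: eq_bigr => j _; ring.
by ring.
Qed.

Lemma lin_continuous K w i : (forall i j, continuous (K i j)) ->
  (forall i, continuous (w i)) -> continuous (lin K w i).
Proof. by move=> hK hw; apply: cont_sum => j; apply: cont_mul. Qed.

Lemma bound_family (J : finType) (f : J -> R -> R) (a X : R) :
  (forall j, continuous (f j)) ->
  exists2 M, 1 <= M & forall j x, a <= x <= X -> `|f j x| <= M.
Proof.
move=> hf; have /choice[g hg] : forall j : J, exists y : R,
    1 <= y /\ forall x, a <= x <= X -> `|f j x| <= y.
  by move=> j; have [M M1 hM] := continuous_itv_bounded a X (hf j); exists M.
exists (1 + \sum_j g j).
  by rewrite lerDl sumr_ge0 // => j _; have [] := hg j; lra.
move=> j x hx; have [g1 /(_ _ hx) h] := hg j; apply: le_trans h _.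
rewrite (bigD1 j) //=; have : 0 <= \sum_(i | i != j) g i.
  by apply: sumr_ge0 => i _; have [] := hg i; lra.
by lra.
Qed.

(** Every lower end u m - c / 2 ^ m lies below every upper end u n + c / 2 ^ n, so the supremum of
    the lower ends belongs to all these intervals and is the limit. *)
Lemma geometric_cauchy (u : nat -> R) (c : R) :
  (forall m n, (m <= n)%N -> `|u n - u m| <= c / 2 ^+ m) ->
  forall m, `|limn u - u m| <= c / 2 ^+ m.
Proof.
move=> hu.
have c0 : 0 <= c by have := hu 0%N 0%N (leqnn _); rewrite subrr normr0 expr0 divr1.
have mono m n : (m <= n)%N -> c / 2 ^+ n <= c / 2 ^+ m.
  move=> mn; rewrite ler_wpM2l // lef_pV2 ?posrE ?exprn_gt0 //.
  by rewrite ler_weXn2l // ler1n.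
have key m n : u m - c / 2 ^+ m <= u n + c / 2 ^+ n.
  have cm k : 0 <= c / 2 ^+ k by rewrite divr_ge0 // exprn_ge0.
  case: (leqP m n) => mn.
    by have := hu _ _ mn; rewrite ler_norml => /andP[]; have := cm n; lra.
  by have := hu _ _ (ltnW mn); rewrite ler_norml => /andP[]; have := cm m; lra.
pose A := [set u m - c / 2 ^+ m | m in [set: nat]].
have supA : has_sup A.
  split; first by exists (u 0%N - c / 2 ^+ 0); exists 0%N.
  by exists (u 0%N + c / 2 ^+ 0) => _ [m _ <-].
have hl m : `|sup A - u m| <= c / 2 ^+ m.
  have h1 : u m - c / 2 ^+ m <= sup A by apply: sup_upper_bound => //; exists m.
  have h2 : sup A <= u m + c / 2 ^+ m by apply: ge_sup; [case: supA|move=> _ [n _ <-]].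
  by rewrite ler_norml; apply/andP; split; lra.
suff -> : limn u = sup A by [].
apply: cvg_lim => //; apply/cvgrPdist_le => e e0.
have : geometric c (2^-1 : R) @ \oo --> (0 : R).
  by apply: cvg_geometric; rewrite ger0_norm ?invr_ge0 // invf_lt1 // ltr1n.
move/cvgrPdist_le/(_ _ e0); apply: filterS => m /=.
rewrite sub0r normrN => h; apply: le_trans (hl m) (le_trans _ h).
by rewrite exprVn; exact: ler_norm.
Qed.

Section Picard.
Variables (K : I -> I -> R -> R) (w0 : I -> R -> R).
Hypotheses (cK : forall i j, continuous (K i j)) (cw0 : forall i, continuous (w0 i)).

(** The k-th term of the Neumann series; the Picard iterates are its partial sums [psum]. *)
Fixpoint picard (k : nat) : I -> R -> R :=
  if k is k'.+1 then fun i => prim (prim (lin K (picard k') i)) else w0.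

Lemma prim2_continuous f : continuous f -> continuous (@prim R (prim f)).
Proof.
by move=> cf; apply: der_continuous (prim_der _); apply: der_continuous (prim_der cf).
Qed.

Lemma picard_continuous k i : continuous (picard k i).
Proof.
elim: k i => [//|k IH] i; apply: prim2_continuous.
exact: lin_continuous.
Qed.

Fixpoint psum (m : nat) (i : I) (x : R) : R :=
  if m is m'.+1 then psum m' i x + picard m' i x else 0.

Lemma picardS k i x : picard k.+1 i x = prim (prim (lin K (picard k) i)) x.
Proof. by []. Qed.

Lemma psum_rec m i x : psum m.+1 i x = psum m i x + picard m i x.
Proof. by []. Qed.

Arguments psum : simpl never.
Arguments picard : simpl never.

Lemma psum_continuous m i : continuous (psum m i).
Proof.
elim: m => [|m IH]; first exact: cont_cst.
by apply: cont_add => //; exact: picard_continuous.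
Qed.

Lemma lin_psumS m i x : lin K (psum m.+1) i x = lin K (psum m) i x + lin K (picard m) i x.
Proof.
rewrite /lin -big_split /=; apply: eq_bigr => j _.
by rewrite psum_rec mulrDr.
Qed.

Lemma prim2D f g h x : continuous f -> continuous g -> (forall t, h t = f t + g t) ->
  @prim R (prim h) x = prim (prim f) x + prim (prim g) x.
Proof.
move=> cf cg /funext ->; rewrite -primD; last 2 first.
- exact: der_continuous (prim_der cf).
- exact: der_continuous (prim_der cg).
by congr prim; apply/funext => t; rewrite primD.
Qed.

Lemma psumS m i x : psum m.+1 i x = w0 i x + prim (prim (lin K (psum m) i)) x.
Proof.
elim: m => [|m IH].
  rewrite psum_rec /psum /picard add0r.
  have -> : lin K (fun _ _ => 0) i = fun=> 0.
    by apply/funext => t; rewrite /lin big1 // => j _; rewrite mulr0.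
  rewrite (_ : prim (fun=> 0) = fun=> 0) ?prim_zero ?addr0 //.
  by apply/funext => t; exact: prim_zero.
rewrite psum_rec IH picardS -addrA; congr (_ + _).
apply: esym; apply: prim2D.
- by apply: lin_continuous => // j; exact: psum_continuous.
- by apply: lin_continuous => // j; exact: picard_continuous.
- by move=> t; exact: lin_psumS.
Qed.

Lemma norm_itv (X x : R) : `|x| <= X -> - X <= x <= X.
Proof. by rewrite ler_norml. Qed.

Lemma lin_bound (M A : R) v i t : 0 <= M ->
  (forall i j, `|K i j t| <= M) -> (forall j, `|v j t| <= A) ->
  `|lin K v i t| <= #|I|%:R * M * A.
Proof.
move=> M0 hM hA; rewrite /lin; apply: le_trans (ler_norm_sum _ _ _) _.
apply: le_trans (_ : \sum_(j : I) M * A <= _).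
  by apply: ler_sum => j _; rewrite normrM; apply: ler_pM.
by rewrite sumr_const -[leLHS]mulr_natl -mulrA.
Qed.

Lemma picard_bound (X : R) : exists2 c, 0 <= c &
  forall k i x, `|x| <= X -> `|picard k i x| <= c / 2 ^+ k.
Proof.
have [M M1 hM] := @bound_family (I * I)%type (fun p => K p.1 p.2) (- X) X (fun p => @cK p.1 p.2).
have [C C1 hC] := @bound_family I w0 (- X) X cw0.
(* As k >= 1 and k >= 2 #|I| M, one application of the matrix and two integrations cost #|I| M / k ^
   2 <= 1 / 2. *)
pose k := 2 * #|I|%:R * M + 1 : R.
have nM : 0 <= #|I|%:R * M by rewrite mulr_ge0 ?ler0n //; lra.
have k0 : 0 < k by rewrite /k; lra.
have key n i x : `|x| <= X -> `|picard n i x| <= C / 2 ^+ n * expR (k * `|x|).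
  elim: n i x => [|n IH] i x xX.
    rewrite expr0 divr1 /picard; apply: le_trans (hC i x (norm_itv xX)) _.
    have : 1 <= expR (k * `|x|) by rewrite -expR0 ler_expR mulr_ge0 // ltW.
    by nra.
  rewrite picardS.
  have A0 : 0 <= C / 2 ^+ n by rewrite divr_ge0 ?exprn_ge0 //; lra.
  have hl t : `|t| <= X -> `|lin K (picard n) i t| <= #|I|%:R * M * (C / 2 ^+ n) * expR (k * `|t|).
    move=> tX; rewrite -mulrA; apply: lin_bound => //; first by lra.
    - by move=> i' j; apply: (hM (i', j)); exact: norm_itv.
    - by move=> j; exact: IH.
  have cl : continuous (lin K (picard n) i).
    by apply: lin_continuous => // j; exact: picard_continuous.
  have B0 : 0 <= #|I|%:R * M * (C / 2 ^+ n) by rewrite mulr_ge0.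
  have h1 t : `|t| <= X -> `|prim (lin K (picard n) i) t| <= #|I|%:R * M * (C / 2 ^+ n) / k * expR (k * `|t|).
    by move=> tX; apply: prim_exp_bound hl tX.
  have cp : continuous (prim (lin K (picard n) i)) := der_continuous (prim_der cl).
  have := prim_exp_bound cp _ k0 h1 xX; rewrite divr_ge0 // ?(ltW k0) // => /(_ isT) h.
  apply: le_trans h _; rewrite ler_pM2r ?expR_gt0 // exprS invfM.
  have -> : #|I|%:R * M * (C / 2 ^+ n) / k / k = (C / 2 ^+ n) * (#|I|%:R * M / k / k).
    by ring.
  have -> : C * (2^-1 / 2 ^+ n) = C / 2 ^+ n * 2^-1 by ring.
  apply: ler_wpM2l => //.
  rewrite ler_pdivrMr // ler_pdivrMr //.
  by rewrite /k in k0 *; nra.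
exists (C * expR (k * X)); first by rewrite mulr_ge0 ?expR_ge0 //; lra.
move=> n i x xX; apply: le_trans (key n i x xX) _.
rewrite mulrAC ler_pM2r ?invr_gt0 ?exprn_gt0 // ler_pM2l; last lra.
by rewrite ler_expR ler_pM2l.
Qed.

Lemma psum_cauchy (c : R) i x : 0 <= c -> (forall k, `|picard k i x| <= c / 2 ^+ k) ->
  forall m n, (m <= n)%N -> `|psum n i x - psum m i x| <= (2 * c) / 2 ^+ m.
Proof.
move=> c0 hk m n /subnKC <-; elim: (n - m)%N => [|p IH].
  by rewrite addn0 subrr normr0 divr_ge0 ?exprn_ge0 // mulr_ge0.
(* Subtracting the tail of the geometric series makes the bound inductive. *)
suff {IH} : `|psum (m + p.+1) i x - psum m i x| <= (2 * c) / 2 ^+ m - (2 * c) / 2 ^+ (m + p.+1).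
  have : 0 <= (2 * c) / 2 ^+ (m + p.+1) by rewrite divr_ge0 ?exprn_ge0 // mulr_ge0.
  by lra.
elim: p.+1 => [|q IH]; first by rewrite addn0 !subrr normr0.
rewrite addnS psum_rec addrAC.
apply: le_trans (ler_normD _ _) _.
have := hk (m + q)%N; rewrite exprS invfM.
set a := (2 ^+ (m + q))^-1 in IH *.
have -> : 2 * c * (2^-1 * a) = c * a by field.
by lra.
Qed.

Definition picard_lim (i : I) (x : R) : R := limn (fun m => psum m i x).

Lemma picard_lim_bound (X : R) : exists2 c, 0 <= c &
  forall m i x, `|x| <= X -> `|picard_lim i x - psum m i x| <= c / 2 ^+ m.
Proof.
have [c c0 hc] := picard_bound X; exists (2 * c); first by rewrite mulr_ge0.
move=> m i x xX; apply: (@geometric_cauchy (fun m => psum m i x)) => p q pq.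
by apply: psum_cauchy => // k; exact: hc.
Qed.

Lemma small_geometric (c e : R) : 0 <= c -> 0 < e -> exists m : nat, c / 2 ^+ m < e.
Proof.
move=> c0 e0.
have : geometric c (2^-1 : R) @ \oo --> (0 : R).
  by apply: cvg_geometric; rewrite ger0_norm ?invr_ge0 // invf_lt1 // ltr1n.
move/cvgrPdist_lt/(_ _ e0) => [m _ /(_ m (leqnn m))] /=.
rewrite sub0r normrN exprVn ger0_norm ?divr_ge0 ?exprn_ge0 // => h.
by exists m.
Qed.

Lemma picard_lim_continuous i : continuous (picard_lim i).
Proof.
move=> x; apply/cvgrPdist_lt => e e0.
have [c c0 hc] := picard_lim_bound (`|x| + 1).
have e3 : 0 < e / 3 by lra.
have [m hm] := small_geometric c0 e3.
have := @psum_continuous m i x; move/cvgrPdist_lt/(_ _ e3) => h.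
near=> y.
have h1 : `|picard_lim i x - psum m i x| < e / 3.
  by apply: le_lt_trans hm; apply: hc; rewrite lerDl.
have h2 : `|picard_lim i y - psum m i y| < e / 3.
  apply: le_lt_trans hm; apply: hc.
  have : `|x - y| < 1 by near: y; exact: (@cvgr_dist_lt _ _ _ (nbhs x) _ id x) (ltr01).
  by have := ler_normB x (x - y); rewrite opprB addrC subrK; lra.
have h3 : `|psum m i x - psum m i y| < e / 3 by near: y.
move: h1 h2 h3; rewrite !ltr_norml => /andP[? ?] /andP[? ?] /andP[? ?].
by apply/andP; split; lra.
Unshelve. all: by end_near. Qed.

(** For every m, both sides are within a constant times 1 / 2 ^ m of [psum m.+1]: the left one by
    [picard_lim_bound], the right one by [psumS] and two integrations of the error. *)
Lemma picard_lim_eq i x :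
  picard_lim i x = w0 i x + prim (prim (lin K picard_lim i)) x.
Proof.
have [c c0 hc] := picard_lim_bound `|x|.
have [M M1 hM] := @bound_family (I * I)%type (fun p => K p.1 p.2) (- `|x|) `|x| (fun p => @cK p.1 p.2).
pose nM : R := #|I|%:R * M; have nM0 : 0 <= nM by rewrite mulr_ge0 ?ler0n //; lra.
have cw := picard_lim_continuous.
have cl : continuous (lin K picard_lim i) by apply: lin_continuous.
suff h m : `|picard_lim i x - (w0 i x + prim (prim (lin K picard_lim i)) x)|
    <= ((1 + nM * expR `|x|) * c) / 2 ^+ m.
  apply/eqP; rewrite -subr_eq0 -normr_eq0; apply/negPn/negP => h0.
  have {}h0 : 0 < `|picard_lim i x - (w0 i x + prim (prim (lin K picard_lim i)) x)|.
    by rewrite lt_def h0 normr_ge0.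
  have C0 : 0 <= (1 + nM * expR `|x|) * c.
    by rewrite mulr_ge0 // addr_ge0 // mulr_ge0 // expR_ge0.
  have [m hm] := small_geometric C0 h0.
  by have := le_lt_trans (h m) hm; rewrite ltxx.
have cs : continuous (lin K (psum m) i).
  by apply: lin_continuous => // j; exact: psum_continuous.
have h1 : `|picard_lim i x - psum m.+1 i x| <= c / 2 ^+ m.
  apply: le_trans (hc m.+1 i x (lexx _)) _.
  rewrite ler_wpM2l // lef_pV2 ?posrE ?exprn_gt0 //.
  by rewrite ler_weXn2l // ler1n.
pose D t := lin K (psum m) i t - lin K picard_lim i t.
have cD : continuous D by rewrite /D; cont_tac.
have A0 : 0 <= nM * (c / 2 ^+ m) by rewrite mulr_ge0 // divr_ge0 // exprn_ge0.
have hD t : `|t| <= `|x| -> `|D t| <= nM * (c / 2 ^+ m) * expR (1 * `|t|).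
  move=> tx; have e1 : 1 <= expR (1 * `|t|) by rewrite mul1r -expR0 ler_expR.
  apply: le_trans (_ : nM * (c / 2 ^+ m) <= _); last by nra.
  have -> : D t = lin K (fun j y => psum m j y - picard_lim j y) i t.
    by rewrite /D /lin -sumrB; apply: eq_bigr => j _; rewrite mulrBr.
  apply: lin_bound => //; first by lra.
  - by move=> i' j; apply: (hM (i', j)); exact: norm_itv.
  - by move=> j; rewrite distrC; exact: hc.
have p0 : (0 : R) < 1 by [].
have h2 t : `|t| <= `|x| -> `|prim D t| <= nM * (c / 2 ^+ m) / 1 * expR (1 * `|t|).
  by move=> tx; apply: prim_exp_bound hD tx.
have cpD := der_continuous (prim_der cD).
have := prim_exp_bound cpD _ p0 h2 (lexx _); rewrite !divr1 => /(_ A0) h3.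
have e2 : prim (prim D) x = prim (prim (lin K (psum m) i)) x - prim (prim (lin K picard_lim i)) x.
  have cpl := der_continuous (prim_der cl); have cps := der_continuous (prim_der cs).
  rewrite -[X in X - _]mul1r -[X in _ - X]mul1r -mulNr -prim_lin //.
  congr prim; apply/funext => t; rewrite -prim_lin //; congr prim; apply/funext => u.
  by rewrite /D mul1r mulN1r.
move: h1 h3; rewrite psumS e2 mul1r => h1 h3.
set P := prim _ _ in h1 h3; set Q := prim _ _ in h3 *.
have -> : picard_lim i x - (w0 i x + Q) = (picard_lim i x - (w0 i x + P)) + (P - Q) by ring.
apply: le_trans (ler_normD _ _) _.
apply: le_trans (lerD h1 h3) _; rewrite le_eqVlt; apply/orP; left; apply/eqP; ring.
Qed.

End Picard.

Lemma ode2_exists K b (p q : I -> R) :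
  (forall i j, continuous (K i j)) -> (forall i, continuous (b i)) ->
  exists w w1, [/\ ode2 K b w w1, forall i, w i 0 = p i & forall i, w1 i 0 = q i].
Proof.
move=> cK cb.
have db i : der (prim (b i)) (b i) := prim_der (cb i).
have db2 i : der (prim (prim (b i))) (prim (b i)) := prim_der (der_continuous (db i)).
pose w0 i x := p i + q i * x + prim (prim (b i)) x.
have dw0 i : der (w0 i) (fun x => q i + prim (b i) x).
  by move=> x; have h := db2 i; rewrite /w0; D1_solve; ring.
have cw0 i : continuous (w0 i) := der_continuous (dw0 i).
pose w := picard_lim K w0.
have cw i : continuous (w i) := @picard_lim_continuous K w0 cK cw0 i.
have cl i : continuous (lin K w i) by apply: lin_continuous.
have dl i : der (prim (lin K w i)) (lin K w i) := prim_der (cl i).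
have dl2 i : der (prim (prim (lin K w i))) (prim (lin K w i)) := prim_der (der_continuous (dl i)).
have wE i x : w i x = w0 i x + prim (prim (lin K w i)) x := @picard_lim_eq K w0 cK cw0 i x.
exists w, (fun i x => q i + prim (b i) x + prim (lin K w i) x); split.
- move=> i; split.
    move=> x; apply: (D1_ext (fun y => esym (wE i y))).
    by have h := dw0 i; have h2 := dl2 i; D1_solve.
  by move=> x; have h := dl i; have h2 := db i; D1_solve; ring.
- by move=> i; rewrite wE /w0 !prim0 mulr0 !addr0.
- by move=> i; rewrite !prim0 !addr0.
Qed.

End LinearODE.

(** * Uniqueness and dependence on the coefficients *)

Section Dependence.
Variables (R : realType) (I : finType).
Implicit Types (K : I -> I -> R -> R) (w v b : I -> R -> R).

Lemma ode2_sub K K' b b' w w1 v v1 : ode2 K b w w1 -> ode2 K' b' v v1 ->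
  ode2 K (fun i x => lin (fun i j x => K i j x - K' i j x) v i x + (b i x - b' i x))
    (fun i x => w i x - v i x) (fun i x => w1 i x - v1 i x).
Proof.
move=> hw hv i; have [h1 h2] := hw i; have [h3 h4] := hv i; split.
  by move=> x; D1_solve; ring.
move=> x; D1_solve; rewrite addrA.
have -> : lin K (fun j y => w j y - v j y) i x = lin K w i x - lin K v i x.
  by rewrite /lin -sumrB; apply: eq_bigr => j _; rewrite mulrBr.
have -> : lin (fun i j x => K i j x - K' i j x) v i x = lin K v i x - lin K' v i x.
  by rewrite /lin -sumrB; apply: eq_bigr => j _; rewrite mulrBl.
by ring.
Qed.

Lemma sqr_le0_eq0 (x : R) : x ^+ 2 <= 0 -> x = 0.
Proof. by move=> h; apply/eqP; rewrite -sqrf_eq0 eq_le h sqr_ge0. Qed.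

Lemma ode2_unique K b b' w w1 v v1 (a X : R) : (forall i j, continuous (K i j)) ->
  ode2 K b w w1 -> ode2 K b' v v1 -> (forall i x, a <= x <= X -> b i x = b' i x) ->
  (forall i, w i a = v i a) -> (forall i, w1 i a = v1 i a) ->
  forall i x, a <= x <= X -> w i x = v i x /\ w1 i x = v1 i x.
Proof.
move=> cK hw hv bb e0 e1 i x hx.
have [M M1 hM] := @bound_family R (I * I)%type (fun p => K p.1 p.2) a X (fun p => @cK p.1 p.2).
have M0 : 0 <= M by lra.
have hd := ode2_sub hw hv.
have b0 (j : I) (t : R) : a <= t <= X -> `|lin (fun i j x => K i j x - K i j x) v j t + (b j t - b' j t)| <= 0.
  move=> ht; rewrite bb // subrr addr0 /lin big1 ?normr0 // => l _.
  by rewrite subrr mul0r.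
have := energy_bound hd M0 (fun i j => hM (i, j)) b0 hx.
set E := energy _ _ a; have -> : E = 0.
  by rewrite /E /energy big1 // => j _; rewrite e0 e1 !subrr expr0n addr0.
rewrite expr0n /= mulr0 addr0 mulr0 => le.
have [l1 l2] := energy_ge (fun i x => w i x - v i x) (fun i x => w1 i x - v1 i x) x i.
by split; apply/eqP; rewrite -subr_eq0; apply/eqP; apply: sqr_le0_eq0;
  [exact: le_trans l1 le|exact: le_trans l2 le].
Qed.

Lemma ode2_zero K w w1 (a X : R) : (forall i j, continuous (K i j)) ->
  ode2 K (fun _ _ => 0) w w1 -> (forall i, w i a = 0) -> (forall i, w1 i a = 0) ->
  forall i x, a <= x <= X -> w i x = 0 /\ w1 i x = 0.
Proof.
move=> cK hw w0 w10; apply: (ode2_unique cK hw (_ : ode2 K (fun _ _ => 0) (fun _ _ => 0) _)) => //.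
move=> i; split=> x; first exact: D1_cst.
by apply: D1_eq (D1_cst 0 x) _; rewrite /lin big1 ?addr0 // => j _; rewrite mulr0.
Qed.

Lemma lin_le (M A : R) K v i x : 0 <= M ->
  (forall i j, `|K i j x| <= M) -> (forall j, `|v j x| <= A) ->
  `|lin K v i x| <= #|I|%:R * (M * A).
Proof. by move=> M0 hM hA; rewrite mulrA; exact: lin_bound. Qed.

(** The difference solves the system of K with forcing (K - K') v, to which [energy_bound]
    applies. *)
Lemma ode2_close K K' w w1 v v1 (M e B a X x : R) :
  ode2 K (fun _ _ => 0) w w1 -> ode2 K' (fun _ _ => 0) v v1 -> 0 <= M -> 0 <= e ->
  (forall i j y, a <= y <= X -> `|K i j y| <= M) ->
  (forall i j y, a <= y <= X -> `|K i j y - K' i j y| <= e) ->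
  (forall i y, a <= y <= X -> `|v i y| <= B) -> a <= x <= X ->
  energy (fun i x => w i x - v i x) (fun i x => w1 i x - v1 i x) x <=
  expR (erate I M * (x - a)) *
    (energy (fun i x => w i x - v i x) (fun i x => w1 i x - v1 i x) a
     + #|I|%:R * (#|I|%:R * (e * B)) ^+ 2).
Proof.
move=> hw hv M0 e0 hM he hB hx; apply: (energy_bound (ode2_sub hw hv) M0 hM _ hx).
move=> i y hy; rewrite subrr addr0; apply: lin_le => //.
- by move=> i' j; exact: he.
- by move=> j; exact: hB.
Qed.

End Dependence.

(** * Periodic test functions *)

Section Smooth.
Variable R : realType.
Implicit Types (f g : R -> R) (n : nat).

(** Stated with witnesses instead of [derive1n], so that closure under sums, products and
    exponentials follows by induction on n. *)
Fixpoint Cn n f : Prop :=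
  if n is n'.+1 then exists f', der f f' /\ Cn n' f' else True.

Definition smooth f := forall n, Cn n f.

Lemma smooth_derivable f : smooth f -> forall n x, derivable (derive1n n f) x 1.
Proof.
move=> hf n; have := hf n.+1; elim: n f {hf} => [|n IH] f [f' [df hf']] x.
  by have [] := df x.
by rewrite derive1Sn (der_derive1 df); apply: IH.
Qed.

Lemma derivable_smooth f : (forall n x, derivable (derive1n n f) x 1) -> smooth f.
Proof.
move=> hf n; elim: n f hf => [//|n IH] f hf; exists (derive1 f); split.
  by move=> x; rewrite derive1E; apply: derivableP; exact: (hf 0%N x).
by apply: IH => m x; rewrite -derive1Sn; exact: hf.
Qed.

Lemma Cn_ext n f g : (forall x, f x = g x) -> Cn n f -> Cn n g.
Proof. by move=> /funext ->. Qed.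

Lemma CnS n f : Cn n.+1 f -> Cn n f.
Proof.
elim: n f => [//|n IH] f [f' [df hf']]; exists f'; split => //.
exact: IH.
Qed.

Lemma smooth_der f : smooth f -> exists f', der f f' /\ smooth f'.
Proof.
move=> hf; exists (derive1 f); split.
  by have [f' [df _]] := hf 1%N; rewrite (der_derive1 df).
by move=> n; have [f' [df h]] := hf n.+1; rewrite (der_derive1 df).
Qed.

Lemma smooth_continuous f : smooth f -> continuous f.
Proof. by case/smooth_der => f' [df _]; exact: der_continuous df. Qed.

Lemma Cn_cst n (c : R) : Cn n (fun=> c).
Proof.
elim: n c => [//|n IH] c; exists (fun=> 0); split => //.
by move=> x; exact: D1_cst.
Qed.

Lemma Cn_add n f g : Cn n f -> Cn n g -> Cn n (fun x => f x + g x).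
Proof.
elim: n f g => [//|n IH] f g [f' [df hf]] [g' [dg hg]].
by exists (fun x => f' x + g' x); split; [move=> x; D1_solve|exact: IH].
Qed.

Lemma Cn_mul n f g : Cn n f -> Cn n g -> Cn n (fun x => f x * g x).
Proof.
elim: n f g => [//|n IH] f g hf hg; have hf0 := CnS hf; have hg0 := CnS hg.
case: hf => f' [df hf]; case: hg => g' [dg hg].
exists (fun x => f' x * g x + f x * g' x); split; first by move=> x; D1_solve.
by apply: Cn_add; exact: IH.
Qed.

Lemma Cn_exp n f : Cn n f -> Cn n (fun x => expR (f x)).
Proof.
elim: n f => [//|n IH] f hf; have hf0 := CnS hf; case: hf => f' [df hf].
exists (fun x => expR (f x) * f' x); split; first by move=> x; D1_solve.
by apply: Cn_mul => //; exact: IH.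
Qed.

Lemma Cn_trig n (a b : R) :
  Cn n (fun x => cos (a * x + b)) /\ Cn n (fun x => sin (a * x + b)).
Proof.
elim: n => [//|n [h1 h2]]; split.
  exists (fun x => (- a) * sin (a * x + b)); split; first by move=> x; D1_solve; ring.
  by apply: Cn_mul => //; exact: Cn_cst.
exists (fun x => a * cos (a * x + b)); split; first by move=> x; D1_solve; ring.
by apply: Cn_mul => //; exact: Cn_cst.
Qed.

End Smooth.

Section Bump.
Variables (R : realType) (L : R).
Hypothesis L0 : 0 < L.

(* [bump_arg b] is negative on ]0, b[ and positive on ]b, L[, so that [bump b n] tends to the
   indicator function of ]0, b[ as [n] grows. *)
Definition bump_arg (b x : R) : R :=
  cos (pi * b / L) - cos ((2 * pi / L) * x + (- pi * b / L)).

Definition bump (b : R) (n : nat) (x : R) : R := expR (- expR (n%:R * bump_arg b x)).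

Lemma test_funP (f : R -> R) : test_fun L f <-> (Defs.periodic L f /\ smooth f).
Proof.
split=> -[pf sf]; split => //; first exact: derivable_smooth.
exact: smooth_derivable.
Qed.

Lemma bump_arg_periodic b x : bump_arg b (x + L) = bump_arg b x.
Proof.
rewrite /bump_arg; congr (_ - _).
have -> : 2 * pi / L * (x + L) + - pi * b / L = (2 * pi / L * x + - pi * b / L) + pi *+ 2.
  by rewrite mulr2n; field; rewrite gt_eqF.
exact: cosD2pi.
Qed.

Lemma bump_test b n : test_fun L (bump b n).
Proof.
apply/test_funP; split; first by move=> x; rewrite /bump bump_arg_periodic.
move=> m; apply: Cn_exp.
apply: (@Cn_ext _ _ (fun x => (-1) * expR (n%:R * bump_arg b x))).
  by move=> x; rewrite mulN1r.
apply: Cn_mul; first exact: Cn_cst.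
apply: Cn_exp; apply: Cn_mul; first exact: Cn_cst.
apply: (@Cn_ext _ _ (fun x => cos (pi * b / L) + (-1) * cos ((2 * pi / L) * x + (- pi * b / L)))).
  by move=> x; rewrite mulN1r.
apply: Cn_add; first exact: Cn_cst.
by apply: Cn_mul; [exact: Cn_cst|have [] := Cn_trig m (2 * pi / L) (- pi * b / L)].
Qed.

Lemma bump_ge0 b n x : 0 <= bump b n x.
Proof. exact: expR_ge0. Qed.

Lemma bump_le1 b n x : bump b n x <= 1.
Proof. by rewrite -expR0 ler_expR oppr_le0 expR_ge0. Qed.

Lemma bump_continuous b n : continuous (bump b n).
Proof. by apply: smooth_continuous; have /test_funP[] := bump_test b n. Qed.

(** With q = pi / L the function is cos (q b) - cos (q (2 x - b)). Between 0 and b one has |2 x - b|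
    < b, and the cosine is even and decreases on [0, pi]. *)
Lemma bump_arg_lt0 b x : 0 < b < L -> 0 < x < b -> bump_arg b x < 0.
Proof.
move=> /andP[b0 bL] /andP[x0 xb]; rewrite /bump_arg subr_lt0.
have pi0 := @pi_gt0 R.
have iL : 0 < L^-1 by rewrite invr_gt0.
pose q := pi / L; have q0 : 0 < q by rewrite divr_gt0.
have qL : q * L = pi by rewrite /q divfK // gt_eqF.
have -> : pi * b / L = q * b by rewrite /q; ring.
have -> : 2 * pi / L * x + - pi * b / L = q * (2 * x - b) by rewrite /q; ring.
have hb : q * b < pi by rewrite -qL ltr_pM2l.
have hb0 : 0 < q * b by rewrite mulr_gt0.
have h1 : 0 <= q * b <= pi by apply/andP; split; lra.
case: (leP 0 (2 * x - b)) => h.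
  have h2 : 0 <= q * (2 * x - b) <= pi.
    by rewrite mulr_ge0 ?(ltW q0) //= -qL ler_pM2l //; lra.
  by rewrite ltr_cos ?in_itv /= ?h1 ?h2 // ltr_pM2l //; lra.
have h2 : 0 <= q * - (2 * x - b) <= pi.
  by rewrite mulr_ge0 ?(ltW q0) //=; [rewrite -qL ler_pM2l //; lra|lra].
by rewrite -[ltRHS]cosN -mulrN ltr_cos ?in_itv /= ?h1 ?h2 // ltr_pM2l //; lra.
Qed.

Lemma bump_arg_gt0 b x : 0 < b < L -> b < x < L -> 0 < bump_arg b x.
Proof.
move=> /andP[b0 bL] /andP[bx xL]; rewrite /bump_arg subr_gt0.
have pi0 := @pi_gt0 R.
pose q := pi / L; have q0 : 0 < q by rewrite divr_gt0.
have qL : q * L = pi by rewrite /q divfK // gt_eqF.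
have -> : pi * b / L = q * b by rewrite /q; ring.
have -> : 2 * pi / L * x + - pi * b / L = q * (2 * x - b) by rewrite /q; ring.
have hb : q * b < pi by rewrite -qL ltr_pM2l.
have hb0 : 0 < q * b by rewrite mulr_gt0.
have h1 : 0 <= q * b <= pi by apply/andP; split; lra.
case: (leP (2 * x - b) L) => h.
  have h2 : 0 <= q * (2 * x - b) <= pi.
    by rewrite mulr_ge0 ?(ltW q0) //=; [rewrite -qL ler_pM2l|lra].
  by rewrite ltr_cos ?in_itv /= ?h1 ?h2 // ltr_pM2l //; lra.
(* Here the angle lies between pi and 2 pi; its reflection 2 pi minus the angle returns to
   [0, pi]. *)
have -> : cos (q * (2 * x - b)) = cos (q * (2 * L - (2 * x - b))).
  rewrite -cosN -[LHS]cosD2pi; congr cos; rewrite mulr2n -qL; ring.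
have h2 : 0 <= q * (2 * L - (2 * x - b)) <= pi.
  by rewrite mulr_ge0 ?(ltW q0) //=; [rewrite -qL ler_pM2l //; lra|lra].
by rewrite ltr_cos ?in_itv /= ?h1 ?h2 // ltr_pM2l //; lra.
Qed.

Lemma expR_mulrn (s : R) n : expR (n%:R * s) = expR s ^+ n.
Proof. by rewrite expRM_natl. Qed.

Lemma cvg_expr0 (q : R) : 0 <= q < 1 -> (fun n => q ^+ n) @ \oo --> (0 : R).
Proof.
move=> /andP[q0 q1]; have := @cvg_geometric R 1 q.
rewrite ger0_norm // => /(_ q1); apply: cvg_trans; apply: near_eq_cvg.
by apply: nearW => n; rewrite /= mul1r.
Qed.

Lemma bump_cvg1 b x : 0 < b < L -> 0 < x < b -> (fun n => bump b n x) @ \oo --> (1 : R).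
Proof.
move=> hb hx; have s0 := bump_arg_lt0 hb hx.
have h : (fun n => expR (bump_arg b x) ^+ n) @ \oo --> (0 : R).
  by apply: cvg_expr0; rewrite expR_ge0 expR_lt1.
have H : (fun n => expR (- expR (bump_arg b x) ^+ n)) @ \oo --> (1 : R).
  rewrite -[1]expR0 -[0]oppr0; apply: (@continuous_cvg _ _ _ _ _ _ (fun y : R => expR (- y))) h.
  by apply: D1_continuous; D1_solve; reflexivity.
rewrite (_ : (fun n => bump b n x) = (fun n => expR (- expR (bump_arg b x) ^+ n))).
  exact: H.
by apply/funext => n; rewrite /bump expR_mulrn.
Qed.

Lemma bump_cvg0 b x : 0 < b < L -> b < x < L -> (fun n => bump b n x) @ \oo --> (0 : R).
Proof.
move=> hb hx; have s0 := bump_arg_gt0 hb hx.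
have h : (fun n => expR (- bump_arg b x) ^+ n) @ \oo --> (0 : R).
  by apply: cvg_expr0; rewrite expR_ge0 expR_lt1 oppr_lt0.
apply: (squeeze_cvgr _ (cvg_cst 0) h); apply: nearW => n.
rewrite bump_ge0 /= -expR_mulrn /bump ler_expR mulrN lerN2.
by apply: le_trans (expR_ge1Dx _); rewrite lerDr.
Qed.

End Bump.

(** * Weak derivatives *)

Section WeakDerivative.
Variables (R : realType) (L : R).
Hypothesis L0 : 0 < L.
Implicit Types (f g w psi : R -> R).
Local Notation mu := (@lebesgue_measure R).

Definition igb f := mu.-integrable `[0, L] (EFin \o f).

Definition aeL (P : R -> Prop) := {ae mu, forall x, `[0%R, L]%classic x -> P x}.

Lemma aeF : Filter (nbhs (almost_everywhere mu)).
Proof. exact: (ae_filter_ringOfSetsType mu). Qed.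

Lemma inL x : `[0%R, L]%classic x <-> 0 <= x <= L.
Proof. by rewrite /= in_itv. Qed.

Lemma aeL_imp (P Q : R -> Prop) : (forall x, 0 <= x <= L -> P x -> Q x) -> aeL P -> aeL Q.
Proof.
by move=> h; rewrite /aeL; apply: (@filterS _ _ aeF) => x hP /[dup] /inL hx /hP; exact: h.
Qed.

Lemma aeL_and (P Q : R -> Prop) : aeL P -> aeL Q -> aeL (fun x => P x /\ Q x).
Proof.
by rewrite /aeL; apply: (@filterS2 _ _ aeF) => x hP hQ hx; split; [exact: hP|exact: hQ].
Qed.

Lemma aeL_all (P : R -> Prop) : (forall x, 0 <= x <= L -> P x) -> aeL P.
Proof. by move=> h; apply: aeW => x /inL; exact: h. Qed.

Lemma aeL_off (b : R) (P : R -> Prop) : (forall x, 0 < x < L -> x != b -> P x) -> aeL P.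
Proof.
move=> h; exists [set x | x \in [:: 0; b; L]]; split.
- apply: countable_measurable; last exact: (finite_set_countable (finite_seq _)).
  by move=> t; exact: measurable_set1.
- by apply: countable_lebesgue_measure0; exact: (finite_set_countable (finite_seq _)).
move=> x /= /not_implyP[/inL /andP[x0 xL] nP]; rewrite !inE.
case E0: (x == 0) => //; case Eb: (x == b) => //; case EL: (x == L) => //.
by exfalso; apply: nP; apply: h; rewrite ?Eb // !lt_def E0 [L == x]eq_sym EL x0 xL.
Qed.

Lemma igb_cont f : continuous f -> igb f.
Proof. by move=> cf; exact: continuous_lint. Qed.

Lemma igbD f g : igb f -> igb g -> igb (fun x => f x + g x).
Proof. by move=> hf hg; exact: (integrableD _ hf hg). Qed.

Lemma igbB f g : igb f -> igb g -> igb (fun x => f x - g x).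
Proof. by move=> hf hg; exact: (integrableB _ hf hg). Qed.

Lemma igbZ (c : R) f : igb f -> igb (fun x => c * f x).
Proof. by move=> hf; exact: (integrableZl _ c hf). Qed.

Lemma igb_norm f : igb f -> igb (fun x => `|f x|).
Proof. by move=> hf; exact: (integrable_norm hf). Qed.

Lemma bounded_on (h : R -> R) (a b M : R) : (forall x, a <= x <= b -> `|h x| <= M) ->
  [bounded h x | x in `[a, b]%classic].
Proof.
move=> hM; exists M; split; first exact: num_real.
move=> y My x /=; rewrite in_itv /= => /hM /le_trans; apply; exact: ltW.
Qed.

Lemma igbM f (h : R -> R) : igb f -> continuous h -> igb (fun x => f x * h x).
Proof.
move=> hf ch; have [M _ hM] := continuous_itv_bounded 0 L ch.
apply: (@integrableMl _ _ _ mu _ (measurable_itv _) (EFin \o f) h hf).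
  by apply: measurable_funTS; exact: continuous_measurable_fun.
exact: bounded_on hM.
Qed.

Lemma Rint_ae f g : igb f -> igb g -> aeL (fun x => f x = g x) ->
  \int[mu]_(x in `[0, L]) f x = \int[mu]_(x in `[0, L]) g x.
Proof.
move=> hf hg h; congr fine; apply: ae_eq_integral => //.
- exact: measurable_int hf.
- exact: measurable_int hg.
by apply: aeL_imp h => x _ /= ->.
Qed.

(** The bumps lie between 0 and 1 and converge to the indicator function of ]0, b[ except at 0, b
    and L, so dominated convergence applies. *)
Lemma Rint_bump0 w b : igb w -> 0 < b < L ->
  (forall n, \int[mu]_(x in `[0, L]) (w x * bump L b n x) = 0) ->
  \int[mu]_(x in `[0, b]) w x = 0.
Proof.
move=> iw hb hw; move: (hb) => /andP[b0 bL].
have mD : measurable `[0, L]%classic by exact: measurable_itv.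
have iwb n : igb (fun x => w x * bump L b n x) by apply: igbM => //; exact: bump_continuous.
have sub : `[0, L]%classic `&` `[0, b]%classic = `[0, b]%classic :> set R.
  apply/seteqP; split => x /=; rewrite !in_itv /=; first by case.
  by move=> /andP[x0 xb]; split; rewrite x0 ?xb //= (le_trans xb (ltW bL)).
have ib : mu.-integrable `[0, L] (EFin \o (w \_ `[0, b])).
  rewrite -restrict_EFin; apply/integrable_restrict => //; rewrite sub.
  by apply: integrableS iw => //; apply: subset_itvl; rewrite bnd_simp ltW.
have h1 n : measurable_fun `[0, L] (fun x => (w x * bump L b n x)%:E).
  exact: measurable_int (iwb n).
have h2 : {ae mu, forall x, `[0, L]%classic x ->
    (fun n => (w x * bump L b n x)%:E) @ \oo --> ((w \_ `[0, b]) x)%:E}.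
  apply: (@aeL_off b) => x /andP[x0 xL] xb; apply: cvg_EFin; first exact: nearW.
  rewrite /patch; case: ifPn => hx.
    rewrite -[w x in X in _ --> X]mulr1; apply: cvgMr.
    by apply: bump_cvg1 => //; move: hx; rewrite inE /= in_itv /= x0 lt_neqAle xb /= => /andP[].
  have -> : point = w x * 0 by rewrite mulr0.
  apply: cvgMr; apply: bump_cvg0 => //; rewrite xL andbT.
  by move: hx; rewrite notin_setE /= in_itv /= (ltW x0) /= => /negP; rewrite -ltNge.
have h3 : {ae mu, forall x n, `[0, L]%classic x -> (`|(w x * bump L b n x)%:E| <= `|w x|%:E)%E}.
  apply: aeW => x n _; rewrite lee_fin normrM (ger0_norm (bump_ge0 L b n x)).
  by rewrite -[leRHS]mulr1 ler_wpM2l // bump_le1.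
have [_ _ H] := @dominated_convergence _ _ R mu _ mD
  (fun n x => (w x * bump L b n x)%:E) (fun x => ((w \_ `[0, b]) x)%:E) (fun x => `|w x|%:E)
  h1 (measurable_int mu ib) h2 (igb_norm iw) h3.
have e0 n : (\int[mu]_(x in `[0%R, L]) (w x * bump L b n x)%:E = 0)%E.
  rewrite -[LHS]fineK; last exact: integrable_fin_num (iwb n).
  by have := hw n; rewrite /Rintegral => ->.
have {}H : (\int[mu]_(x in `[0%R, L]) ((w \_ `[0, b]) x)%:E = 0)%E.
  apply: (cvg_unique _ H); first exact: ereal_hausdorff.
  by rewrite (_ : [sequence _]_n = fun=> 0%E); [exact: cvg_cst|apply/funext => n; exact: e0].
by rewrite -sub Rintegral_mkcondr /Rintegral H.
Qed.

(** Extension by zero makes a function integrable on [0, L] integrable on every compact interval, as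
    [prim] requires. *)
Definition res f x : R := if 0 <= x <= L then f x else 0.

Lemma resE f : res f = f \_ `[0, L].
Proof.
apply/funext => x; rewrite /res patchE; case: ifPn => hx.
  by rewrite mem_set //= in_itv.
by rewrite memNset //= in_itv; exact/negP.
Qed.

Lemma res_in f x : 0 <= x <= L -> res f x = f x.
Proof. by rewrite /res => ->. Qed.

Lemma res_lint f : igb f -> lint (res f).
Proof.
move=> hf a b; apply: (@integrableS _ _ _ mu setT) => //.
by rewrite resE -restrict_EFin; apply/integrable_restrict => //; rewrite setTI.
Qed.

(** All integrals of w over [0, b] vanish by [Rint_bump0], and almost everywhere w is the derivative
    of its primitive by Lebesgue's differentiation theorem. *)
Lemma dubois_reymond w : igb w ->
  (forall psi, test_fun L psi -> \int[mu]_(x in `[0, L]) (w x * psi x) = 0) ->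
  aeL (fun x => w x = 0).
Proof.
move=> iw hw.
have h0 b : 0 < b < L -> \int[mu]_(x in `[0, b]) w x = 0.
  by move=> hb; apply: Rint_bump0 => // n; apply: hw; exact: bump_test.
have hi y : mu.-integrable `]-oo, y] (EFin \o w \_ `[0, L]).
  rewrite -restrict_EFin; apply/integrable_restrict => //.
  by apply: integrableS iw => //; apply: measurableI.
have il : locally_integrable [set: R] (w \_ `[0, L]).
  by apply: integrable_locally_restrict.
have H := @FTC1Ny R (w \_ `[0, L]) hi il.
have {}H : {ae mu, forall x, 0 < x < L -> w x = 0}.
  apply: (@filterS _ _ aeF) H.
  move=> x [_ +] /andP[x0 xL].
  rewrite patchE mem_set /=; last by rewrite in_itv /= !ltW.
  move=> <-; rewrite derive1E.
  rewrite (@near_eq_derive _ _ _ _ (fun=> 0) x 1) ?derive_cst //.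
  near=> y.
  have y0 : 0 < y by near: y; exact: lt_nbhsr.
  have yL : y < L by near: y; exact: lt_nbhsl.
  rewrite -Rintegral_mkcondr.
  rewrite (_ : _ `&` _ = `[0, y]%classic); first by apply: h0; rewrite y0.
  apply/seteqP; split => z /=; rewrite !in_itv /=.
    by move=> [zy /andP[z0 _]]; rewrite z0 zy.
  by move=> /andP[z0 zy]; rewrite z0 zy (le_trans zy (ltW yL)).
have : aeL (fun x => 0 < x < L) by apply: (@aeL_off 0).
apply: (@filterS2 _ _ aeF) H => x h1 h2 /h2 hx; exact: h1.
Unshelve. all: by end_near. Qed.

Lemma lintM f (h : R -> R) : lint f -> continuous h -> lint (fun x => f x * h x).
Proof.
move=> hf ch a b; have [M _ hM] := continuous_itv_bounded a b ch.
apply: (@integrableMl _ _ _ mu _ (measurable_itv _) (EFin \o f) h (hf a b)).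
  by apply: measurable_funTS; exact: continuous_measurable_fun.
exact: bounded_on hM.
Qed.

Lemma lint_norm f : lint f -> lint (fun x => `|f x|).
Proof. by move=> hf a b; exact: (integrable_norm (hf a b)). Qed.

Lemma lintZ (c : R) f : lint f -> lint (fun x => c * f x).
Proof. by move=> hf a b; exact: (integrableZl _ c (hf a b)). Qed.

Lemma prim_norm_le f (a b : R) : lint f -> a <= b ->
  `|prim f b - prim f a| <= prim (fun x => `|f x|) b - prim (fun x => `|f x|) a.
Proof.
move=> hf ab; rewrite !primB //; last exact: lint_norm.
exact: le_normr_Rintegral.
Qed.

(* Summing the second-order increments of [H] over the uniform partition of
   [0, L] into [n] cells gives a total of order 1/n. *)
Lemma cst_of_second_order (H V : R -> R) (C : R) : 0 <= C ->
  (forall x y, 0 <= x -> x <= y -> y <= L ->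
     `|H y - H x| <= C * (y - x) * (V y - V x)) ->
  H L = H 0.
Proof.
move=> C0 h.
have V0 : 0 <= C * L * (V L - V 0).
  by apply: le_trans (_ : `|H L - H 0| <= _) => //; have := h 0 L; rewrite subr0; apply => //; exact: ltW.
suff key n : `|H L - H 0| <= C * L * (V L - V 0) / n.+1%:R.
  apply/eqP; rewrite -subr_eq0 -normr_le0 leNgt; apply/negP => p0.
  have /archi_boundP := divr_ge0 V0 (ltW p0).
  set m := Num.bound _ => hm.
  have m0 : 0 < m%:R :> R by apply: le_lt_trans hm; rewrite divr_ge0 // ltW.
  have := key m.-1; rewrite prednK; last by move: m0; rewrite ltr0n.
  move: hm; rewrite ltr_pdivrMr // ler_pdivlMr // => hm /le_lt_trans /(_ hm).
  by rewrite mulrC ltxx.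
have n0 : 0 < n.+1%:R :> R by rewrite ltr0n.
pose d := L / n.+1%:R; have d0 : 0 < d by rewrite divr_gt0.
have dn : n.+1%:R * d = L by rewrite /d mulrC divfK // gt_eqF.
have {}key (k : nat) : (k <= n.+1)%N -> `|H (k%:R * d) - H 0| <= C * d * (V (k%:R * d) - V 0).
  elim: k => [|k IH] kn; first by rewrite mul0r !subrr normr0 mulr0.
  have {}IH := IH (ltnW kn).
  have e1 : k.+1%:R * d = k%:R * d + d by rewrite -natr1 mulrDl mul1r.
  have kd0 : 0 <= k%:R * d by rewrite mulr_ge0 // ltW.
  have kL : k.+1%:R * d <= L by rewrite -dn ler_pM2r // ler_nat.
  have := h (k%:R * d) (k.+1%:R * d) kd0.
  rewrite e1 lerDl (ltW d0) -e1 => /(_ isT kL).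
  have -> : k.+1%:R * d - k%:R * d = d by rewrite e1; ring.
  move=> h1; apply: le_trans (_ : `|H (k.+1%:R * d) - H (k%:R * d)| + `|H (k%:R * d) - H 0| <= _).
    by apply: le_trans (ler_normD _ _); rewrite subrKA.
  by lra.
have := key n.+1 (leqnn _); rewrite dn /d.
by congr (_ <= _); ring.
Qed.

(** As g is only integrable, [prim g] need not be differentiable and the product rule is not at
    hand. Instead, with V the primitive of |g|, the increments of the difference H of both sides are
    at most a constant times (y - x) (V y - V x), so that [cst_of_second_order] applies. *)
Lemma prim_by_parts g psi psi' : lint g -> der psi psi' -> continuous psi' ->
  prim (fun x => prim g x * psi' x) L = prim g L * psi L - prim (fun x => g x * psi x) L.
Proof.
move=> lg dpsi cpsi'; have cpsi := der_continuous dpsi.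
have cg := prim_continuous lg.
have lgpsi : lint (fun x => g x * psi x) := lintM lg cpsi.
have lgp : lint (fun x => prim g x * psi' x).
  by apply: continuous_lint; apply: cont_mul.
have [C C1 hC] := continuous_itv_bounded 0 L cpsi'.
pose V := prim (fun x => `|g x|); have lV := lint_norm lg.
pose H x := prim g x * psi x - prim (fun x => g x * psi x) x - prim (fun x => prim g x * psi' x) x.
suff : H L = H 0 by rewrite /H !prim0 mul0r !subrr; move/eqP; rewrite subr_eq0 => /eqP ->.
apply: (@cst_of_second_order H V (2 * C)); first by lra.
move=> x y x0 xy yL.
have Vm z t : z <= t -> V z <= V t.
  by move=> zt; rewrite -subr_ge0 /V primB //; apply: Rintegral_ge0.
have psi_lip z t : 0 <= z -> z <= t -> t <= L -> `|psi t - psi z| <= C * (t - z).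
  move=> z0 zt tL; have [c /andP[c1 c2] ->] := MVT_le zt (fun u _ => dpsi u).
  rewrite normrM [`|t - z|]ger0_norm ?subr_ge0 //; apply: ler_wpM2r; first by rewrite subr_ge0.
  by apply: hC; lra.
have e0 : H y - H x = \int[mu]_(t in `[x, y]) (g t * (psi y - psi t))
    - \int[mu]_(t in `[x, y]) ((prim g t - prim g x) * psi' t).
  have lc : lint (fun t => psi y * g t) := lintZ _ lg.
  have -> : \int[mu]_(t in `[x, y]) (g t * (psi y - psi t)) =
      psi y * (prim g y - prim g x) - (prim (fun x => g x * psi x) y - prim (fun x => g x * psi x) x).
    rewrite !primB // -RintegralZl // -RintegralB //.
    by apply: eq_Rintegral => t _; ring.
  have -> : \int[mu]_(t in `[x, y]) ((prim g t - prim g x) * psi' t) =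
      (prim (fun x => prim g x * psi' x) y - prim (fun x => prim g x * psi' x) x) - prim g x * (psi y - psi x).
    rewrite !primB // -(Rintegral_der xy cpsi' dpsi) -RintegralZl //; last exact: continuous_lint.
    rewrite -RintegralB //; last by apply: lintZ; exact: continuous_lint.
    by apply: eq_Rintegral => t _; ring.
  by rewrite /H; ring.
have Vxy0 : 0 <= V y - V x by rewrite subr_ge0 Vm.
have b1 : `|\int[mu]_(t in `[x, y]) (g t * (psi y - psi t))| <= C * (y - x) * (V y - V x).
  have li : lint (fun t => g t * (psi y - psi t)) by apply: lintM => //; cont_tac.
  apply: le_trans (le_normr_Rintegral _ (li _ _)) _; first by [].
  rewrite /V primB // -RintegralZl //; apply: le_Rintegral => //.
  - exact: lint_norm li _ _.
  - exact: lintZ lV _ _.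
  move=> t; rewrite /= in_itv /= => /andP[xt ty].
  rewrite normrM mulrC; apply: ler_wpM2r => //.
  apply: le_trans (psi_lip _ _ _ ty yL) _; first exact: le_trans xt.
  by apply: ler_wpM2l; lra.
have b2 : `|\int[mu]_(t in `[x, y]) ((prim g t - prim g x) * psi' t)| <= C * (y - x) * (V y - V x).
  have li : lint (fun t => (prim g t - prim g x) * psi' t) by apply: continuous_lint; cont_tac.
  apply: le_trans (le_normr_Rintegral _ (li _ _)) _; first by [].
  have -> : C * (y - x) * (V y - V x) = \int[mu]_(t in `[x, y]) (C * (V y - V x)).
    have d1 : der (fun t => (C * (V y - V x)) * t) (fun=> C * (V y - V x)).
      by move=> t; D1_solve; ring.
    by rewrite (Rintegral_der xy _ d1); [ring|exact: cont_cst].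
  apply: le_Rintegral => //.
  - exact: lint_norm li _ _.
  - by apply: continuous_lint; exact: cont_cst.
  move=> t; rewrite /= in_itv /= => /andP[xt ty].
  rewrite normrM mulrC; apply: ler_pM => //; first by apply: hC; lra.
  apply: le_trans (prim_norm_le lg xt) _; rewrite -/V lerD2r.
  exact: Vm.
rewrite e0; apply: le_trans (ler_normB _ _) _; apply: le_trans (lerD b1 b2) _.
by rewrite le_eqVlt; apply/orP; left; apply/eqP; ring.
Qed.

Lemma primL f : lint f -> prim f L = \int[mu]_(x in `[0, L]) f x.
Proof. by move=> hf; rewrite -(primB hf (ltW L0)) prim0 subr0. Qed.

Lemma Rint_res f : \int[mu]_(x in `[0, L]) res f x = \int[mu]_(x in `[0, L]) f x.
Proof. by apply: eq_Rintegral => x; rewrite inE => /inL hx; rewrite res_in. Qed.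

Lemma test_der psi : test_fun L psi -> exists psi',
  [/\ der psi psi', smooth psi' & derive1 psi = psi'].
Proof.
move=> /test_funP[_ /smooth_der[psi' [d s]]]; exists psi'; split => //.
exact: der_derive1.
Qed.

Lemma Rint_by_parts g psi psi' : igb g -> der psi psi' -> continuous psi' ->
  \int[mu]_(x in `[0, L]) (prim (res g) x * psi' x) =
  prim (res g) L * psi L - \int[mu]_(x in `[0, L]) (g x * psi x).
Proof.
move=> ig dpsi cpsi'; have lg := res_lint ig.
have cpsi := der_continuous dpsi; have cg := prim_continuous lg.
rewrite -primL; last by apply: continuous_lint; exact: cont_mul.
rewrite (prim_by_parts lg dpsi cpsi') (primL (lintM lg cpsi)).
congr (_ - _); apply: eq_Rintegral => x; rewrite inE => /inL hx.
by rewrite res_in.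
Qed.

Lemma Rint_psi' psi psi' : Defs.periodic L psi -> der psi psi' -> continuous psi' ->
  \int[mu]_(x in `[0, L]) psi' x = 0.
Proof.
move=> ppsi dpsi cpsi'; rewrite (Rintegral_der (ltW L0) cpsi' dpsi).
by rewrite -[psi 0]ppsi add0r subrr.
Qed.

Lemma weak_of_rep f g (p : R) : igb f -> igb g -> prim (res g) L = 0 ->
  aeL (fun x => f x = p + prim (res g) x) ->
  forall psi, test_fun L psi ->
  \int[mu]_(x in `[0, L]) (f x * derive1 psi x) = - \int[mu]_(x in `[0, L]) (g x * psi x).
Proof.
move=> jf ig g0 hae psi tpsi; have [psi' [dpsi spsi' ->]] := test_der tpsi.
have cpsi' := smooth_continuous spsi'; have ppsi := (test_funP L psi).1 tpsi.
have cg := prim_continuous (res_lint ig).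
have c1 : continuous (fun x => p * psi' x) by cont_tac.
have c2 : continuous (fun x => prim (res g) x * psi' x) by cont_tac.
rewrite (@Rint_ae _ (fun x => p * psi' x + prim (res g) x * psi' x)).
- rewrite RintegralD //; [|exact: igb_cont|exact: igb_cont].
  rewrite RintegralZl //; last exact: igb_cont.
  rewrite (Rint_psi' ppsi.1 dpsi cpsi') (Rint_by_parts ig dpsi cpsi') g0.
  by rewrite mulr0 mul0r !add0r.
- exact: igbM.
- by apply: igbD; exact: igb_cont.
- by apply: aeL_imp hae => x _ ->; rewrite mulrDl.
Qed.

Lemma Rint_cst (c : R) : \int[mu]_(x in `[0, L]) c = c * L.
Proof.
have d : der (fun x => c * x) (fun=> c) by move=> x; D1_solve; ring.
by rewrite (Rintegral_der (ltW L0) (@cont_cst R c) d); ring.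
Qed.

Lemma test_cst (c : R) : test_fun L (fun=> c).
Proof. by apply/test_funP; split=> // n; exact: Cn_cst. Qed.

(** A test function minus its mean m is the derivative of a periodic test function. Hence w minus
    its own mean p is orthogonal to all test functions. *)
Lemma dubois_reymond_cst w : igb w ->
  (forall psi, test_fun L psi -> \int[mu]_(x in `[0, L]) (w x * derive1 psi x) = 0) ->
  exists p : R, aeL (fun x => w x = p).
Proof.
move=> iw hw; pose p := (\int[mu]_(x in `[0, L]) w x) / L; exists p.
have ip : igb (fun=> p) by apply: igb_cont; exact: cont_cst.
have h : aeL (fun x => w x - p = 0).
  apply: dubois_reymond; first exact: igbB.
  move=> th tth; have /test_funP[pth sth] := tth; have cth := smooth_continuous sth.
  pose m := (\int[mu]_(x in `[0, L]) th x) / L.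
  have cthm : continuous (fun x => th x - m) by cont_tac.
  have dP := prim_der cthm.
  have tP : test_fun L (prim (fun x => th x - m)).
    apply/test_funP; split.
      have dP2 : der (fun x => prim (fun x => th x - m) (x + L)) (fun x => th x - m).
        by move=> x; apply: D1_eq; [apply: (D1_comp (dP _)); D1_tac|rewrite /= pth; ring].
      have e0 : prim (fun x => th x - m) L = 0.
        rewrite primL; last exact: continuous_lint.
        rewrite RintegralB //; [|exact: igb_cont|by apply: igb_cont; exact: cont_cst].
        by rewrite Rint_cst /m divfK ?subrr // gt_eqF.
      move=> x; have := der_cst_eq x dP2 dP; rewrite add0r e0 prim0 subrr.
      by move/eqP; rewrite subr_eq0 => /eqP.
    case=> [//|n]; exists (fun x => th x - m); split => //.
    by apply: Cn_add; [exact: sth|apply: (@Cn_cst _ _ (- m))].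
  have := hw _ tP; rewrite (der_derive1 dP).
  have -> : \int[mu]_(x in `[0, L]) (w x * (th x - m)) =
     \int[mu]_(x in `[0, L]) (w x * th x) - m * \int[mu]_(x in `[0, L]) w x.
    rewrite -RintegralZl // -RintegralB //; [|exact: igbM|exact: igbZ].
    by apply: eq_Rintegral => x _; ring.
  move=> e1.
  have -> : \int[mu]_(x in `[0, L]) ((w x - p) * th x) =
     \int[mu]_(x in `[0, L]) (w x * th x) - p * \int[mu]_(x in `[0, L]) th x.
    rewrite -RintegralZl //; last exact: igb_cont.
    rewrite -RintegralB //; [|exact: igbM|by apply: igbZ; exact: igb_cont].
    by apply: eq_Rintegral => x _; ring.
  by rewrite -[RHS]e1 /p /m; ring.
by apply: aeL_imp h => x _ /eqP; rewrite subr_eq0 => /eqP.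
Qed.

(** Testing with the constant 1 shows that g has mean zero. The integration by parts for
    [prim (res g)] then has no boundary term, and f minus this primitive is orthogonal to all
    derivatives of test functions. *)
Lemma weak_rep f g : igb f -> igb g ->
  (forall psi, test_fun L psi ->
    \int[mu]_(x in `[0, L]) (f x * derive1 psi x) = - \int[mu]_(x in `[0, L]) (g x * psi x)) ->
  prim (res g) L = 0 /\ exists p : R, aeL (fun x => f x = p + prim (res g) x).
Proof.
move=> jf ig hw; have lg := res_lint ig; have cg := prim_continuous lg.
have g0 : prim (res g) L = 0.
  rewrite primL // Rint_res.
  have := hw _ (test_cst 1); rewrite (der_derive1 (D1_cst (1 : R))).
  have -> : \int[mu]_(x in `[0, L]) (f x * 0) = 0.
    by rewrite (_ : (fun x => f x * 0) = fun=> 0) ?Rint_cst ?mul0r //; apply/funext => x; rewrite mulr0.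
  under eq_Rintegral do rewrite mulr1.
  by move/esym/eqP; rewrite oppr_eq0 => /eqP.
split => //.
have [p hp] : exists p : R, aeL (fun x => f x - prim (res g) x = p).
  apply: dubois_reymond_cst; first by apply: igbB => //; exact: igb_cont.
  move=> psi tpsi; have [psi' [dpsi spsi' E]] := test_der tpsi.
  have := hw _ tpsi; rewrite E => e1; have cpsi' := smooth_continuous spsi'.
  have := Rint_by_parts ig dpsi cpsi'; rewrite g0 mul0r sub0r -e1 => e2.
  have c2 : continuous (fun x => prim (res g) x * psi' x) by cont_tac.
  transitivity (\int[mu]_(x in `[0, L]) (f x * psi' x - prim (res g) x * psi' x)).
    by apply: eq_Rintegral => x _; rewrite mulrBl.
  rewrite RintegralB //; [|exact: igbM|exact: igb_cont].
  by rewrite e2 subrr.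
by exists p; apply: aeL_imp hp => x _ <-; rewrite subrK.
Qed.

End WeakDerivative.

(** * Picone's identity *)

Section Jacobi.
Variables (R : realType) (qs f f1 u u1 : R -> R) (a b : R).
Hypotheses (ab : a < b) (cq : continuous qs).
Hypotheses (df : der f f1) (cf1 : continuous f1).
Hypotheses (du : der u u1) (du1 : der u1 (fun x => qs x * u x)).
Hypothesis u0 : forall x, a < x < b -> u x != 0.

(* Picone's identity: f1 ^ 2 + qs f ^ 2 = (f1 - f u1 / u) ^ 2 + jac'. *)
Definition jac (x : R) : R := f x ^+ 2 * u1 x / u x.

(** The limit is taken along ]a, b[ only, where u has no zero. *)
Definition tends (F : R -> R) (e l : R) := forall eps : R, 0 < eps ->
  exists2 d : R, 0 < d & forall x, a < x < b -> `|x - e| < d -> `|F x - l| < eps.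

Lemma tends_cont (F : R -> R) e : {for e, continuous F} -> tends F e (F e).
Proof.
move=> cF eps e0; have /cvgrPdist_lt/(_ _ e0)[d /= d0 hd] := cF.
exists d => // x _ hx; rewrite distrC; apply: hd.
by rewrite /ball /= distrC.
Qed.

(** At a common zero e of f and u, the mean value theorem gives f = O(x - e), while u is of exact
    order x - e because u1 e is nonzero. So f ^ 2 u1 / u tends to 0, which is the value of [jac] at
    e. *)
Lemma jac_tends e : u e != 0 \/ (f e = 0 /\ u1 e != 0) -> tends jac e (jac e).
Proof.
have cu1 := der_continuous du1.
case=> [ue|[fe u1e]].
  apply: tends_cont; apply: D1_continuous; rewrite /jac.
  by have hu1 := du1; have hu := du; have hf := df; D1_tac.
have [ue|ue] := eqVneq (u e) 0; last first.
  apply: tends_cont; apply: D1_continuous; rewrite /jac.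
  by have hu1 := du1; have hu := du; have hf := df; D1_tac.
have -> : jac e = 0 by rewrite /jac fe; ring.
have [M M1 hM] := continuous_itv_bounded (e - 1) (e + 1) cf1.
have [M' M1' hM'] := continuous_itv_bounded (e - 1) (e + 1) cu1.
pose m := `|u1 e|; have m0 : 0 < m by rewrite normr_gt0.
have m2 : 0 < m / 2 by lra.
have /cvgrPdist_lt/(_ _ m2)[d /= d0 hd] := cu1 e.
move=> eps e0; pose C := M ^+ 2 * M' / (m / 2).
have C0 : 0 < C by rewrite divr_gt0 // mulr_gt0 ?exprn_gt0 //; lra.
exists (Num.min 1 (Num.min d (eps / C))); first by rewrite !lt_min ltr01 d0 divr_gt0.
move=> x xab; rewrite !lt_min => /andP[x1 /andP[xd xe]].
have ux : u x != 0 := u0 xab.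
have mv (F G : R -> R) : der F G -> F e = 0 -> exists2 c, `|c - e| <= `|x - e| & F x = G c * (x - e).
  move=> dF Fe; case: (leP e x) => ex.
    have [c /andP[c1 c2] E] := MVT_le ex (fun t _ => dF t).
    by exists c; [rewrite !ger0_norm; lra|rewrite -E Fe subr0].
  have [c /andP[c1 c2] E] := MVT_le (ltW ex) (fun t _ => dF t).
  exists c; first by rewrite !ler0_norm; lra.
  by rewrite -[F x]opprK -[- F x]add0r -Fe E; ring.
have [cf hcf Ef] := mv _ _ df fe; have [cu hcu Eu] := mv _ _ du ue.
have bf : `|f1 cf| <= M.
  by apply: hM; have := le_lt_trans hcf x1; rewrite ltr_norml; lra.
have bu1 : `|u1 x| <= M' by apply: hM'; move: x1; rewrite ltr_norml; lra.
have bu : m / 2 <= `|u1 cu|.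
  have : `|u1 e - u1 cu| < m / 2 by apply: hd; rewrite /ball /= distrC; exact: le_lt_trans hcu xd.
  have := ler_normD (u1 e - u1 cu) (u1 cu); rewrite subrK -/m; lra.
have xe0 : x - e != 0 by apply: contra ux => /eqP h; rewrite Eu h mulr0.
have n1 : u1 cu != 0 by rewrite -normr_gt0; lra.
have -> : jac x = (f1 cf ^+ 2 * u1 x / u1 cu) * (x - e).
  by rewrite /jac Ef Eu; field; rewrite n1 xe0.
rewrite subr0 normrM.
have h1 : `|f1 cf ^+ 2 * u1 x / u1 cu| <= C.
  rewrite normrM normfV normrM normrX /C; apply: ler_pM.
  - by rewrite mulr_ge0 ?exprn_ge0.
  - by rewrite invr_ge0.
  - by apply: ler_pM => //; rewrite lerXn2r ?nnegrE //; lra.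
  - by rewrite lef_pV2 ?posrE // normr_gt0.
apply: le_lt_trans (_ : C * `|x - e| < _); first by apply: ler_wpM2r.
by rewrite mulrC -ltr_pdivlMr.
Qed.

Lemma tends_mono (F : R -> R) (la lb : R) :
  (forall x y, a < x -> x <= y -> y < b -> F x <= F y) ->
  tends F a la -> tends F b lb -> la <= lb.
Proof.
move=> mF ha hb; have hab := ab; rewrite leNgt; apply/negP => lt.
have e0 : 0 < (la - lb) / 2 by lra.
have [da da0 {}ha] := ha _ e0; have [db db0 {}hb] := hb _ e0.
pose m := (a + b) / 2.
pose x := Num.min m (a + da / 2); pose y := Num.max m (b - db / 2).
have xm : x <= m by rewrite ge_min lexx.
have xa : x <= a + da / 2 by rewrite ge_min lexx orbT.
have ym : m <= y by rewrite le_max lexx.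
have yb : b - db / 2 <= y by rewrite le_max lexx orbT.
have x0 : a < x by rewrite lt_min /m; apply/andP; split; lra.
have y0 : y < b by rewrite gt_max /m; apply/andP; split; lra.
have := mF x y x0 (le_trans xm ym) y0.
have := ha x; rewrite x0 /= => /(_ _ _).
have xb : x < b by lra.
have ya : a < y by lra.
move=> /(_ xb) h1; have := hb y; rewrite ya y0 => /(_ isT) h2.
have {}h1 : `|F x - la| < (la - lb) / 2 by apply: h1; rewrite gtr0_norm; lra.
have {}h2 : `|F y - lb| < (la - lb) / 2 by apply: h2; rewrite ltr0_norm; lra.
move: h1 h2; rewrite !ltr_norml => /andP[? ?] /andP[? ?]; lra.
Qed.

(** By Picone's identity [P - jac] has a square as derivative inside ]a, b[; its monotonicity is
    carried to the end points by [tends_mono]. *)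
Lemma jacobi_le (P : R -> R) : der P (fun x => f1 x ^+ 2 + qs x * f x ^+ 2) ->
  (u a != 0 \/ (f a = 0 /\ u1 a != 0)) -> (u b != 0 \/ (f b = 0 /\ u1 b != 0)) ->
  jac b - jac a <= P b - P a.
Proof.
move=> dP ha hb; have cP := der_continuous dP.
suff : P a - jac a <= P b - jac b by lra.
apply: (@tends_mono (fun x => P x - jac x)).
- move=> x y ax xy yb.
  apply: (@D1_ndecr R (fun t => P t - jac t) (fun t => (f1 t - f t * u1 t / u t) ^+ 2) _ _ xy).
    move=> t /andP[xt ty]; have ut : u t != 0 by apply: u0; rewrite (lt_le_trans ax xt) (le_lt_trans ty yb).
    have hu1 := du1; have hu := du; have hf := df.
    rewrite /jac; apply: D1_eq; first by D1_tac.
    by rewrite /=; field.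
  by move=> t _; exact: sqr_ge0.
- move=> eps e0; have e2 : 0 < eps / 2 by lra.
  have [d1 d10 h1] := tends_cont (cP a) e2; have [d2 d20 h2] := jac_tends ha e2.
  exists (Num.min d1 d2); first by rewrite lt_min d10.
  move=> x xab; rewrite lt_min => /andP[/(h1 _ xab) + /(h2 _ xab)].
  by rewrite !ltr_norml => /andP[? ?] /andP[? ?]; apply/andP; split; lra.
- move=> eps e0; have e2 : 0 < eps / 2 by lra.
  have [d1 d10 h1] := tends_cont (cP b) e2; have [d2 d20 h2] := jac_tends hb e2.
  exists (Num.min d1 d2); first by rewrite lt_min d10.
  move=> x xab; rewrite lt_min => /andP[/(h1 _ xab) + /(h2 _ xab)].
  by rewrite !ltr_norml => /andP[? ?] /andP[? ?]; apply/andP; split; lra.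
Qed.

End Jacobi.

(** * The real spectral problem *)

Section RealSystem.
Variables (R : realType) (s c L : R) (qs u u1 y y1 : R -> R).
Hypotheses (s0 : 0 < s) (sE : s = 5 - 4 * c ^+ 2) (L0 : 0 < L).
Hypotheses (cq : continuous qs) (qsym : forall x, qs (L - x) = qs x).
Hypotheses (du : der u u1) (du1 : der u1 (fun x => qs x * u x)).
Hypotheses (dy : der y y1) (dy1 : der y1 (fun x => qs x * y x)).
Local Notation H := (L / 2).
Hypotheses (u_0 : u 0 = 0) (u_neg : forall x, 0 < x < H -> u x < 0).
Hypotheses (u1_0 : u1 0 < 0) (u1_H : 0 < u1 H).
Hypotheses (y_0 : 0 < y 0) (y1_0 : y1 0 = 0) (y_H : y H < 0) (y1_H : y1 H < 0) (y1_L : 0 < y1 L).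
Hypotheses (u1_L : u1 L = u1 0).
Implicit Types (w v : bool -> R -> R) (mu : R).

(* The components (f, g) are indexed by [true] and [false]. The eigenvalue equation reads
   M w'' = N w with M = [[5, 4c], [4c, 4]], whose determinant is 4s and whose inverse is [Minv]. *)
Definition Minv (i j : bool) : R :=
  if i then (if j then 4 else - 4 * c) / (4 * s) else (if j then - 4 * c else 5) / (4 * s).

Definition Nmat mu (i j : bool) (x : R) : R :=
  if i then (if j then s * qs x + c ^+ 2 - mu else c) else (if j then c else 1 - mu).

Definition K2 mu (i j : bool) (x : R) : R := Minv i true * Nmat mu true j x + Minv i false * Nmat mu false j x.

Definition sol mu w w1 := ode2 (K2 mu) (fun _ _ => 0) w w1.

Definition mform (a b : bool -> R) : R :=
  5 * a true * b true + 4 * c * (a true * b false + a false * b true) + 4 * a false * b false.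

Definition dot (a b : bool -> R) : R := a true * b true + a false * b false.

Definition dens w w1 v v1 (x : R) : R :=
  mform (fun i => w1 i x) (fun i => v1 i x)
  + (s * qs x + c ^+ 2) * w true x * v true x
  + c * (w true x * v false x + w false x * v true x) + w false x * v false x.

Definition dotf w v (x : R) : R := dot (fun i => w i x) (fun i => v i x).

Lemma K2_continuous mu i j : continuous (K2 mu i j).
Proof.
have h := cq; have cN i' j' : continuous (Nmat mu i' j').
  by case: i'; case: j'; rewrite /Nmat; cont_tac.
by rewrite /K2; cont_tac; exact: cN.
Qed.

Lemma big_unit (F : unit -> R) : \sum_j F j = F tt.
Proof. by rewrite (bigD1 tt) //= big1 ?addr0 // => -[]. Qed.

Lemma lin_bool (K : bool -> bool -> R -> R) w i x :
  lin K w i x = K i true x * w true x + K i false x * w false x.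
Proof. by rewrite /lin big_bool. Qed.

Lemma sol_der mu w w1 i : sol mu w w1 -> der (w i) (w1 i).
Proof. by move=> h; have [] := h i. Qed.

Lemma sol_der1 mu w w1 i : sol mu w w1 ->
  der (w1 i) (fun x => K2 mu i true x * w true x + K2 mu i false x * w false x).
Proof. by move=> h x; have [_ h1] := h i; apply: D1_eq (h1 x) _; rewrite lin_bool addr0. Qed.

Lemma sol_lin mu w w1 v v1 (a b : R) : sol mu w w1 -> sol mu v v1 ->
  sol mu (fun i x => a * w i x + b * v i x) (fun i x => a * w1 i x + b * v1 i x).
Proof.
move=> hw hv; have := ode2_lin a b hw hv.
have -> : (fun (_ : bool) (_ : R) => a * 0 + b * 0) = (fun _ _ => 0).
  by apply/funext => i; apply/funext => x; ring.
by [].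
Qed.

Lemma sol_reflect mu w w1 : sol mu w w1 ->
  sol mu (fun i x => w i (L - x)) (fun i x => - w1 i (L - x)).
Proof.
move=> hw i; split=> x.
  have h := sol_der i hw.
  by apply: D1_eq; [apply: (D1_comp (h _)); D1_tac|rewrite /=; ring].
have h := sol_der1 i hw.
apply: D1_eq; first by apply: D1_opp; apply: (D1_comp (h _)); D1_tac.
rewrite lin_bool /K2 /Nmat qsym /=; ring.
Qed.

(** The product rule for v . M w' together with M w'' = N w. Integrated, it is the weak form of the
    eigenvalue equation. *)
Lemma mform_der mu w w1 v v1 : sol mu w w1 -> der (v true) (v1 true) -> der (v false) (v1 false) ->
  der (fun x => mform (fun i => v i x) (fun i => w1 i x))
    (fun x => dens v v1 w w1 x - mu * dotf v w x).
Proof.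
move=> hw d1 d2 x; have d3 := sol_der1 true hw; have d4 := sol_der1 false hw.
have s1 : s != 0 by rewrite gt_eqF.
rewrite /mform; D1_solve; rewrite /dens /dotf /dot /mform /= /K2 /Nmat /Minv.
have e5 : 5 = s + 4 * c ^+ 2 by have := sE; lra.
rewrite e5 /=; field; exact: s1.
Qed.

Lemma dens_continuous w w1 v v1 : (forall i, continuous (w i)) -> (forall i, continuous (w1 i)) ->
  (forall i, continuous (v i)) -> (forall i, continuous (v1 i)) -> continuous (dens w w1 v v1).
Proof.
move=> h1 h2 h3 h4; have h := cq.
have [a1 a2 a3 a4] := And4 (h1 true) (h1 false) (h2 true) (h2 false).
have [a5 a6 a7 a8] := And4 (h3 true) (h3 false) (h4 true) (h4 false).
by clear h1 h2 h3 h4; rewrite /dens /mform; cont_tac.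
Qed.

Lemma dotf_continuous w v : (forall i, continuous (w i)) -> (forall i, continuous (v i)) ->
  continuous (dotf w v).
Proof. by move=> h1 h2; rewrite /dotf /dot; cont_tac. Qed.

Lemma sol_cont mu w w1 : sol mu w w1 -> (forall i, continuous (w i)) /\ (forall i, continuous (w1 i)).
Proof.
by move=> h; split=> i; [exact: der_continuous (sol_der i h)|exact: der_continuous (sol_der1 i h)].
Qed.

Lemma dotf_ge0 w x : 0 <= dotf w w x.
Proof. by rewrite /dotf /dot -!expr2 addr_ge0 ?sqr_ge0. Qed.

Lemma dotf_eq0 w x : dotf w w x = 0 -> forall i, w i x = 0.
Proof.
rewrite /dotf /dot -!expr2 => /eqP; rewrite paddr_eq0 ?sqr_ge0 // !sqrf_eq0.
by case/andP=> /eqP ? /eqP ? [].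
Qed.

Lemma prim_dot_eq0 w (X : R) : 0 < X -> (forall i, continuous (w i)) -> prim (dotf w w) X <= 0 ->
  forall i x, 0 <= x <= X -> w i x = 0.
Proof.
move=> X0 cw h i x hx; apply: dotf_eq0.
apply: (der_ge0_eq0 X0 (prim_der (dotf_continuous cw cw)) (dotf_continuous cw cw)) hx.
  by move=> t _; exact: dotf_ge0.
by rewrite prim0.
Qed.

(** Green's identity; the last hypothesis says that the boundary terms at 0 and X cancel. *)
Lemma orthogonality mu mu' w w1 v v1 (X : R) : mu != mu' -> sol mu w w1 -> sol mu' v v1 ->
  mform (fun i => v i X) (fun i => w1 i X) - mform (fun i => w i X) (fun i => v1 i X)
  = mform (fun i => v i 0) (fun i => w1 i 0) - mform (fun i => w i 0) (fun i => v1 i 0) ->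
  prim (dotf w v) X = 0.
Proof.
move=> ne hw hv hb.
have d1 := mform_der hw (sol_der true hv) (sol_der false hv).
have d2 := mform_der hv (sol_der true hw) (sol_der false hw).
have [cw _] := sol_cont hw; have [cv _] := sol_cont hv.
have cd := dotf_continuous cw cv; have dd := prim_der cd.
have D : der (fun x => mform (fun i => v i x) (fun i => w1 i x) - mform (fun i => w i x) (fun i => v1 i x)
    - (mu' - mu) * prim (dotf w v) x) (fun=> 0).
  move=> x; apply: D1_eq.
    apply: D1_add; first by apply: D1_add; [exact: d1|apply: D1_opp; exact: d2].
    by apply: D1_opp; apply: D1_mul; [exact: D1_cst|exact: dd].
  by rewrite /dens /dotf /dot /mform; ring.
have := der_cst_eq X D (@D1_cst R 0); rewrite /= hb prim0 !subr0 mulr0 subr0.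
move/eqP; rewrite addrC -subr_eq0 addrK oppr_eq0 mulf_eq0 subr_eq0 [mu' == mu]eq_sym (negbTE ne) /=.
by move/eqP.
Qed.

Lemma dens_split w w1 x : dens w w1 w w1 x =
  (4 * (w1 false x + c * w1 true x) ^+ 2 + (w false x + c * w true x) ^+ 2)
  + s * (w1 true x ^+ 2 + qs x * w true x ^+ 2).
Proof.
have e5 : 5 = s + 4 * c ^+ 2 by have := sE; lra.
by rewrite /dens /mform e5; ring.
Qed.

Lemma form_ge0 w w1 (a b : R) (P : R -> R) : a <= b ->
  der P (dens w w1 w w1) -> continuous (w true) -> continuous (w1 true) ->
  0 <= prim (fun x => w1 true x ^+ 2 + qs x * w true x ^+ 2) b
     - prim (fun x => w1 true x ^+ 2 + qs x * w true x ^+ 2) a ->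
  P a <= P b.
Proof.
move=> ab dP cw cw1 h; have hq := cq; have hs := s0.
have cJ : continuous (fun x => w1 true x ^+ 2 + qs x * w true x ^+ 2) by cont_tac.
have dJ := prim_der cJ; set J := prim _ in h dJ.
suff : P a - s * J a <= P b - s * J b by nra.
apply: (der_ndecr (f := fun x => P x - s * J x) (g := fun x => 4 * (w1 false x + c * w1 true x) ^+ 2 + (w false x + c * w true x) ^+ 2)) => //.
  by move=> x; D1_solve; rewrite dens_split; ring.
by move=> x _; rewrite addr_ge0 ?sqr_ge0 // mulr_ge0 // sqr_ge0.
Qed.

Let H0 : 0 < H. Proof. by have h := L0; lra. Qed.

Lemma wronskian x : u x * y1 x - u1 x * y x = - u1 0 * y 0.
Proof.
have hu := du; have hu1 := du1; have hy := dy; have hy1 := dy1.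
have D : der (fun x => u x * y1 x - u1 x * y x) (fun=> 0) by move=> t; D1_solve; ring.
have := der_cst_eq x D (@D1_cst R 0); rewrite /= !subr0 u_0 => ->; ring.
Qed.

(** The Wronskian of u and y is a positive constant, so y / u increases strictly on ]0, H[ and
    vanishes there at most once. The signs of y at 0 and H give a zero, and y1 is nonzero there
    since the Wronskian is. *)
Lemma y_zero : exists z, [/\ 0 < z < H, y z = 0, y1 z != 0,
  (forall x, 0 < x < z -> y x != 0) & (forall x, z < x < H -> y x != 0)].
Proof.
have hH := H0; have hy0 := y_0; have hyH := y_H; have hu1 := u1_0; have hun := u_neg.
have k0 : 0 < - u1 0 * y 0 by rewrite mulr_gt0 // oppr_gt0.
have [|z /andP[z0 zH] yz] := @IVT0 R y 0 H (ltW hH) (der_continuous dy).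
  by rewrite nmulr_lle0 // ltW.
have {}z0 : 0 < z by rewrite lt_def z0 andbT; apply: contraTneq hy0 => e; move: yz; rewrite e => ->; rewrite ltxx.
have {}zH : z < H by rewrite lt_def zH andbT; apply: contraTneq hyH => e; move: yz; rewrite -e => ->; rewrite ltxx.
have noz a b : 0 < a -> a < b -> b < H -> y a = 0 -> y b = 0 -> False.
  move=> a0 ab bH ya yb.
  have hT x : a <= x <= b -> D1 (fun t => y t / u t) x (- u1 0 * y 0 / u x ^+ 2).
    move=> /andP[ax xb]; have ux : u x < 0 by apply: hun; lra.
    have n0 : u x != 0 by rewrite lt_eqF.
    have h1 := du; have h2 := dy; apply: D1_eq; first by D1_tac.
    by rewrite -(wronskian x); field.
  have := D1_incr ab hT; rewrite ya yb !mul0r ltxx => /(_ _) f; apply/negP: isT.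
  rewrite /= f // => x /andP[ax xb]; have ux : u x < 0 by apply: hun; lra.
  by rewrite divr_gt0 // exprn_even_gt0 //= lt_eqF.
exists z; split => //; first by rewrite z0.
- have := wronskian z; rewrite yz mulr0 subr0 => E; apply: contraTneq k0 => e0.
  by rewrite -E e0 mulr0 ltxx.
- move=> x /andP[x0 xz]; apply/eqP => yx; exact: (noz x z).
- move=> x /andP[zx xH]; apply/eqP => yx; exact: (noz z x).
Qed.

(** The boundary terms of Picone's identity with y on [0, z] and [z, H] vanish at 0, where y1 = 0,
    and at z, where the first component is zero. At H the term w ^ 2 y1 / y is nonnegative because y
    and y1 are both negative: this is where the sign of y1 H enters. *)
Lemma neumann_form w w1 z (P : R -> R) :
  0 < z < H -> y z = 0 -> y1 z != 0 ->
  (forall x, 0 < x < z -> y x != 0) -> (forall x, z < x < H -> y x != 0) ->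
  (forall i, der (w i) (w1 i)) -> (forall i, continuous (w1 i)) -> w true z = 0 ->
  der P (dens w w1 w w1) -> P 0 <= P H.
Proof.
move=> /andP[z0 zH] yz y1z h1 h2 dw cw1 wz dP; have hq := cq; have hH := H0.
have cw i : continuous (w i) := der_continuous (dw i).
apply: (form_ge0 (ltW hH) dP) => //.
have cJ : continuous (fun x => w1 true x ^+ 2 + qs x * w true x ^+ 2).
  by have a1 := cw true; have a2 := cw1 true; cont_tac.
have dJ := prim_der cJ; set J := prim _ in dJ *.
have yH0 := y_H; have yy0 := y_0; have yy1 := y1_H.
have b1 := jacobi_le z0 (dw true) (cw1 true) dy dy1 h1 dJ (or_introl (lt0r_neq0 yy0)) (or_intror (conj wz y1z)).
have b2 := jacobi_le zH (dw true) (cw1 true) dy dy1 h2 dJ (or_intror (conj wz y1z)) (or_introl (ltr0_neq0 yH0)).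
move: b1 b2; rewrite /jac wz y1_0 expr0n /= mulr0 !mul0r.
have : 0 <= w true H ^+ 2 * y1 H / y H.
  by rewrite -mulrA mulr_ge0 ?sqr_ge0 // ltW // nmulr_rgt0 // invr_lt0.
lra.
Qed.

Lemma dirichlet_form w w1 (P : R -> R) :
  (forall i, der (w i) (w1 i)) -> (forall i, continuous (w1 i)) -> w true 0 = 0 -> w true H = 0 ->
  der P (dens w w1 w w1) -> P 0 <= P H.
Proof.
move=> dw cw1 w0 wH dP; have hq := cq; have hH := H0.
have cw i : continuous (w i) := der_continuous (dw i).
apply: (form_ge0 (ltW hH) dP) => //.
have cJ : continuous (fun x => w1 true x ^+ 2 + qs x * w true x ^+ 2).
  by have a1 := cw true; have a2 := cw1 true; cont_tac.
have dJ := prim_der cJ; set J := prim _ in dJ *.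
have hu x : 0 < x < H -> u x != 0 by move=> hx; rewrite lt_eqF // u_neg.
have n1 := u1_0; have n2 := u1_H.
have := jacobi_le hH (dw true) (cw1 true) du du1 hu dJ
  (or_intror (conj w0 (ltr0_neq0 n1))) (or_intror (conj wH (lt0r_neq0 n2))).
by rewrite /jac w0 wH expr0n /= !mul0r subrr.
Qed.

Lemma negative_dirichlet mu w w1 : mu < 0 -> sol mu w w1 ->
  (forall i, w i 0 = 0) -> (forall i, w i H = 0) -> forall i x, 0 <= x <= H -> w i x = 0.
Proof.
move=> mu0 hw w0 wH; have [cw cw1] := sol_cont hw; have dw i := sol_der i hw.
have cD := dens_continuous cw cw1 cw cw1.
have dP := prim_der cD; have hP := dirichlet_form dw cw1 (w0 true) (wH true) dP.
have cd := dotf_continuous cw cw; have dd := prim_der cd.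
have dB := mform_der hw (dw true) (dw false).
have D : der (fun x => mform (fun i => w i x) (fun i => w1 i x) - prim (dens w w1 w w1) x + mu * prim (dotf w w) x) (fun=> 0).
  move=> x; apply: D1_eq.
    apply: D1_add; first by apply: D1_add; [exact: dB|apply: D1_opp; exact: dP].
    by apply: D1_mul; [exact: D1_cst|exact: dd].
  by rewrite /=; ring.
apply: (prim_dot_eq0 H0 cw).
have := der_cst_eq H D (@D1_cst R 0); rewrite /mform /= !w0 !wH !prim0 => E.
move: hP; rewrite prim0 => hP; nra.
Qed.

(* A nonzero combination of the two solutions has a first component vanishing at the interior
   zero of [y], and the form is nonnegative on such functions by Picone's identity. *)
Lemma negative_neumann mu mu' w w1 v v1 : mu < 0 -> mu' < 0 ->
  sol mu w w1 -> sol mu' v v1 ->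
  (forall i, w1 i 0 = 0) -> (forall i, w1 i H = 0) ->
  (forall i, v1 i 0 = 0) -> (forall i, v1 i H = 0) ->
  exists a b : R, [/\ (a != 0) || (b != 0),
    mu = mu' -> forall i x, 0 <= x <= H -> a * w i x + b * v i x = 0 &
    mu != mu' -> forall i x, 0 <= x <= H -> a * w i x = 0 /\ b * v i x = 0].
Proof.
move=> m0 m0' hw hv w0 wH v0 vH; have [z [z0H yz y1z hz1 hz2]] := y_zero.
have [a [b [ab abz]]] : exists a b : R, (a != 0) || (b != 0) /\ a * w true z + b * v true z = 0.
  have [e|ne] := eqVneq (v true z) 0.
    by exists 0, 1; rewrite oner_eq0 orbT e mul0r mulr0 addr0.
  by exists (v true z), (- w true z); rewrite ne; split => //; ring.
exists a, b; split => //.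
all: have [cw cw1] := sol_cont hw; have dw i := sol_der i hw.
all: have [cv cv1] := sol_cont hv; have dv i := sol_der i hv.
all: pose U i x := a * w i x + b * v i x; pose U1 i x := a * w1 i x + b * v1 i x.
all: have dU i : der (U i) (U1 i) by move=> x; have h1 := dw i; have h2 := dv i; rewrite /U; D1_solve; rewrite /U1; ring.
all: have cU1 i : continuous (U1 i) by have h1 := cw1 i; have h2 := cv1 i; rewrite /U1; cont_tac.
all: have cU i : continuous (U i) := der_continuous (dU i).
all: have cD := dens_continuous cU cU1 cU cU1; have dP := prim_der cD.
all: have := neumann_form z0H yz y1z hz1 hz2 dU cU1 abz dP; rewrite prim0.
  move=> hP e; have hU : sol mu U U1 by apply: sol_lin => //; rewrite e.
  have cd := dotf_continuous cU cU; have dd := prim_der cd.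
  have dB := mform_der hU (dU true) (dU false).
  have D : der (fun x => mform (fun i => U i x) (fun i => U1 i x) - prim (dens U U1 U U1) x + mu * prim (dotf U U) x) (fun=> 0).
    move=> x; apply: D1_eq.
      apply: D1_add; first by apply: D1_add; [exact: dB|apply: D1_opp; exact: dP].
      by apply: D1_mul; [exact: D1_cst|exact: dd].
    by rewrite /=; ring.
  apply: (prim_dot_eq0 H0 cU).
  have := der_cst_eq H D (@D1_cst R 0).
  have e0 i : U1 i 0 = 0 by rewrite /U1 w0 v0; ring.
  have eH i : U1 i H = 0 by rewrite /U1 wH vH; ring.
  rewrite /mform /= !e0 !eH !prim0 => E; nra.
move=> hP ne.
have hO : prim (dotf w v) H = 0.
  by apply: (orthogonality ne hw hv); rewrite /mform !w0 !wH !v0 !vH; ring.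
have cdw := dotf_continuous cw cw; have ddw := prim_der cdw.
have cdv := dotf_continuous cv cv; have ddv := prim_der cdv.
have cdwv := dotf_continuous cw cv; have ddwv := prim_der cdwv.
have dB1 := mform_der hw (dU true) (dU false).
have dB2 := mform_der hv (dU true) (dU false).
(* Testing both equations with U = a w + b v expresses the form of U as mu a ^ 2 |w| ^ 2 + mu' b ^ 2
   |v| ^ 2 plus a mixed term, which vanishes by orthogonality. The form being nonnegative and mu,
   mu' negative, both squares are zero. *)
have D : der (fun x => a * mform (fun i => U i x) (fun i => w1 i x) + b * mform (fun i => U i x) (fun i => v1 i x)
    - prim (dens U U1 U U1) x + mu * a ^+ 2 * prim (dotf w w) x + mu' * b ^+ 2 * prim (dotf v v) x
    + (mu + mu') * a * b * prim (dotf w v) x) (fun=> 0).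
  move=> x; apply: D1_eq.
    apply: D1_add; first apply: D1_add; first apply: D1_add; first apply: D1_add.
    - apply: D1_add; first by apply: D1_mul; [exact: D1_cst|exact: dB1].
      by apply: D1_mul; [exact: D1_cst|exact: dB2].
    - by apply: D1_opp; exact: dP.
    - by apply: D1_mul; [exact: D1_cst|exact: ddw].
    - by apply: D1_mul; [exact: D1_cst|exact: ddv].
    - by apply: D1_mul; [exact: D1_cst|exact: ddwv].
  by rewrite /dens /dotf /dot /mform /U /U1; ring.
have := der_cst_eq H D (@D1_cst R 0).
rewrite /mform /= !w0 !wH !v0 !vH !prim0 hO => E.
have pw : 0 <= prim (dotf w w) H.
  by rewrite -(prim0 (dotf w w)); apply: (der_ndecr (ltW H0) ddw) => t _; exact: dotf_ge0.
have pv : 0 <= prim (dotf v v) H.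
  by rewrite -(prim0 (dotf v v)); apply: (der_ndecr (ltW H0) ddv) => t _; exact: dotf_ge0.
have {}pw : 0 <= a ^+ 2 * prim (dotf w w) H by rewrite mulr_ge0 ?sqr_ge0.
have {}pv : 0 <= b ^+ 2 * prim (dotf v v) H by rewrite mulr_ge0 ?sqr_ge0.
have scal (t : R) (g g1 : bool -> R -> R) : (forall i, continuous (g i)) -> t ^+ 2 * prim (dotf g g) H <= 0 ->
    forall i x, 0 <= x <= H -> t * g i x = 0.
  move=> cg le i x hx; have [->|t0] := eqVneq t 0; first by rewrite mul0r.
  rewrite (prim_dot_eq0 H0 cg _ i hx) ?mulr0 //.
  by move: le; rewrite pmulr_rle0 // exprn_even_gt0.
by move=> i x hx; split; [apply: (scal a w w1 cw)|apply: (scal b v v1 cv)] => //; nra.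
Qed.

(** For mu = 0 the function h satisfies h'' = h / 4, so h h' is nondecreasing; being periodic it is
    constant, and h = 0. The first component then solves w'' = qs w and equals a u + b y; comparing
    derivatives at 0 and L gives b y1 L = 0. *)
Lemma kernel_periodic w w1 : sol 0 w w1 -> (forall i, w i L = w i 0) -> (forall i, w1 i L = w1 i 0) ->
  exists a : R, forall x, 0 <= x <= L -> w true x = a * u x /\ w false x = - c * (a * u x).
Proof.
move=> hw p0 p1; have hL := L0; have s1 : s != 0 by rewrite gt_eqF.
have dw i := sol_der i hw; have dw1 i := sol_der1 i hw.
have d1 := dw true; have d2 := dw false; have d3 := dw1 true; have d4 := dw1 false.
have e5 : 5 = s + 4 * c ^+ 2 by have := sE; lra.
pose h x := w false x + c * w true x; pose h1 x := w1 false x + c * w1 true x.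
have dh : der h h1 by move=> x; rewrite /h; D1_solve; rewrite /h1; ring.
have dh1 : der h1 (fun x => h x / 4).
  move=> x; rewrite /h1; D1_solve; rewrite /h /K2 /Minv /Nmat /= e5; field; exact: s1.
have ch := der_continuous dh; have ch1 := der_continuous dh1.
have h_eq0 x : 0 <= x <= L -> h x = 0.
  move=> hx; have cp : continuous (fun x => h1 x ^+ 2 + h x ^+ 2 / 4) by cont_tac.
  have D : der (fun x => h x * h1 x) (fun x => h1 x ^+ 2 + h x ^+ 2 / 4).
    by move=> t; D1_solve; field.
  have ge0 t : 0 <= h1 t ^+ 2 + h t ^+ 2 / 4 by rewrite addr_ge0 ?sqr_ge0 // divr_ge0 // sqr_ge0.
  have Fle : h L * h1 L <= h 0 * h1 0 by rewrite /h /h1 !p0 !p1.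
  have E := @der_ge0_eq0 R _ _ 0 L hL D cp (fun t _ => ge0 t) Fle x hx.
  move/eqP: E; rewrite paddr_eq0 ?sqr_ge0 // ?divr_ge0 ?sqr_ge0 // => /andP[_].
  by rewrite mulf_eq0 invr_eq0 pnatr_eq0 orbF sqrf_eq0 => /eqP.
have n1 := u1_0; have n2 := y_0; have n3 := y1_L.
pose a := w1 true 0 / u1 0; pose b := w true 0 / y 0.
pose W (_ : unit) x := w true x - a * u x - b * y x.
pose W1 (_ : unit) x := w1 true x - a * u1 x - b * y1 x.
have hu := du; have hu1 := du1; have hy := dy; have hy1 := dy1.
have hode : ode2 (fun _ _ => qs) (fun _ _ => 0) W W1.
  case; split; first by move=> x; rewrite /W; D1_solve; rewrite /W1; ring.
  move=> x; rewrite /W1 /=; D1_solve; rewrite /lin big_unit /W /K2 /Minv /Nmat /=.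
  by field; exact: s1.
have W0 x : 0 <= x <= L -> W tt x = 0 /\ W1 tt x = 0.
  move=> hx; apply: (ode2_zero _ hode _ _ tt hx) => // -[].
    by rewrite /W u_0 /b divfK ?gt_eqF //; ring.
  by rewrite /W1 y1_0 /a divfK ?lt_eqF //; ring.
have b0 : b = 0.
  have [] := W0 L; first by rewrite lexx ltW.
  move=> _; rewrite /W1 p1 u1_L /a divfK ?lt_eqF // subrr sub0r => /eqP.
  by rewrite oppr_eq0 mulf_eq0 (gt_eqF n3) orbF => /eqP.
exists a => x hx; have [E _] := W0 x hx; have E2 := h_eq0 x hx.
move: E E2; rewrite /W /h b0 mul0r subr0 => /eqP; rewrite subr_eq0 => /eqP ->.
by move=> E2; split => //; lra.
Qed.

Lemma sol_unique mu w w1 v v1 (a X : R) : sol mu w w1 -> sol mu v v1 ->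
  (forall i, w i a = v i a) -> (forall i, w1 i a = v1 i a) ->
  forall i x, a <= x <= X -> w i x = v i x /\ w1 i x = v1 i x.
Proof. by move=> hw hv; apply: ode2_unique hw hv _ => // i j; exact: K2_continuous. Qed.

Definition persol mu w w1 :=
  [/\ sol mu w w1, forall i, w i L = w i 0 & forall i, w1 i L = w1 i 0].

(** The odd part about L / 2 of a periodic solution vanishes at 0 and at L / 2, so
    [negative_dirichlet] applies to it. *)
Lemma negative_symmetric mu w w1 : mu < 0 -> persol mu w w1 ->
  forall i x, 0 <= x <= L -> w i (L - x) = w i x.
Proof.
move=> mu0 [hw p0 p1]; have hL := L0.
have hr := sol_reflect hw; have := sol_lin 1 (- 1) hw hr.
set o := (fun i x => _); set o1 := (fun i x => _) => ho.
have oz : forall i x, 0 <= x <= H -> o i x = 0.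
  apply: (negative_dirichlet mu0 ho) => i; rewrite /o.
    by rewrite subr0 p0; ring.
  by rewrite (_ : L - H = H); [ring|field].
move=> i x /andP[x0 xL]; case: (leP x H) => xH.
  by have := oz i x; rewrite x0 xH => /(_ isT); rewrite /o; lra.
have := oz i (L - x); rewrite /o (_ : L - (L - x) = x); last by ring.
have e : 0 <= L - x <= H by lra.
by move=> /(_ e); lra.
Qed.

(** Both solutions are symmetric about L / 2. Adding the reflected solution doubles them on [0, L]
    and makes the Neumann conditions at 0 and L / 2 explicit. *)
Lemma negative_periodic mu mu' w w1 v v1 : mu < 0 -> mu' < 0 ->
  persol mu w w1 -> persol mu' v v1 ->
  exists a b : R, [/\ (a != 0) || (b != 0),
    mu = mu' -> forall i x, 0 <= x <= L -> a * w i x + b * v i x = 0 &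
    mu != mu' -> forall i x, 0 <= x <= L -> a * w i x = 0 /\ b * v i x = 0].
Proof.
move=> m0 m0' hpw hpv; have hL := L0.
have sw := negative_symmetric m0 hpw; have sv := negative_symmetric m0' hpv.
have [hw p0 p1] := hpw; have [hv q0 q1] := hpv.
have ew := sol_lin 1 1 hw (sol_reflect hw); have ev := sol_lin 1 1 hv (sol_reflect hv).
have LH : L - H = H by field.
have [||||a [b [ab h1 h2]]] := negative_neumann m0 m0' ew ev.
- by move=> i; rewrite subr0 p1; ring.
- by move=> i; rewrite LH; ring.
- by move=> i; rewrite subr0 q1; ring.
- by move=> i; rewrite LH; ring.
have fold x : 0 <= x <= L -> exists2 x', 0 <= x' <= H & forall i, w i x' = w i x /\ v i x' = v i x.
  move=> hx; case: (leP x H) => xH; first by exists x => //; move: hx; case/andP=> -> _.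
  by exists (L - x); [lra|move=> i; rewrite sw // sv].
exists a, b; split => //.
- move=> e i x hx; have [x' hx' E] := fold x hx; have [<- <-] := E i.
  have := h1 e i x' hx'; rewrite sw ?sv; [lra|lra|lra].
- move=> e i x hx; have [x' hx' E] := fold x hx; have [<- <-] := E i.
  by have [] := h2 e i x' hx'; rewrite sw ?sv; [split; lra|lra|lra].
Qed.

(** Vanishing derivatives at L / 2 give the solution and its reflection about L / 2 the same Cauchy
    data there, so they agree up to L. The values at L are thus those at 0. *)
Lemma neumann_periodic mu w w1 : sol mu w w1 -> (forall i, w1 i 0 = 0) -> (forall i, w1 i H = 0) ->
  persol mu w w1.
Proof.
move=> hw n0 nH; have hL := L0; have LH : L - H = H by field.
have E := @sol_unique mu w w1 _ _ H L hw (sol_reflect hw).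
have hLL : H <= L <= L by lra.
have e i : w i L = w i 0 /\ w1 i L = w1 i 0.
  have [j|j|] := E _ _ i L hLL; rewrite ?LH ?nH ?oppr0 //.
  by rewrite subrr n0 oppr0 => -> ->.
by split=> // i; have [] := e i.
Qed.

Lemma neumann_basis mu : exists W : (bool -> bool -> R -> R) * (bool -> bool -> R -> R),
  forall k, [/\ sol mu (W.1 k) (W.2 k), forall i, W.1 k i 0 = (i == k)%:R & forall i, W.2 k i 0 = 0].
Proof.
have h k : exists w : (bool -> R -> R) * (bool -> R -> R),
    [/\ sol mu w.1 w.2, forall i, w.1 i 0 = (i == k)%:R & forall i, w.2 i 0 = 0].
  have [||w [w1 [h1 h2 h3]]] := @ode2_exists R bool (K2 mu) (fun _ _ => 0) (fun i => (i == k)%:R) (fun=> 0).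
  - by move=> i j; exact: K2_continuous.
  - by move=> i; exact: cont_cst.
  by exists (w, w1).
have /choice[W hW] := h.
by exists (fun k => (W k).1, fun k => (W k).2).
Qed.

Definition nb mu := projT1 (cid (neumann_basis mu)).
Definition nw mu := (nb mu).1.
Definition nw1 mu := (nb mu).2.

Lemma nw_sol mu k : sol mu (nw mu k) (nw1 mu k).
Proof. by have [] := projT2 (cid (neumann_basis mu)) k. Qed.

Lemma nw_0 mu k i : nw mu k i 0 = (i == k)%:R.
Proof. by have [_ h _] := projT2 (cid (neumann_basis mu)) k; exact: h. Qed.

Lemma nw1_0 mu k i : nw1 mu k i 0 = 0.
Proof. by have [_ _ h] := projT2 (cid (neumann_basis mu)) k; exact: h. Qed.

Definition ndet mu := nw1 mu true true H * nw1 mu false false H - nw1 mu true false H * nw1 mu false true H.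

Lemma K2_sub mu mu' i j x : K2 mu i j x - K2 mu' i j x = (mu' - mu) * Minv i j.
Proof. by rewrite /K2 /Nmat; case: j; ring. Qed.

Lemma K2_bound (B X : R) : exists2 M, 1 <= M &
  forall mu i j x, `|mu| <= B -> 0 <= x <= X -> `|K2 mu i j x| <= M.
Proof.
have [M M1 hM] := @bound_family R (bool * bool)%type (fun p => K2 0 p.1 p.2) 0 X
  (fun p => @K2_continuous 0 p.1 p.2).
have [M' M1' hM'] := @bound_family R (bool * bool)%type (fun p => cst (Minv p.1 p.2)) 0 0
  (fun p => @cont_cst R (Minv p.1 p.2)).
have hm i j : `|Minv i j| <= M' by have := hM' (i, j) 0; apply; rewrite lexx.
exists (M + `|B| * M'); first by rewrite -[1]addr0 lerD // mulr_ge0 //; lra.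
move=> mu i j x hmu hx.
rewrite -[K2 mu i j x](subrK (K2 0 i j x)) K2_sub addrC.
apply: le_trans (ler_normD _ _) (lerD (hM (i, j) x hx) _).
rewrite normrM sub0r normrN; apply: ler_pM => //.
by apply: le_trans hmu (ler_norm _).
Qed.

Lemma Minv_bound : exists2 M, 1 <= M & forall i j, `|Minv i j| <= M.
Proof.
have [M' M1' hM'] := @bound_family R (bool * bool)%type (fun p => cst (Minv p.1 p.2)) 0 0
  (fun p => @cont_cst R (Minv p.1 p.2)).
by exists M' => // i j; have := hM' (i, j) 0; apply; rewrite lexx.
Qed.

(** [K2] is affine in mu, so [ode2_close] makes the Neumann solutions locally Lipschitz in mu. *)
Lemma ndet_continuous : continuous ndet.
Proof.
have hH := H0.
have cn k i : continuous (fun mu => nw1 mu k i H).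
  move=> m; pose B := `|m| + 1.
  have [M M1 hM] := K2_bound B H; have [M' M1' hM'] := Minv_bound.
  have [A A1 hA] := @bound_family R bool (nw m k) 0 H (fun i => (sol_cont (nw_sol m k)).1 i).
  have lip mu : `|mu - m| <= 1 ->
      (nw1 mu k i H - nw1 m k i H) ^+ 2 <= expR (erate bool M * H) * (2 * (2 * M' * A) ^+ 2) * (mu - m) ^+ 2.
    move=> h1; have hmu : `|mu| <= B by have := ler_normD (mu - m) m; rewrite subrK /B; lra.
    have M0 : 0 <= M by lra.
    have e0 : 0 <= `|mu - m| * M' by rewrite mulr_ge0 //; lra.
    have hd i0 j t : 0 <= t <= H -> `|K2 mu i0 j t - K2 m i0 j t| <= `|mu - m| * M'.
      by move=> _; rewrite K2_sub normrM distrC ler_wpM2l.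
    have hH0 : 0 <= H <= H by rewrite lexx ltW.
    have := ode2_close (nw_sol mu k) (nw_sol m k) M0 e0 (fun i j t => hM mu i j t hmu) hd hA hH0.
    have -> : energy (fun i x => nw mu k i x - nw m k i x) (fun i x => nw1 mu k i x - nw1 m k i x) 0 = 0.
      by rewrite /energy big1 // => j _; rewrite !nw_0 !nw1_0 !subrr expr0n addr0.
    rewrite subr0 add0r card_bool.
    have [_ le1] := energy_ge (fun i x => nw mu k i x - nw m k i x) (fun i x => nw1 mu k i x - nw1 m k i x) H i.
    move=> le2; apply: le_trans le1 (le_trans le2 _).
    rewrite -(real_normK (num_real (mu - m))) le_eqVlt; apply/orP; left; apply/eqP; ring.
  move: lip; set C := expR _ * _ => lip.
  have C0 : 0 <= C by rewrite mulr_ge0 ?expR_ge0 // mulr_ge0 // sqr_ge0.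
  apply/cvgrPdist_lt => e e0.
  exists (Num.min 1 (e / (1 + C))); first by rewrite /= lt_min ltr01 divr_gt0 //; lra.
  move=> mu; rewrite /= /ball /= distrC lt_min => /andP[l1 l2].
  have := lip mu (ltW l1) => l3; rewrite distrC.
  have {}l2 : `|mu - m| * (1 + C) < e by rewrite -ltr_pdivlMr //; lra.
  rewrite -(ltr_pXn2r (n := 2)) ?nnegrE ?normr_ge0 ?(ltW e0) // real_normK ?num_real //.
  apply: le_lt_trans l3 _; rewrite -(real_normK (num_real (mu - m))).
  apply: le_lt_trans (_ : (`|mu - m| * (1 + C)) ^+ 2 < _).
    rewrite exprMn mulrC ler_wpM2l ?sqr_ge0 //; nra.
  by rewrite ltr_pXn2r ?nnegrE ?(ltW e0) // mulr_ge0 //; lra.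
have h1 := cn true true; have h2 := cn true false; have h3 := cn false true; have h4 := cn false false.
by rewrite /ndet; cont_tac.
Qed.

(** At mu = 0 the system decouples into h'' = h / 4 and f'' = qs f, so the Neumann solutions are
    explicit in g = cosh (x / 2) and y / y 0. The determinant is triangular and equals (y1 H / y 0)
    g1 H. *)
Lemma ndet_zero_lt0 : ndet 0 < 0.
Proof.
have hH := H0; have hy := dy; have hy1 := dy1; have s1 : s != 0 by rewrite gt_eqF.
have n1 := y_0; have n2 := y1_H; have n3 := y1_0.
have e5 : 5 = s + 4 * c ^+ 2 by have := sE; lra.
pose g x := (expR (x / 2) + expR (- (x / 2))) / 2 : R.
pose g1 x := (expR (x / 2) - expR (- (x / 2))) / 4 : R.
have dg : der g g1 by move=> x; rewrite /g; D1_solve; rewrite /g1; field.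
have dg1 : der g1 (fun x => g x / 4) by move=> x; rewrite /g1; D1_solve; rewrite /g; field.
have g_0 : g 0 = 1 by rewrite /g mul0r oppr0 expR0; field.
have g1_0 : g1 0 = 0 by rewrite /g1 mul0r oppr0 subrr mul0r.
pose a := (y 0)^-1.
pose F (i : bool) x := if i then 0 else g x.
pose F1 (i : bool) x := if i then 0 else g1 x.
(* The summand c g gives the second component the value 0 at 0. *)
pose T (i : bool) x := if i then a * y x else - c * (a * y x) + c * g x.
pose T1 (i : bool) x := if i then a * y1 x else - c * (a * y1 x) + c * g1 x.
have hF : sol 0 F F1.
  case; (split=> x; [rewrite /F /F1; D1_solve; ring|]); rewrite lin_bool addr0 /F1 /F /=.
  - by D1_solve; rewrite /K2 /Minv /Nmat /=; field; exact: s1.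
  - by D1_solve; rewrite /K2 /Minv /Nmat /= e5; field; exact: s1.
have hT : sol 0 T T1.
  case; (split=> x; [rewrite /T /T1; D1_solve; ring|]); rewrite lin_bool addr0 /T1 /T /=.
  - by D1_solve; rewrite /K2 /Minv /Nmat /=; field; exact: s1.
  - by D1_solve; rewrite /K2 /Minv /Nmat /= e5; field; exact: s1.
have ya : a * y 0 = 1 by rewrite /a mulVf // gt_eqF.
have hHH : 0 <= H <= H by rewrite lexx ltW.
have E1 i : nw1 0 true i H = T1 i H.
  have [] // := @sol_unique 0 _ _ _ _ 0 H (nw_sol 0 true) hT _ _ i H hHH.
    by move=> j; rewrite nw_0 /T; case: j; rewrite /= ?g_0 ya //; ring.
  by move=> j; rewrite nw1_0 /T1; case: j; rewrite n3 ?g1_0; ring.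
have E2 i : nw1 0 false i H = F1 i H.
  have [] // := @sol_unique 0 _ _ _ _ 0 H (nw_sol 0 false) hF _ _ i H hHH.
    by move=> j; rewrite nw_0 /F; case: j; rewrite /= ?g_0.
  by move=> j; rewrite nw1_0 /F1; case: j; rewrite ?g1_0.
rewrite /ndet !E1 !E2 /T1 /F1 mulr0 subr0.
have : 0 < g1 H by rewrite /g1 divr_gt0 // subr_gt0 ltr_expR; lra.
have : 0 < a by rewrite invr_gt0.
by move=> a0 gH; rewrite nmulr_rlt0 // pmulr_rlt0.
Qed.

(* The Gram matrix of the Neumann basis for the form [mform] is positive definite for
   very negative [mu], and its determinant is [4 s] times the product of the determinants of
   the values and of the derivatives. *)
Lemma ndet_gt0 : exists2 mu, mu < 0 & 0 < ndet mu.
Proof.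
have hH := H0; have hs := s0.
have e5 : 5 = s + 4 * c ^+ 2 by have := sE; lra.
have cA : continuous (fun x => s * qs x + c ^+ 2) by have h := cq; cont_tac.
have [M M1 hM] := continuous_itv_bounded 0 H cA.
(* M outweighs the potential and the rest the coupling terms, so that the density of the form minus
   mu |w| ^ 2 is at least |w| ^ 2. *)
pose mu := - (M + c ^+ 2 + 2); exists mu; first by have := sqr_ge0 c; rewrite /mu; lra.
pose W := nw mu; pose W1 := nw1 mu.
pose G k l x := mform (fun i => W k i x) (fun i => W1 l i x).
have dW k i : der (W k i) (W1 k i) := sol_der i (nw_sol mu k).
have [cW cW1] : (forall k i, continuous (W k i)) /\ (forall k i, continuous (W1 k i)).
  by split=> k; have [] := sol_cont (nw_sol mu k).
(* Green's identity for two solutions with zero derivatives at 0. *)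
have Gsym x : G true false x = G false true x.
  have h1 := mform_der (nw_sol mu false) (dW true true) (dW true false).
  have h2 := mform_der (nw_sol mu true) (dW false true) (dW false false).
  have D : der (fun x => G true false x - G false true x) (fun=> 0).
    move=> t; apply: D1_eq; first by apply: D1_add; [exact: h1|apply: D1_opp; exact: h2].
    by rewrite /dens /dotf /dot /mform /W /W1; ring.
  have := der_cst_eq x D (@D1_cst R 0); rewrite /G /mform /W1 !nw1_0 !subr0 => E.
  by apply/eqP; rewrite -subr_eq0; apply/eqP; rewrite E; ring.
(* The quadratic form of G at p is w . M w' for the solution w with data p. It starts from 0, and
   its derivative dominates |w| ^ 2, which is positive at 0. *)
have Gpos (p : bool -> R) x : 0 < x <= H -> (p true != 0) || (p false != 0) ->
    0 < p true ^+ 2 * G true true x + p true * p false * (G true false x + G false true x) + p false ^+ 2 * G false false x.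
  move=> /andP[x0 xH] pn.
  pose w i t := p true * W true i t + p false * W false i t.
  pose w1 i t := p true * W1 true i t + p false * W1 false i t.
  have hw : sol mu w w1 by apply: sol_lin; exact: nw_sol.
  have [cw cw1] := sol_cont hw.
  have dB := mform_der hw (sol_der true hw) (sol_der false hw).
  have -> : p true ^+ 2 * G true true x + p true * p false * (G true false x + G false true x) + p false ^+ 2 * G false false x
      = mform (fun i => w i x) (fun i => w1 i x) by rewrite /G /mform /w /w1; ring.
  have B0 : mform (fun i => w i 0) (fun i => w1 i 0) = 0.
    by rewrite /mform /w1 /W1 !nw1_0; ring.
  have ge0 t : 0 <= t <= x -> dotf w w t <= dens w w1 w w1 t - mu * dotf w w t.
    move=> /andP[t0 tx]; have := hM t; rewrite t0 (le_trans tx xH) => /(_ isT).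
    rewrite ler_norml => /andP[q1 _]; rewrite /dens /mform e5 /dotf /dot /mu.
    set a := w true t; set b := w false t; set a1 := w1 true t; set b1 := w1 false t.
    have h1 : 0 <= s * a1 ^+ 2 by rewrite mulr_ge0 ?sqr_ge0 // ltW.
    have h2 : 0 <= (2 * c * a1 + 2 * b1) ^+ 2 := sqr_ge0 _.
    have h3 : 0 <= (c * a + b) ^+ 2 := sqr_ge0 _.
    have h4 : 0 <= (s * qs t + c ^+ 2 + M) * a ^+ 2 by rewrite mulr_ge0 ?sqr_ge0 //; lra.
    have h5 : 0 <= (M + c ^+ 2) * b ^+ 2 by rewrite mulr_ge0 ?sqr_ge0 //; have := sqr_ge0 c; lra.
    by have := sqr_ge0 b; have := sqr_ge0 a; lra.
  have cf : continuous (fun t => dens w w1 w w1 t - mu * dotf w w t).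
    have h1 := dens_continuous cw cw1 cw cw1; have h2 := dotf_continuous cw cw; cont_tac.
  rewrite ltNge; apply/negP => le0; move: pn.
  have z0 : w true 0 = 0 /\ w false 0 = 0.
    have le2 : mform (fun i => w i x) (fun i => w1 i x) <= mform (fun i => w i 0) (fun i => w1 i 0) by rewrite B0.
    have E := der_ge0_eq0 x0 dB cf _ le2.
    have d0 : dotf w w 0 = 0.
      have x00 : (0 : R) <= 0 <= x by rewrite lexx ltW.
      have := ge0 0 x00; rewrite E // => [|t ht]; last first.
        exact: le_trans (dotf_ge0 w t) (ge0 t ht).
      by move=> le; apply/eqP; rewrite eq_le le dotf_ge0.
    by have := dotf_eq0 d0.
  by case: z0; rewrite /w /W !nw_0 /= !mulr1 !mulr0 addr0 add0r => -> ->; rewrite eqxx.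
pose dU x := W true true x * W false false x - W true false x * W false true x.
have Gdet x : G true true x * G false false x - G true false x * G false true x
    = 4 * s * dU x * (W1 true true x * W1 false false x - W1 true false x * W1 false true x).
  by rewrite /G /mform /dU e5; ring.
have Gdet0 x : 0 < x <= H -> 0 < G true true x * G false false x - G true false x * G false true x.
  move=> hx; have := Gpos (fun i => i%:R) x hx; rewrite /= oner_eq0 => /(_ isT).
  rewrite expr1n mul1r mulr0 !mul0r expr0n /= !mul0r !addr0 => gt.
  (* At this vector the quadratic form is [G true true x] times the determinant. *)
  have := Gpos (fun i => if i then - G true false x else G true true x) x hx.
  rewrite /= (gt_eqF gt) orbT => /(_ isT); rewrite -Gsym => h.
  have {}h : 0 < G true true x * (G true true x * G false false x - G true false x * G true false x) by lra.
  by rewrite pmulr_rgt0 in h.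
have cdU : continuous dU.
  have [a1 a2] := (cW true true, cW true false); have [a3 a4] := (cW false true, cW false false).
  by rewrite /dU; cont_tac.
(* The determinant of the values is 1 at 0, and a zero of it in ]0, H] would annihilate the positive
   Gram determinant. *)
have dUH : 0 < dU H.
  rewrite ltNge; apply/negP => le0.
  have d00 : dU 0 = 1 by rewrite /dU /W !nw_0 /=; ring.
  have [|x /andP[x0 xH] dx] := @IVT0 R dU 0 H (ltW hH) cdU; first by rewrite d00 mul1r.
  have xn : 0 < x by rewrite lt_def x0 andbT; apply: contra_eq_neq dx => ->; rewrite d00 oner_eq0.
  by have := Gdet0 x; rewrite xn xH => /(_ isT); rewrite Gdet dx mulr0 mul0r ltxx.
have := Gdet0 H; rewrite hH lexx => /(_ isT); rewrite Gdet pmulr_rgt0 //.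
by rewrite !mulr_gt0.
Qed.

Lemma negative_eigenvalue : exists mu w w1, [/\ mu < 0, persol mu w w1 & exists i, w i 0 != 0].
Proof.
have [m m0 dm] := ndet_gt0; have d0 := ndet_zero_lt0.
have [|mu /andP[_ mu0] dmu] := @IVT0 R ndet m 0 (ltW m0) ndet_continuous.
  by rewrite pmulr_rle0 // ltW.
have {}mu0 : mu < 0.
  by rewrite lt_neqAle mu0 andbT; apply: contra_eq_neq dmu => ->; rewrite lt_eqF.
(* A nonzero kernel vector of the singular 2 by 2 matrix, formed from its cofactors. *)
have [p [pn hp]] : exists p : bool -> R, (p true != 0) || (p false != 0) /\
    forall i, p true * nw1 mu true i H + p false * nw1 mu false i H = 0.
  move: dmu; rewrite /ndet; set A := nw1 _ _ _ _; set B := nw1 _ _ _ _.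
  set C := nw1 _ _ _ _; set D := nw1 _ _ _ _ => dmu.
  have [/andP[/eqP A0 /eqP D0]|] := boolP ((A == 0) && (D == 0)).
    have [C0|C0] := eqVneq C 0.
      by exists (fun i => i%:R); rewrite /= oner_eq0; split => // -[]; rewrite -/A -/B -/C -/D ?A0 ?C0; ring.
    exists (fun i => if i then - B else C); rewrite /= C0 orbT; split => // -[].
      by rewrite -/A -/D A0 D0; ring.
    by rewrite -/C -/B; ring.
  rewrite negb_and orbC => n; exists (fun i => if i then - D else A); rewrite /= oppr_eq0; split => // -[].
    by rewrite -/A -/D; ring.
  by rewrite -/C -/B -dmu; ring.
exists mu, (fun i x => p true * nw mu true i x + p false * nw mu false i x),
  (fun i x => p true * nw1 mu true i x + p false * nw1 mu false i x); split => //.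
  apply: neumann_periodic; first by apply: sol_lin; exact: nw_sol.
  - by move=> i; rewrite !nw1_0; ring.
  - by move=> i; rewrite hp.
case/orP: pn => pn; [exists true|exists false]; rewrite !nw_0 /= ?mulr0 ?mulr1 ?addr0 ?add0r //.
Qed.

End RealSystem.

(** * The dnoidal profile *)

Section Elliptic.
Variables (R : realType) (k : R).
Hypothesis k1 : k ^+ 2 < 1.
Local Notation mu := (@lebesgue_measure R).

Definition ell_del (t : R) : R := Num.sqrt (1 - k ^+ 2 * sin t ^+ 2).

Lemma sin2_le1 (t : R) : 0 <= sin t ^+ 2 <= 1.
Proof. by rewrite sqr_ge0 /= sin2cos2; have := sqr_ge0 (cos t); lra. Qed.

Lemma ell_arg_gt0 t : 0 < 1 - k ^+ 2 * sin t ^+ 2.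
Proof.
have /andP[h1 h2] := sin2_le1 t; have kk := k1.
have : 0 <= k ^+ 2 * (1 - sin t ^+ 2) by rewrite mulr_ge0 ?sqr_ge0 //; lra.
lra.
Qed.

Lemma ell_del_gt0 t : 0 < ell_del t.
Proof. by rewrite sqrtr_gt0 ell_arg_gt0. Qed.

Lemma ell_del_neq0 t : ell_del t != 0.
Proof. by rewrite gt_eqF // ell_del_gt0. Qed.

Lemma ell_del2 t : ell_del t ^+ 2 = 1 - k ^+ 2 * sin t ^+ 2.
Proof. by rewrite sqr_sqrtr // ltW // ell_arg_gt0. Qed.

Lemma ell_del_le1 t : ell_del t <= 1.
Proof.
rewrite -[leRHS]sqrtr1 ler_wsqrtr //.
by have /andP[h1 _] := sin2_le1 t; have := sqr_ge0 k; nra.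
Qed.

Lemma ell_del_der : der ell_del (fun t => - k ^+ 2 * sin t * cos t / ell_del t).
Proof.
move=> t; have h := ell_arg_gt0 t; have h2 := ell_del_neq0 t.
rewrite /ell_del; apply: D1_eq; first by D1_tac.
by rewrite -/(ell_del t) /=; field.
Qed.

Definition ell_f (t : R) : R := (ell_del t)^-1.

Lemma ell_f_continuous : continuous ell_f.
Proof.
move=> t; have h := ell_del_neq0 t; have d := ell_del_der.
apply: D1_continuous; rewrite /ell_f; D1_tac; exact: h.
Qed.

Lemma ell_f_ge1 t : 1 <= ell_f t.
Proof. by rewrite /ell_f invf_ge1 ?ell_del_gt0 // ell_del_le1. Qed.

Lemma ellipticFE t : ellipticF k t = prim ell_f t.
Proof. by []. Qed.

Lemma ell_F_der : der (ellipticF k) ell_f.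
Proof. exact: prim_der ell_f_continuous. Qed.

Lemma ell_F0 : ellipticF k 0 = 0.
Proof. exact: prim0. Qed.

Lemma ell_F_incr x y : x < y -> ellipticF k x < ellipticF k y.
Proof.
by move=> xy; apply: (der_incr xy ell_F_der) => t _; have := ell_f_ge1 t; lra.
Qed.

Lemma ell_F_lt x y : (ellipticF k x < ellipticF k y) = (x < y).
Proof.
case: (ltgtP x y) => [/ell_F_incr ->//|/ell_F_incr/lt_gtF ->//|->].
by rewrite ltxx.
Qed.

Lemma ell_F_inj : injective (ellipticF k).
Proof. by move=> x y e; case: (ltgtP x y) => // /ell_F_incr; rewrite e ltxx. Qed.

(** As [ell_f >= 1], the function F t - t is nondecreasing. So F M >= M and F (- M) <= - M, and M =
    |u| + 1 brackets u. *)
Lemma ell_F_surj u : exists t, ellipticF k t = u.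
Proof.
have d : der (fun t => ellipticF k t - t) (fun t => ell_f t - 1).
  by move=> t; have h := ell_F_der; D1_solve.
pose M : R := `|u| + 1.
have M0 : 0 <= M by rewrite /M; have := normr_ge0 u; lra.
have h1 : M <= ellipticF k M.
  have := der_ndecr M0 d; rewrite /= ell_F0 subrr => h.
  by rewrite -subr_ge0; apply: h => t _; have := ell_f_ge1 t; lra.
have h2 : ellipticF k (- M) <= - M.
  have M0' : - M <= 0 by rewrite oppr_le0.
  have := der_ndecr M0' d; rewrite /= ell_F0 subrr => h.
  by rewrite -subr_le0; apply: h => t _; have := ell_f_ge1 t; lra.
have /andP[Mu1 Mu2] : - M <= u <= M by rewrite -ler_norml /M; lra.
have ab : - M <= M by lra.
have cF : continuous (fun t => ellipticF k t - u).
  by have := der_continuous ell_F_der => h; cont_tac.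
have [|c _ /eqP] := @IVT0 _ _ _ _ ab cF; first by nra.
by rewrite subr_eq0 => /eqP; exists c.
Qed.

Lemma ell_amP u : ellipticF k (jacobi_am k u) = u.
Proof.
rewrite /jacobi_am; case: xgetP => [t _ //|h].
by have [t ht] := ell_F_surj u; have := h t; rewrite /= ht.
Qed.

Lemma ell_amK t : jacobi_am k (ellipticF k t) = t.
Proof. by apply: ell_F_inj; rewrite ell_amP. Qed.

Lemma ell_am_der : der (jacobi_am k) (fun u => ell_del (jacobi_am k u)).
Proof.
move=> u; rewrite -{1}(ell_amP u) -[ell_del _]invrK.
apply: (@is_derive_inverse _ (ellipticF k)).
- by near=> t; exact: ell_amK.
- by near=> t; exact: der_continuous ell_F_der t.
- exact: ell_F_der.
- by rewrite invr_eq0 ell_del_neq0.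
Unshelve. all: by end_near. Qed.

Lemma ell_am0 : jacobi_am k 0 = 0.
Proof. by apply: ell_F_inj; rewrite ell_amP ell_F0. Qed.

Lemma ell_F_opp t : ellipticF k (- t) = - ellipticF k t.
Proof.
have h := ell_F_der.
have d : der (fun t => ellipticF k (- t) + ellipticF k t) (fun=> 0).
  move=> x; apply: D1_eq; first by apply: D1_add; [apply: (D1_comp (ell_F_der _)); D1_tac|exact: h].
  by rewrite /ell_f /ell_del sinN sqrrN; ring.
have := der_cst_eq t d (@D1_cst R 0); rewrite /= !subr0 oppr0 ell_F0 addr0 => /eqP.
by rewrite addr_eq0 => /eqP.
Qed.

Lemma ell_F_pi t : ellipticF k (t + pi) = ellipticF k t + 2 * ellipticF k (pi / 2).
Proof.
have h := ell_F_der.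
have d : der (fun t => ellipticF k (t + pi)) ell_f.
  move=> x; apply: D1_eq; first by apply: (D1_comp (ell_F_der _)); D1_tac.
  by rewrite /= /ell_f /ell_del sinDpi sqrrN; ring.
have H x := der_cst_eq x d h.
(* Evaluation at - (pi / 2) identifies F pi as 2 F (pi / 2). *)
have := H (- (pi / 2)); rewrite /= ell_F0 add0r subr0 ell_F_opp.
have -> : - (pi / 2) + pi = pi / 2 :> R by field.
by have := H t; rewrite /= ell_F0 add0r subr0; lra.
Qed.

Lemma ell_K_sub (th : R) : 0 <= th -> th < pi / 2 ->
  (\int[mu]_(t in `[0%R, sin th]) ((Num.sqrt ((1 - k ^+ 2 * t ^+ 2) * (1 - t ^+ 2)))^-1)%:E
   = (ellipticF k th)%:E)%E.
Proof.
move=> th0 thp; pose G (t : R) : R := (Num.sqrt ((1 - k ^+ 2 * t ^+ 2) * (1 - t ^+ 2)))^-1.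
have pi0 := @pi_gt0 R.
have dsin : derive1 (@sin R) = @cos R by apply: der_derive1 => x; exact: D1_sin1.
have G_cont (t : R) : 0 <= t < 1 -> {for t, continuous G}.
  move=> /andP[t0 t1]; have kk := k1; have p1 : 0 < (1 - t) * (1 + t) by rewrite mulr_gt0 //; lra.
  have p2 : 0 <= k ^+ 2 * ((1 - t) * (1 + t)) by rewrite mulr_ge0 ?sqr_ge0 // ltW.
  have h : 0 < (1 - k ^+ 2 * t ^+ 2) * (1 - t ^+ 2) by rewrite mulr_gt0 //; lra.
  apply: D1_continuous; rewrite /G; D1_tac; first by rewrite gt_eqF // sqrtr_gt0.
  exact: h.
have sin1 : sin th < 1.
  by rewrite -[ltRHS]sin_pihalf ltr_sin ?in_itv /=; lra.
have := @integration_by_substitution_increasing R (@sin R) G 0 th th0.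
rewrite sin0 dsin => ->.
- rewrite ellipticFE /prim th0 -[RHS]fineK; last first.
    rewrite fin_numE; apply/andP; split => //.
  rewrite /= [RHS]/=.
  rewrite /Rintegral fineK; last first.
    by apply: integrable_fin_num => //; exact: continuous_lint ell_f_continuous 0 th.
  apply: eq_integral => x; rewrite inE /= in_itv /= => /andP[x0 xth].
  have C0 : 0 < cos x by apply: cos_gt0_pihalf; lra.
  congr EFin.
  transitivity ((Num.sqrt ((1 - k ^+ 2 * sin x ^+ 2) * (1 - sin x ^+ 2)))^-1 * cos x); first by [].
  rewrite /ell_f.
  have -> : 1 - sin x ^+ 2 = cos x ^+ 2 by rewrite cos2sin2.
  rewrite sqrtrM; last exact: ltW (ell_arg_gt0 x).
  rewrite sqrtr_sqr gtr0_norm // -/(ell_del x) invfM -mulrA mulVf ?mulr1 //.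
  by rewrite gt_eqF.
- move=> x y; rewrite !in_itv /= => /andP[x0 xth] /andP[y0 yth] xy.
  by rewrite ltr_sin ?in_itv /=; lra.
- by move=> x _; exact: continuous_cos.
- apply/cvg_ex; exists (cos 0); apply: cvg_at_right_filter; exact: continuous_cos.
- apply/cvg_ex; exists (cos th); apply: cvg_at_left_filter; exact: continuous_cos.
- split; first by move=> x _; exact: derivable_sin.
  + by apply: cvg_at_right_filter; exact: continuous_sin.
  + by apply: cvg_at_left_filter; exact: continuous_sin.
- apply: continuous_in_subspaceT => t; rewrite inE /= in_itv /= => /andP[t0 tth].
  by apply: G_cont; rewrite t0; lra.
Qed.

(** The integrand of K is unbounded near 1. The substitution by the sine is therefore made on
    intervals ending before 1, which exhaust [0, 1[, and monotone convergence gives the limit. *)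
Lemma ell_KE : ellipticK k = ellipticF k (pi / 2).
Proof.
pose G (t : R) : R := (Num.sqrt ((1 - k ^+ 2 * t ^+ 2) * (1 - t ^+ 2)))^-1.
have pi0 := @pi_gt0 R; have pi1 := @pihalf_ge1 R.
have mG : measurable_fun (`[0, 1[%classic : set R) G.
  apply: subspace_continuous_measurable_fun => //.
  apply: continuous_in_subspaceT => t; rewrite inE /= in_itv /= => /andP[t0 t1].
  have kk := k1; have p1 : 0 < (1 - t) * (1 + t) by rewrite mulr_gt0 //; lra.
  have p2 : 0 <= k ^+ 2 * ((1 - t) * (1 + t)) by rewrite mulr_ge0 ?sqr_ge0 // ltW.
  have h : 0 < (1 - k ^+ 2 * t ^+ 2) * (1 - t ^+ 2) by rewrite mulr_gt0 //; lra.
  apply: D1_continuous; rewrite /G; D1_tac; first by rewrite gt_eqF // sqrtr_gt0.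
  exact: h.
(* Nonnegative from n = 0 on, since pi / 2 >= 1. *)
pose th (n : nat) : R := pi / 2 - n.+1%:R^-1.
have thb n : 0 <= th n < pi / 2.
  have : 0 < n.+1%:R^-1 :> R by rewrite invr_gt0 ltr0n.
  have : n.+1%:R^-1 <= 1 :> R by rewrite invf_le1 ?ler1n ?ltr0n.
  by rewrite /th; set v := _^-1 => v1 v0; apply/andP; split; lra.
have sin_le (x y : R) : 0 <= x -> x <= y -> y <= pi / 2 -> sin x <= sin y.
  move=> x0; rewrite le_eqVlt => /predU1P[->//|xy] yp.
  by apply: ltW; rewrite ltr_sin ?in_itv /=; lra.
pose D (n : nat) := `[0%R, sin (th n)]%classic : set R.
have DU : \bigcup_n D n = `[0%R, 1[%classic.
  apply/seteqP; split => x.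
    move=> [n _]; rewrite /D /= !in_itv /= => /andP[-> /= xs].
    have /andP[t0 t1] := thb n; apply: le_lt_trans xs _.
    by rewrite -[ltRHS]sin_pihalf ltr_sin ?in_itv /=; lra.
  rewrite /= in_itv /= => /andP[x0 x1].
  have xi : -1 <= x < 1 by rewrite x1 andbT; lra.
  have xi' : x \in `[(-1), 1] by rewrite in_itv /=; lra.
  have hlt := asin_ltpi2 xi.
  have d0 : 0 < pi / 2 - asin x by lra.
  have d1 : 0 <= (pi / 2 - asin x)^-1 by rewrite invr_ge0 ltW.
  have := archi_boundP d1.
  set n := Num.bound _ => hn.
  exists n => //; rewrite /D /= in_itv /= x0 /= -{1}(asinK xi').
  have a0 : 0 <= asin x.
    rewrite leNgt; apply/negP => a0.
    have := asin_geNpi2 (_ : -1 <= x <= 1); rewrite (ltW x1) andbT => /(_ _) g.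
    have g' : - (pi / 2) <= asin x by apply: g; lra.
    have : sin (asin x) < sin 0 by rewrite ltr_sin ?in_itv /=; lra.
    by rewrite asinK // sin0; lra.
  apply: sin_le => //; last by have /andP[_ /ltW] := thb n.
  have : n.+1%:R^-1 <= pi / 2 - asin x.
    rewrite -[leRHS]invrK lef_pV2 ?posrE ?invr_gt0 ?ltr0n //.
    by apply: ltW; apply: lt_le_trans hn _; rewrite ler_nat.
  by rewrite /th; set v := _^-1; lra.
have H : (fun n => \int[mu]_(x in D n) (G x)%:E)%E @ \oo --> (\int[mu]_(x in \bigcup_n D n) (G x)%:E)%E.
  apply: ge0_nondecreasing_set_cvg_integral.
  - apply/nondecreasing_seqP => n; rewrite subsetEset => x; rewrite /D /= !in_itv /= => /andP[-> /= xs].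
    apply: le_trans xs _; have /andP[t0 t1] := thb n; have /andP[t2 t3] := thb n.+1.
    apply: sin_le => //; last exact: ltW.
    by rewrite /th lerD2l lerN2 lef_pV2 ?posrE ?ltr0n // ler_nat.
  - by move=> n; exact: measurable_itv.
  - move=> n; apply/measurable_EFinP; apply: measurable_funS mG => //.
    by rewrite -DU; exact: bigcup_sup.
  - by move=> n x _; rewrite lee_fin invr_ge0 sqrtr_ge0.
have H2 : (fun n => \int[mu]_(x in D n) (G x)%:E)%E @ \oo --> (ellipticF k (pi / 2))%:E.
  rewrite (_ : (fun n => _) = (fun n => (ellipticF k (th n))%:E)); last first.
    by apply/funext => n; have /andP[t0 t1] := thb n; rewrite /D (ell_K_sub t0 t1).
  apply: cvg_EFin; first exact: nearW.
  apply: (@continuous_cvg _ _ _ _ _ _ (ellipticF k)); first exact: der_continuous ell_F_der _.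
  rewrite -[pi / 2 in X in _ --> X]subr0; apply: cvgB; first exact: cvg_cst.
  exact: cvg_harmonic.
have E := cvg_unique _ H H2.
(* The end point 1, where the inverse of 0 takes its default value, is removed as a null set. *)
rewrite /ellipticK /Rintegral -integral_itv_bndo_bndc; last exact/measurable_EFinP.
by rewrite -DU E.
Qed.

Lemma ell_am_opp u : jacobi_am k (- u) = - jacobi_am k u.
Proof. by apply: ell_F_inj; rewrite ell_F_opp !ell_amP. Qed.

Lemma ell_am_period u : jacobi_am k (u + 2 * ellipticK k) = jacobi_am k u + pi.
Proof. by apply: ell_F_inj; rewrite ell_F_pi !ell_amP ell_KE. Qed.

Lemma ell_am_lt u v : (jacobi_am k u < jacobi_am k v) = (u < v).
Proof. by rewrite -ell_F_lt !ell_amP. Qed.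

Lemma ell_amK2 : jacobi_am k (ellipticK k) = pi / 2.
Proof. by rewrite ell_KE ell_amK. Qed.

End Elliptic.

(** * Roots of the first integral and the profile equation *)

Section DnoidalProfile.
Variables (R : realType) (c a4 : R).
Hypotheses (c0 : 0 < c) (c1 : c < 1).
Hypothesis ha4 : alpha4_min c < a4 < alpha4_max c.

Local Notation r := (rr c).
Local Notation s := (ss c).
Local Notation a1 := (alpha1 a4 c).
Local Notation a3 := (alpha3 a4 c).
Local Notation k := (modulus a4 c).
Local Notation gam := (wave_gamma a4 c).
Local Notation phi := (dnoidal a4 c).

Lemma rr_gt0 : 0 < r.
Proof.
have h0 := c0; have h1 := c1.
have : 0 < (1 - c) * (1 + c) by rewrite mulr_gt0 //; lra.
by rewrite /rr; lra.
Qed.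

Lemma ss_gt0 : 0 < s.
Proof. by have := rr_gt0; rewrite /rr /ss; lra. Qed.

(** The square of the positive equilibrium of the profile equation, the centre surrounded by the
    periodic orbits. *)
Definition acen : R := alpha4_min c.

Lemma acenE : acen ^+ 2 + acen = r.
Proof.
have r0 := rr_gt0; rewrite /acen /alpha4_min.
have : Num.sqrt (1 + 4 * r) ^+ 2 = 1 + 4 * r by rewrite sqr_sqrtr //; lra.
set q := Num.sqrt _ => hq.
have -> : ((-1 + q) / 2) ^+ 2 + (-1 + q) / 2 = (q ^+ 2 - 1) / 4 by field.
by rewrite hq; field.
Qed.

Lemma acen_gt0 : 0 < acen.
Proof.
have r0 := rr_gt0; rewrite /acen /alpha4_min.
have : 1 < Num.sqrt (1 + 4 * r) by rewrite -[ltLHS]sqrtr1 ltr_sqrt; lra.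
lra.
Qed.

Lemma acen_lt : acen < a4.
Proof. by case/andP: ha4. Qed.

Lemma a4_gt0 : 0 < a4.
Proof. exact: lt_trans acen_gt0 acen_lt. Qed.

Lemma a4_low : r < a4 ^+ 2 + a4.
Proof. by rewrite -acenE; have := acen_lt; have := acen_gt0; nra. Qed.

Lemma a4_high : a4 ^+ 2 + 3 / 2 * a4 < 3 * r.
Proof.
have r0 := rr_gt0; case/andP: ha4 => _; rewrite /alpha4_max.
have q0 := sqrtr_ge0 (9 + 48 * r).
have : Num.sqrt (9 + 48 * r) ^+ 2 = 9 + 48 * r by rewrite sqr_sqrtr //; lra.
set q := Num.sqrt _ in q0 *; have := a4_gt0; nra.
Qed.

Definition adif : R := Num.sqrt 3 * Num.sqrt (dn_beta a4 c).

Lemma adif_gt0 : 0 < adif /\ adif ^+ 2 = 3 * dn_beta a4 c.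
Proof.
have b0 : 0 < dn_beta a4 c.
  by rewrite /dn_beta; have := a4_high; have := a4_gt0; have := rr_gt0; lra.
split; first by rewrite mulr_gt0 // sqrtr_gt0.
by rewrite /adif exprMn !sqr_sqrtr // ltW.
Qed.

(** Vieta's relations: [alpha1], [alpha3] and a4 are the values q = phi ^ 2 at which the first
    integral makes 2 q ^ 3 + 3 q ^ 2 - 6 r q constant. *)
Lemma a13_sum : a1 + a3 = - a4 - 3 / 2.
Proof. by rewrite /alpha1 /alpha3; field. Qed.

Lemma a13_prod : a1 * a3 = a4 ^+ 2 + 3 / 2 * a4 - 3 * r.
Proof.
have [_] := adif_gt0; rewrite /adif /alpha1 /alpha3 /dn_beta.
set q := Num.sqrt 3 * Num.sqrt _ => hq.
have -> : (- 2 * a4 - 3 - q) / 4 * ((- 2 * a4 - 3 + q) / 4) = ((2 * a4 + 3) ^+ 2 - q ^+ 2) / 16 by field.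
by rewrite hq; field.
Qed.

Lemma a1_lt0 : a1 < 0.
Proof.
have [q0 _] := adif_gt0; rewrite /alpha1 -/adif; have := a4_gt0; lra.
Qed.

Lemma a3_gt0 : 0 < a3.
Proof. by have := a1_lt0; have := a13_prod; have := a4_high; nra. Qed.

(** Both sides are half the derivative of that cubic at its root a4. *)
Lemma a41_a43 : (a4 - a1) * (a4 - a3) = 3 * (a4 ^+ 2 + a4 - r).
Proof.
have -> : (a4 - a1) * (a4 - a3) = a4 ^+ 2 - a4 * (a1 + a3) + a1 * a3 by ring.
by rewrite a13_sum a13_prod; field.
Qed.

Lemma a3_lt : a3 < a4.
Proof.
have := a41_a43; have := a4_low; have := a1_lt0; have := a4_gt0; nra.
Qed.

Lemma modulus2 : k ^+ 2 = - a1 * (a4 - a3) / (a4 * (a3 - a1)).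
Proof.
rewrite /modulus sqr_sqrtr //; have := a3_lt; have := a1_lt0; have := a3_gt0; have := a4_gt0.
by move=> *; rewrite divr_ge0 // mulr_ge0 //; lra.
Qed.

Lemma modulus2_lt1 : k ^+ 2 < 1.
Proof.
rewrite modulus2; have h1 := a3_lt; have h2 := a1_lt0; have h3 := a3_gt0; have h4 := a4_gt0.
rewrite ltr_pdivrMr ?mul1r; first by nra.
by rewrite mulr_gt0 //; lra.
Qed.

Definition dn_rho : R := a4 * k ^+ 2 / (- a1).

Lemma dn_rhoE : dn_rho = (a4 - a3) / (a3 - a1).
Proof.
rewrite /dn_rho modulus2; have h1 := a3_lt; have h2 := a1_lt0; have h3 := a3_gt0; have h4 := a4_gt0.
by field; apply/and3P; split; apply/eqP; lra.
Qed.

Lemma dn_rho_gt0 : 0 < dn_rho.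
Proof.
rewrite dn_rhoE; have h1 := a3_lt; have h2 := a1_lt0; have h3 := a3_gt0.
by rewrite divr_gt0 //; lra.
Qed.

Lemma gam2 : gam ^+ 2 = a4 * (a3 - a1) / (3 * s).
Proof.
rewrite /wave_gamma sqr_sqrtr //; have h1 := a3_lt; have h2 := a1_lt0; have h3 := a3_gt0.
have h4 := a4_gt0; have h5 := ss_gt0.
by rewrite divr_ge0 // mulr_ge0 //; lra.
Qed.

Lemma gam_gt0 : 0 < gam.
Proof.
have h1 := a3_lt; have h2 := a1_lt0; have h3 := a3_gt0.
have h4 := a4_gt0; have h5 := ss_gt0.
by rewrite sqrtr_gt0 divr_gt0 // mulr_gt0 //; lra.
Qed.

Definition dn_theta (x : R) : R := jacobi_am k (gam * x).
Definition dn_den (x : R) : R := Num.sqrt (1 + dn_rho * sin (dn_theta x) ^+ 2).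

Lemma dn_theta_der : der dn_theta (fun x => gam * ell_del k (dn_theta x)).
Proof.
move=> x; have h := ell_am_der modulus2_lt1.
apply: D1_eq; first by apply: (D1_comp (h _)); D1_tac.
by rewrite mulrC.
Qed.

Lemma dn_den_arg_gt0 x : 0 < 1 + dn_rho * sin (dn_theta x) ^+ 2.
Proof. by have := sqr_ge0 (sin (dn_theta x)); have := dn_rho_gt0; nra. Qed.

Lemma dn_den_gt0 x : 0 < dn_den x.
Proof. by rewrite sqrtr_gt0 dn_den_arg_gt0. Qed.

Lemma dn_den2 x : dn_den x ^+ 2 = 1 + dn_rho * sin (dn_theta x) ^+ 2.
Proof. by rewrite sqr_sqrtr // ltW // dn_den_arg_gt0. Qed.

Lemma phiE x : phi x = Num.sqrt a4 * ell_del k (dn_theta x) / dn_den x.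
Proof. by []. Qed.

Lemma phi_gt0 x : 0 < phi x.
Proof.
rewrite phiE divr_gt0 ?dn_den_gt0 // mulr_gt0 //; first by rewrite sqrtr_gt0 a4_gt0.
exact: (ell_del_gt0 modulus2_lt1).
Qed.

Definition dnoidal1 (x : R) : R :=
  - Num.sqrt a4 * gam * (k ^+ 2 + dn_rho) * sin (dn_theta x) * cos (dn_theta x) / dn_den x ^+ 3.

Lemma dn_den_der : der dn_den
  (fun x => dn_rho * sin (dn_theta x) * cos (dn_theta x) * (gam * ell_del k (dn_theta x)) / dn_den x).
Proof.
move=> x; have h := dn_den_arg_gt0 x; have d := dn_theta_der.
have n0 : dn_den x != 0 by rewrite gt_eqF // dn_den_gt0.
rewrite /dn_den; apply: D1_eq; first by D1_tac.
by rewrite -/(dn_den x) /=; field.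
Qed.

Lemma dn_del_der : der (fun x => ell_del k (dn_theta x))
  (fun x => - gam * k ^+ 2 * sin (dn_theta x) * cos (dn_theta x)).
Proof.
move=> x; have n0 := ell_del_neq0 modulus2_lt1 (dn_theta x).
apply: D1_eq; first exact: (D1_comp (ell_del_der modulus2_lt1 _) (dn_theta_der x)).
by field.
Qed.

Lemma phi_der : der phi dnoidal1.
Proof.
move=> x; have n0 : dn_den x != 0 by rewrite gt_eqF // dn_den_gt0.
have d1 := dn_den_der; have d2 := dn_del_der.
apply: (D1_ext (fun y => esym (phiE y))).
apply: D1_eq.
  apply: D1_mul; last by apply: D1_inv => //; apply: d1.
  by apply: D1_mul; [exact: D1_cst|exact: d2].
rewrite /dnoidal1.
have e1 := dn_den2 x; have e2 := ell_del2 modulus2_lt1 (dn_theta x).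
set S := sin _ in e1 e2 *; set C := cos _; set d := ell_del _ _ in e2 *; set e := dn_den x in n0 e1 *.
(* The squares of e and d give k ^ 2 e ^ 2 + rho d ^ 2 = k ^ 2 + rho. *)
have -> : - Num.sqrt a4 * gam * (k ^+ 2 + dn_rho) * S * C / e ^+ 3 =
  - Num.sqrt a4 * gam * S * C * (k ^+ 2 * e ^+ 2 + dn_rho * d ^+ 2) / e ^+ 3.
  by rewrite e1 e2; ring.
by field.
Qed.

Definition dnoidal2 (x : R) : R := (r * phi x - phi x ^+ 3 - phi x ^+ 5) / s.

Lemma dnoidal1_der : der dnoidal1 dnoidal2.
Proof.
move=> x; have n0 : dn_den x != 0 by rewrite gt_eqF // dn_den_gt0.
have n1 := ell_del_neq0 modulus2_lt1 (dn_theta x).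
have d1 := dn_den_der; have d2 := dn_theta_der.
rewrite /dnoidal1; apply: D1_eq.
  apply: D1_mul; last by apply: D1_inv; [rewrite expf_neq0|D1_tac].
  by D1_tac.
rewrite /dnoidal2 phiE /=.
have e1 := dn_den2 x; have e2 := ell_del2 modulus2_lt1 (dn_theta x).
have e3 := cos2sin2 (dn_theta x).
set S := sin _ in e1 e2 e3 *; set C := cos _ in e3 *.
set d := ell_del _ _ in n1 e2 *; set e := dn_den x in n0 e1 *.
have q2 : Num.sqrt a4 ^+ 2 = a4 by rewrite sqr_sqrtr // ltW // a4_gt0.
set q := Num.sqrt a4 in q2 *.
have s0 : s != 0 by rewrite gt_eqF // ss_gt0.
(* The profile equation freed of the factor q d / e ^ 5 is a polynomial identity in S ^ 2. Vieta's
   relations eliminate a1 and r. *)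
have key : - gam ^+ 2 * (k ^+ 2 + dn_rho) * ((1 - 2 * S ^+ 2) * (1 + dn_rho * S ^+ 2) - 3 * dn_rho * S ^+ 2 * (1 - S ^+ 2))
   = (r * (1 + dn_rho * S ^+ 2) ^+ 2 - a4 * (1 - k ^+ 2 * S ^+ 2) * (1 + dn_rho * S ^+ 2)
       - a4 ^+ 2 * (1 - k ^+ 2 * S ^+ 2) ^+ 2) / s.
  rewrite gam2 modulus2 dn_rhoE.
  have h1 := a3_lt; have h2 := a1_lt0; have h3 := a3_gt0; have h4 := a4_gt0.
  have E1 : a1 = - a4 - 3 / 2 - a3 by rewrite -a13_sum; ring.
  have E2 : r = (a4 ^+ 2 + 3 / 2 * a4 - a1 * a3) / 3 by rewrite a13_prod; field.
  have m0 : a3 - a1 != 0 by apply/eqP; lra.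
  have m1 : a4 != 0 by rewrite gt_eqF.
  rewrite E2; move: m0 m1; rewrite E1 => m0 m1.
  by field; repeat (apply/andP; split); rewrite ?s0 ?m1 //; apply/eqP; lra.
transitivity (q * d / e ^+ 5 * (- gam ^+ 2 * (k ^+ 2 + dn_rho) *
   ((1 - 2 * S ^+ 2) * (1 + dn_rho * S ^+ 2) - 3 * dn_rho * S ^+ 2 * (1 - S ^+ 2)))).
  have -> : 1 - 2 * S ^+ 2 = C ^+ 2 - S ^+ 2 by rewrite e3; ring.
  by rewrite -e1 -e3; field.
rewrite key -e1 -e2.
have -> : a4 * d ^+ 2 * e ^+ 2 = q ^+ 2 * d ^+ 2 * e ^+ 2 by rewrite q2.
have -> : a4 ^+ 2 = q ^+ 4 by rewrite -q2; ring.
by field; rewrite n0 s0.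
Qed.

End DnoidalProfile.

(** * The linearised profile equation *)

Section SecondSolution.
Variables (R : realType) (L c a4 : R).
Hypotheses (c0 : 0 < c) (c1 : c < 1).
Hypothesis ha4 : alpha4_min c < a4 < alpha4_max c.
Hypothesis hT : dnoidal_period a4 c = L.

Local Notation r := (rr c).
Local Notation s := (ss c).
Local Notation a1 := (alpha1 a4 c).
Local Notation a3 := (alpha3 a4 c).
Local Notation k := (modulus a4 c).
Local Notation gam := (wave_gamma a4 c).
Local Notation phi := (dnoidal a4 c).
Local Notation phi1 := (dnoidal1 c a4).
Local Notation phi2 := (dnoidal2 c a4).
Local Notation theta := (dn_theta c a4).
Local Notation ae := (acen c).

Let k1 : k ^+ 2 < 1 := modulus2_lt1 c0 c1 ha4.

Lemma gamL : gam * L = 2 * ellipticK k.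
Proof.
have h1 := a3_lt c0 c1 ha4; have h2 := a1_lt0 c0 c1 ha4; have h3 := a3_gt0 c0 c1 ha4.
have h4 := a4_gt0 c0 c1 ha4; have h5 := ss_gt0 c0 c1.
rewrite -hT /dnoidal_period /wave_gamma.
have p : 0 < a4 * (a3 - a1) by rewrite mulr_gt0 //; lra.
have ps : 0 < 3 * s by lra.
rewrite sqrtrM ?(ltW p) // sqrtrV ?(ltW ps) //.
have n1 : Num.sqrt (a4 * (a3 - a1)) != 0 by rewrite gt_eqF // sqrtr_gt0.
have n2 : Num.sqrt (3 * s) != 0 by rewrite gt_eqF // sqrtr_gt0.
by field; rewrite n1 n2.
Qed.

Lemma thetaL x : theta (x + L) = theta x + pi.
Proof. by rewrite /dn_theta mulrDr gamL (ell_am_period k1). Qed.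

Lemma theta_opp x : theta (- x) = - theta x.
Proof. by rewrite /dn_theta mulrN (ell_am_opp k1). Qed.

Lemma theta0 : theta 0 = 0.
Proof. by rewrite /dn_theta mulr0 (ell_am0 k1). Qed.

Lemma thetaH : theta (L / 2) = pi / 2.
Proof.
rewrite /dn_theta.
have -> : gam * (L / 2) = ellipticK k by rewrite mulrA gamL; field.
exact: (ell_amK2 k1).
Qed.

Lemma dn_den_sym x : dn_den c a4 (- x) = dn_den c a4 x.
Proof. by rewrite /dn_den theta_opp sinN sqrrN. Qed.

Lemma dn_denL x : dn_den c a4 (x + L) = dn_den c a4 x.
Proof. by rewrite /dn_den thetaL sinDpi sqrrN. Qed.

Lemma phi_opp x : phi (- x) = phi x.
Proof. by rewrite !phiE dn_den_sym /ell_del theta_opp sinN sqrrN. Qed.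

Lemma phiL x : phi (x + L) = phi x.
Proof. by rewrite !phiE dn_denL /ell_del thetaL sinDpi sqrrN. Qed.

Lemma phi_reflect x : phi (L - x) = phi x.
Proof. by rewrite addrC phiL phi_opp. Qed.

Lemma phi1L x : phi1 (x + L) = phi1 x.
Proof. by rewrite /dnoidal1 dn_denL thetaL sinDpi cosDpi; ring. Qed.

Lemma phi1_0 : phi1 0 = 0.
Proof. by rewrite /dnoidal1 theta0 sin0; ring. Qed.

Lemma phi1_H : phi1 (L / 2) = 0.
Proof. by rewrite /dnoidal1 thetaH cos_pihalf; ring. Qed.

Lemma L_gt0 : 0 < L.
Proof.
have g0 := gam_gt0 c0 c1 ha4.
have : theta 0 < theta (L / 2) by rewrite theta0 thetaH; have := @pi_gt0 R; lra.
by rewrite /dn_theta (ell_am_lt k1) ltr_pM2l //; lra.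
Qed.

Lemma phi1_lt0 x : 0 < x < L / 2 -> phi1 x < 0.
Proof.
move=> /andP[x0 xH]; have g0 := gam_gt0 c0 c1 ha4.
have t0 : 0 < theta x by rewrite -theta0 /dn_theta (ell_am_lt k1) ltr_pM2l.
have tH : theta x < pi / 2 by rewrite -thetaH /dn_theta (ell_am_lt k1) ltr_pM2l.
have hs : 0 < sin (theta x) by apply: sin_gt0_pihalf; rewrite t0.
have hc : 0 < cos (theta x) by apply: cos_gt0_pihalf; rewrite tH andbT; have := @pi_gt0 R; lra.
have hr := dn_rho_gt0 c0 c1 ha4; have hk := sqr_ge0 k.
have hq : 0 < Num.sqrt a4 by rewrite sqrtr_gt0; exact: a4_gt0 c0 c1 ha4.
rewrite /dnoidal1 -!mulrA mulNr oppr_lt0 !mulr_gt0 //; first by lra.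
by rewrite invr_gt0 exprn_gt0 // dn_den_gt0.
Qed.

Lemma phi2_0 : phi2 0 < 0.
Proof.
have s0 := ss_gt0 c0 c1; have q0 := a4_gt0 c0 c1 ha4.
have E : phi 0 = Num.sqrt a4.
  by rewrite phiE /ell_del /dn_den theta0 sin0 expr0n /= !mulr0 subr0 addr0 sqrtr1 mulr1 divr1.
have e2 : Num.sqrt a4 ^+ 2 = a4 by rewrite sqr_sqrtr // ltW.
have p0 : 0 < Num.sqrt a4 by rewrite sqrtr_gt0.
rewrite /dnoidal2 E pmulr_llt0 ?invr_gt0 //.
have -> : r * Num.sqrt a4 - Num.sqrt a4 ^+ 3 - Num.sqrt a4 ^+ 5 =
  Num.sqrt a4 * (r - Num.sqrt a4 ^+ 2 - (Num.sqrt a4 ^+ 2) ^+ 2) by ring.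
by rewrite e2 pmulr_rlt0 //; have := a4_low c0 c1 ha4; lra.
Qed.

Lemma phi2_H : 0 < phi2 (L / 2).
Proof.
have s0 := ss_gt0 c0 c1; have p0 := phi_gt0 c0 c1 ha4 (L / 2).
have h1 := a3_lt c0 c1 ha4; have h2 := a1_lt0 c0 c1 ha4; have h3 := a3_gt0 c0 c1 ha4.
have h4 := a4_gt0 c0 c1 ha4.
have E : phi (L / 2) ^+ 2 = a3.
  rewrite phiE exprMn exprVn exprMn (dn_den2 c0 c1 ha4) (ell_del2 k1) sqr_sqrtr ?ltW //.
  rewrite thetaH sin_pihalf expr1n !mulr1 (dn_rhoE c0 c1 ha4) (modulus2 c0 c1 ha4).
  by field; repeat (apply/andP; split); apply/eqP; lra.
have lo : a3 ^+ 2 + a3 < r.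
  (* Half the derivative of the cubic at its root a3, negative because a3 is the middle root. *)
  have e : (a3 - a1) * (a3 - a4) = 3 * (a3 ^+ 2 + a3 - r).
    have -> : (a3 - a1) * (a3 - a4) = a3 ^+ 2 - a3 * a4 + (a4 - a3) * a1 by ring.
    have E1 : a1 = - a4 - 3 / 2 - a3 by rewrite -(a13_sum c a4); ring.
    have E2 : r = (a4 ^+ 2 + 3 / 2 * a4 - a1 * a3) / 3 by rewrite (a13_prod c0 c1 ha4); field.
    by rewrite E2 E1; field.
  have : (a3 - a1) * (a3 - a4) < 0 by rewrite nmulr_llt0; lra.
  lra.
rewrite /dnoidal2 divr_gt0 //.
have -> : r * phi (L / 2) - phi (L / 2) ^+ 3 - phi (L / 2) ^+ 5 =
  phi (L / 2) * (r - phi (L / 2) ^+ 2 - (phi (L / 2) ^+ 2) ^+ 2) by ring.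
by rewrite E mulr_gt0 //; lra.
Qed.

(* With V the potential of the conservative equation phi'' = - V'(phi),
   normalised by V = 0 at the centre, [pN] is V / V'^2; its convexity is
   Chicone's criterion for the monotonicity of the period. *)
Definition pN (p : R) : R := s * (2 * p ^+ 2 + 4 * ae + 3) / (12 * p ^+ 2 * (p ^+ 2 + ae + 1) ^+ 2).
Definition pN1 (p : R) : R :=
  s / 12 * (- 8 * p / (p ^+ 2 + ae + 1) ^+ 3
    - (4 * ae + 3) * (2 / (p ^+ 3 * (p ^+ 2 + ae + 1) ^+ 2) + 4 / (p * (p ^+ 2 + ae + 1) ^+ 3))).
Definition pN2 (p : R) : R :=
  s / 12 * (8 * (5 * p ^+ 2 - (ae + 1)) * p ^+ 4
    + (4 * ae + 3) * (42 * p ^+ 4 + 24 * p ^+ 2 * (ae + 1) + 6 * (ae + 1) ^+ 2))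
  / (p ^+ 4 * (p ^+ 2 + ae + 1) ^+ 4).
Definition pG (p : R) : R := (p ^+ 5 + p ^+ 3 - r * p) / s.
Definition pG1 (p : R) : R := (5 * p ^+ 4 + 3 * p ^+ 2 - r) / s.
Definition pG2 (p : R) : R := (20 * p ^+ 3 + 6 * p) / s.

Lemma pN2_gt0 p : 0 < p -> 0 < pN2 p.
Proof.
move=> p0; have a0 := acen_gt0 c0 c1; have s0 := ss_gt0 c0 c1.
have p2 : 0 < p ^+ 2 by rewrite exprn_gt0.
have p4 : 0 < p ^+ 4 by rewrite exprn_gt0.
have d0 : 0 < p ^+ 2 + ae + 1 by lra.
rewrite /pN2 divr_gt0 //; last by rewrite mulr_gt0 // exprn_gt0.
rewrite mulr_gt0 ?divr_gt0 //.
(* After expansion the only negative term, - 8 (ae + 1) p ^ 4, is absorbed by 42 (4 ae + 3) p ^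
   4. *)
have -> : 8 * (5 * p ^+ 2 - (ae + 1)) * p ^+ 4
    + (4 * ae + 3) * (42 * p ^+ 4 + 24 * p ^+ 2 * (ae + 1) + 6 * (ae + 1) ^+ 2)
  = 40 * p ^+ 2 * p ^+ 4 + (160 * ae + 118) * p ^+ 4
    + (4 * ae + 3) * (24 * p ^+ 2 * (ae + 1) + 6 * (ae + 1) ^+ 2) by ring.
rewrite !addr_gt0 // !mulr_gt0 //; try lra.
by rewrite addr_gt0 // ?mulr_gt0 // ?exprn_gt0 //; lra.
Qed.

Lemma pN_der p : 0 < p -> D1 pN p (pN1 p).
Proof.
move=> p0; have a0 := acen_gt0 c0 c1.
have p2 : 0 < p ^+ 2 by rewrite exprn_gt0.
have n1 : p ^+ 2 + ae + 1 != 0 by apply/eqP; lra.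
have n2 : p != 0 by rewrite gt_eqF.
rewrite /pN /pN1; apply: D1_eq; first by D1_tac; rewrite !mulf_neq0 ?expf_neq0 // pnatr_eq0.
by rewrite /=; field; rewrite n1 n2.
Qed.

Lemma pN1_der p : 0 < p -> D1 pN1 p (pN2 p).
Proof.
move=> p0; have a0 := acen_gt0 c0 c1.
have p2 : 0 < p ^+ 2 by rewrite exprn_gt0.
have n1 : p ^+ 2 + ae + 1 != 0 by apply/eqP; lra.
have n2 : p != 0 by rewrite gt_eqF.
rewrite /pN1 /pN2; apply: D1_eq; first by D1_tac; rewrite ?mulf_neq0 ?expf_neq0.
by rewrite /=; field; rewrite n1 n2.
Qed.

(* The derivative of the identity [pN1 * pG + 2 * pN * pG1 = 1]. *)
Lemma pN_key p : 0 < p -> pN2 p * pG p + 3 * pN1 p * pG1 p + 2 * pN p * pG2 p = 0.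
Proof.
move=> p0; have a0 := acen_gt0 c0 c1; have s0 := ss_gt0 c0 c1.
have p2 : 0 < p ^+ 2 by rewrite exprn_gt0.
have n1 : p ^+ 2 + ae + 1 != 0 by apply/eqP; lra.
have n2 : p != 0 by rewrite gt_eqF.
have n3 : s != 0 by rewrite gt_eqF.
rewrite /pN2 /pN1 /pN /pG /pG1 /pG2 -(acenE c0 c1) -/(acen c).
by field; rewrite n1 n2 n3.
Qed.

Let dphi : der phi phi1 := phi_der c0 c1 ha4.
Let dphi1 : der phi1 phi2 := dnoidal1_der c0 c1 ha4.

Lemma phi2E x : phi2 x = - pG (phi x).
Proof. by rewrite /dnoidal2 /pG; ring. Qed.

Definition yW_arg (x : R) : R := pN2 (phi x) * phi1 x ^+ 2.

Lemma phi_den_neq0 x : phi x ^+ 2 + ae + 1 != 0 /\ phi x != 0.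
Proof.
have p0 := phi_gt0 c0 c1 ha4 x; have a0 := acen_gt0 c0 c1.
have p2 : 0 < phi x ^+ 2 by rewrite exprn_gt0.
by split; [apply/eqP; lra|rewrite gt_eqF].
Qed.

Lemma yW_arg_continuous : continuous yW_arg.
Proof.
have d1 := dphi; have d2 := dphi1.
move=> x; have [n1 n2] := phi_den_neq0 x.
apply: D1_continuous; rewrite /yW_arg /pN2; D1_tac.
by rewrite mulf_neq0 // expf_neq0.
Qed.

Definition yW : R -> R := prim yW_arg.
(** Let E = phi'^2 / 2 + V(phi) be the energy. This is E times the derivative in E of the even
    solution of the profile equation: it is an even solution of the linearised equation, and its
    Wronskian with phi' is E. All its terms are periodic but the one with [yW], which measures how
    the period varies with E. *)
Definition ysol (x : R) : R :=
  pN (phi x) * pG (phi x) + pN1 (phi x) * phi1 x ^+ 2 / 2 - phi1 x * yW x / 2.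
Definition ysol1 (x : R) : R := pN (phi x) * pG1 (phi x) * phi1 x + pG (phi x) * yW x / 2.
Definition qs (x : R) : R := (r - 3 * phi x ^+ 2 - 5 * phi x ^+ 4) / s.

Lemma qsE x : qs x = - pG1 (phi x).
Proof. by rewrite /qs /pG1; ring. Qed.

Lemma qs_reflect x : qs (L - x) = qs x.
Proof. by rewrite /qs phi_reflect. Qed.

Lemma qs_continuous : continuous qs.
Proof. by have d := dphi; rewrite /qs; cont_tac. Qed.

Lemma phi2_der : der phi2 (fun x => qs x * phi1 x).
Proof.
by move=> x; have d := dphi; rewrite /dnoidal2 /qs; D1_solve; rewrite /=; ring.
Qed.

Let dpN : der (fun x => pN (phi x)) (fun x => pN1 (phi x) * phi1 x).
Proof. by move=> x; apply: D1_comp (dphi x); exact: pN_der (phi_gt0 c0 c1 ha4 x). Qed.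

Let dpN1 : der (fun x => pN1 (phi x)) (fun x => pN2 (phi x) * phi1 x).
Proof. by move=> x; apply: D1_comp (dphi x); exact: pN1_der (phi_gt0 c0 c1 ha4 x). Qed.

Let dpG : der (fun x => pG (phi x)) (fun x => pG1 (phi x) * phi1 x).
Proof. by move=> x; have d := dphi; rewrite /pG /pG1; D1_solve; rewrite /=; ring. Qed.

Let dpG1 : der (fun x => pG1 (phi x)) (fun x => pG2 (phi x) * phi1 x).
Proof. by move=> x; have d := dphi; rewrite /pG1 /pG2; D1_solve; rewrite /=; ring. Qed.

Let dW : der yW yW_arg := prim_der yW_arg_continuous.

Lemma ysol_der : der ysol ysol1.
Proof.
move=> x; have d1 := dpN; have d2 := dpN1; have d3 := dpG; have d4 := dphi1; have d5 := dW.
rewrite /ysol; apply: D1_eq; first by D1_tac; first [exact: d1|exact: d2|exact: d3].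
by rewrite /= /ysol1 /yW_arg phi2E; field.
Qed.

Lemma ysol1_der : der ysol1 (fun x => qs x * ysol x).
Proof.
move=> x; have d1 := dpN; have d2 := dpG1; have d3 := dpG; have d4 := dphi1; have d5 := dW.
rewrite /ysol1; apply: D1_eq; first by D1_tac; first [exact: d1|exact: d2|exact: d3].
rewrite /= /ysol /yW_arg phi2E qsE.
have := pN_key (phi_gt0 c0 c1 ha4 x).
set p := phi x; set u := phi1 x; set w := yW x => key.
have {}key : 2 * pN p * pG2 p = - pN2 p * pG p - 3 * pN1 p * pG1 p by lra.
apply: (@mulfI _ 2); first by rewrite pnatr_eq0.
transitivity (u ^+ 2 * (2 * pN p * pG2 p) + 2 * pN1 p * pG1 p * u ^+ 2
  - 2 * pN p * pG1 p * pG p + pG1 p * u * w + pG p * pN2 p * u ^+ 2); first by field.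
by rewrite key; field.
Qed.

Lemma yW_gt0 x : 0 < x -> 0 < yW x.
Proof.
move=> x0; have L0 := L_gt0.
have h0 t : 0 <= yW_arg t.
  by rewrite /yW_arg mulr_ge0 ?sqr_ge0 // ltW // pN2_gt0 //; exact: phi_gt0.
pose m := Num.min x (L / 2).
have m0 : 0 < m by rewrite lt_min x0 /=; lra.
have mx : m <= x by rewrite ge_min lexx.
have mH : m <= L / 2 by rewrite ge_min lexx orbT.
have e0 : yW 0 = 0 by exact: prim0.
have h1 : yW 0 < yW m.
  apply: (der_incr m0 dW) => t /andP[t0 tm].
  have hp : phi1 t < 0 by apply: phi1_lt0; rewrite t0; lra.
  by rewrite /yW_arg mulr_gt0 ?pN2_gt0 ?(phi_gt0 c0 c1 ha4) // exprn_even_gt0 //= lt_eqF.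
have h2 : yW m <= yW x by apply: (der_ndecr mx dW) => t _.
by rewrite -e0; apply: lt_le_trans h1 h2.
Qed.

Lemma pN_gt0 p : 0 < p -> 0 < pN p.
Proof.
move=> p0; have a0 := acen_gt0 c0 c1; have s0 := ss_gt0 c0 c1.
have p2 : 0 < p ^+ 2 by rewrite exprn_gt0.
by rewrite /pN divr_gt0 // !mulr_gt0 ?exprn_gt0 //; lra.
Qed.

Lemma ysol_0 : 0 < ysol 0.
Proof.
rewrite /ysol phi1_0 expr0n /= mulr0 mul0r addr0 mul0r mul0r subr0.
rewrite mulr_gt0 ?pN_gt0 ?(phi_gt0 c0 c1 ha4) //.
by have := phi2_0; rewrite phi2E oppr_lt0.
Qed.

Lemma ysol1_0 : ysol1 0 = 0.
Proof. by rewrite /ysol1 phi1_0 /yW prim0; ring. Qed.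

Lemma ysol_H : ysol (L / 2) < 0.
Proof.
rewrite /ysol phi1_H expr0n /= mulr0 mul0r addr0 mul0r mul0r subr0.
rewrite pmulr_rlt0 ?pN_gt0 ?(phi_gt0 c0 c1 ha4) //.
by have := phi2_H; rewrite phi2E oppr_gt0.
Qed.

(** phi' vanishes at L / 2 and leaves V'(phi) [yW] / 2. There phi lies below the centre, so V' is
    negative; at L it lies above, which reverses the sign. *)
Lemma ysol1_H : ysol1 (L / 2) < 0.
Proof.
have w0 : 0 < yW (L / 2) by apply: yW_gt0; have := L_gt0; lra.
rewrite /ysol1 phi1_H mulr0 add0r pmulr_llt0 // pmulr_llt0 //.
by have := phi2_H; rewrite phi2E oppr_gt0.
Qed.

Lemma ysol1_L : 0 < ysol1 L.
Proof.
have w0 : 0 < yW L by apply: yW_gt0; exact: L_gt0.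
have e1 : phi1 L = 0 by rewrite -[L]add0r phi1L phi1_0.
rewrite /ysol1 e1 mulr0 add0r divr_gt0 // mulr_gt0 //.
have -> : phi L = phi 0 by rewrite -[L]add0r phiL.
by have := phi2_0; rewrite phi2E oppr_lt0.
Qed.

End SecondSolution.

(** * Nonreal eigenvalues and accumulation points *)

Lemma bolzano_weierstrass (R : realType) (J : finType) (p : nat -> J -> R) :
  (forall n j, `|p n j| <= 1) ->
  exists q : J -> R, forall (eta : R) (N : nat), 0 < eta ->
    exists2 n, (N <= n)%N & forall j, `|p n j - q j| < eta.
Proof.
move=> hp; pose v n : 'rV[R]_#|J| := \row_i p n (enum_val i).
have hc : compact [set w : 'rV[R]_#|J| | forall i, `[(- 1), 1]%classic (w ord0 i)].
  by apply: (@rV_compact R #|J| (fun=> `[(- 1 : R), 1]%classic)) => i; exact: segment_compact.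
have [|q [_ hq]] := hc (v @ \oo) _.
  exists 0%N => // n _ i; rewrite /= mxE in_itv /= -ler_norml; exact: hp.
exists (fun j => q ord0 (enum_rank j)) => eta N e0.
have hN : (v @ \oo) [set v n | n in [set n | (N <= n)%N]].
  by exists N => // n /= hn; exists n.
have [_ [[n hn <-] hb]] := hq _ _ hN (nbhsx_ballx q eta e0).
exists n => // j; move: hb; rewrite mx_norm_ball /ball_ /= [X in X < _]mx_normrE => /bigmax_ltP[_ /(_ (ord0, enum_rank j) isT)].
by rewrite !mxE enum_rankK distrC.
Qed.

(** Since w is known to vanish only to the right of 0, its derivative at 0 is reached through the
    product w w1: it is 0 at both ends, and on [0, L] its derivative is w1 ^ 2. *)
Lemma ode2_vanish (R : realType) (I : finType) (K : I -> I -> R -> R) (w w1 : I -> R -> R) (L : R) :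
  0 < L -> (forall i j, continuous (K i j)) -> ode2 K (fun _ _ => 0) w w1 ->
  (forall i x, 0 <= x <= L -> w i x = 0) -> forall i, w1 i 0 = 0.
Proof.
move=> L0 cK hw wz i; have [d1 d2] := hw i.
have cw j : continuous (w j) := der_continuous (hw j).1.
have cw1 : continuous (w1 i) := der_continuous d2.
have cl := @lin_continuous R I K w i cK cw.
have D : der (fun x => w i x * w1 i x) (fun x => w1 i x ^+ 2 + w i x * lin K w i x).
  by move=> x; D1_solve; ring.
have cf : continuous (fun x => w1 i x ^+ 2 + w i x * lin K w i x).
  have cwi := cw i; by cont_tac.
have h0 : (0 : R) <= 0 <= L by rewrite lexx ltW.
have hLL : 0 <= L <= L by rewrite lexx ltW.
have le : w i L * w1 i L <= w i 0 * w1 i 0 by rewrite !wz // !mul0r.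
have ge x : 0 <= x <= L -> 0 <= w1 i x ^+ 2 + w i x * lin K w i x.
  by move=> hx; rewrite wz // mul0r addr0 sqr_ge0.
have := der_ge0_eq0 L0 D cf ge le h0.
by rewrite wz // mul0r addr0 => /eqP; rewrite sqrf_eq0 => /eqP.
Qed.

Lemma close_close (R : realType) (a b b' e : R) :
  `|a - b| < e / 2 -> `|a - b'| < e / 2 -> `|b - b'| <= e.
Proof.
rewrite !ltr_norml => /andP[? ?] /andP[? ?].
by rewrite ler_norml; apply/andP; split; lra.
Qed.

Section ComplexSystem.
Variables (R : realType) (s c L : R) (qs : R -> R).
Hypotheses (s0 : 0 < s) (sE : s = 5 - 4 * c ^+ 2) (L0 : 0 < L) (cq : continuous qs).
Local Notation sol := (@sol R s c qs).
Local Notation persol := (@persol R s c L qs).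
Local Notation K2 := (@K2 R s c qs).
Local Notation Minv := (@Minv R s c).
Local Notation mform := (@mform R c).
Local Notation J := (bool * bool)%type.

(* The first index distinguishes real and imaginary parts, the second one the components. *)
Definition K4 (mu nu : R) (p q : J) (x : R) : R :=
  if p.1 == q.1 then K2 mu p.2 q.2 x else (if p.1 then nu else - nu) * Minv p.2 q.2.

Definition percsol mu nu (b w w1 : J -> R -> R) :=
  [/\ ode2 (K4 mu nu) b w w1, forall i, w i L = w i 0 & forall i, w1 i L = w1 i 0].

Lemma K4_continuous mu nu p q : continuous (K4 mu nu p q).
Proof.
have h1 := @K2_continuous R s c qs cq mu p.2 q.2.
have h2 := @cont_cst R ((if p.1 then nu else - nu) * Minv p.2 q.2).
have [E|E] := boolP (p.1 == q.1).
  by rewrite (_ : K4 mu nu p q = K2 mu p.2 q.2) //; apply/funext => x; rewrite /K4 E.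
rewrite (_ : K4 mu nu p q = fun=> (if p.1 then nu else - nu) * Minv p.2 q.2) //.
by apply/funext => x; rewrite /K4 (negbTE E).
Qed.

Lemma big_bool2 (F : J -> R) :
  \sum_p F p = F (true, true) + F (true, false) + (F (false, true) + F (false, false)).
Proof.
rewrite (eq_bigr (fun p => F (p.1, p.2))); last by case.
by rewrite -(pair_bigA _ (fun i j => F (i, j))) /= !big_bool.
 Qed.

Lemma lin4 mu nu w (p : bool) i x : lin (K4 mu nu) w (p, i) x =
  K2 mu i true x * w (p, true) x + K2 mu i false x * w (p, false) x
  + (if p then nu else - nu) * (Minv i true * w (~~ p, true) x + Minv i false * w (~~ p, false) x).
Proof. by rewrite /lin big_bool2 /K4; case: p => /=; ring. Qed.

(** For real part u and imaginary part v, the derivative of v . M u' - u . M v' is nu (|u| ^ 2 + |v|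
    ^ 2), and by periodicity its integral over [0, L] is zero. *)
Lemma nonreal_percsol mu nu w w1 : nu != 0 -> percsol mu nu (fun _ _ => 0) w w1 ->
  forall p x, 0 <= x <= L -> w p x = 0.
Proof.
move=> nu0 [hw p0 p1]; have s1 : s != 0 by rewrite gt_eqF.
have e5 : 5 = s + 4 * c ^+ 2 by have := sE; lra.
pose u i := w (true, i); pose u1 i := w1 (true, i).
pose v i := w (false, i); pose v1 i := w1 (false, i).
have cw p : continuous (w p) := der_continuous (hw p).1.
have D : der (fun x => mform (fun i => v i x) (fun i => u1 i x) - mform (fun i => u i x) (fun i => v1 i x))
    (fun x => nu * (dotf u u x + dotf v v x)).
  move=> x; have [d1 d2] := hw (true, true); have [d3 d4] := hw (true, false).
  have [d5 d6] := hw (false, true); have [d7 d8] := hw (false, false).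
  rewrite /mform /u /u1 /v /v1; D1_solve.
  rewrite !lin4 /dotf /dot /u /v /K2 /Minv /Nmat e5 /=; field; exact: s1.
have cd : continuous (fun x => dotf u u x + dotf v v x).
  by apply: cont_add; apply: dotf_continuous => i; exact: cw.
have dd := prim_der cd.
have hn : prim (fun x => dotf u u x + dotf v v x) L = 0.
  have D2 : der (fun x => mform (fun i => v i x) (fun i => u1 i x) - mform (fun i => u i x) (fun i => v1 i x)
      - nu * prim (fun x => dotf u u x + dotf v v x) x) (fun=> 0).
    move=> x; apply: D1_eq; first apply: D1_add; first exact: D.
      by apply: D1_opp; apply: D1_mul; [exact: D1_cst|exact: dd].
    by rewrite /=; ring.
  have := der_cst_eq L D2 (@D1_cst R 0); rewrite /mform /u /u1 /v /v1 !p0 !p1 prim0 => E.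
  have {E} : nu * prim (fun x => dotf u u x + dotf v v x) L = 0 by move: E; rewrite /u /v; lra.
  by move/eqP; rewrite mulf_eq0 (negbTE nu0) => /eqP.
move=> [p i] x hx.
have ge t : 0 <= t <= L -> 0 <= dotf u u t + dotf v v t by move=> _; rewrite addr_ge0 // dotf_ge0.
have le : prim (fun x => dotf u u x + dotf v v x) L <= prim (fun x => dotf u u x + dotf v v x) 0.
  by rewrite hn prim0.
have := der_ge0_eq0 L0 dd cd ge le hx.
move/eqP; rewrite paddr_eq0 ?dotf_ge0 // => /andP[/eqP e1 /eqP e2].
by case: p; [exact: (dotf_eq0 e1)|exact: (dotf_eq0 e2)].
Qed.

Lemma percsol_real mu w w1 : percsol mu 0 (fun _ _ => 0) w w1 ->
  forall p, persol mu (fun i => w (p, i)) (fun i => w1 (p, i)).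
Proof.
move=> [hw p0 p1] p; split; [|by move=> i; rewrite p0|by move=> i; rewrite p1].
move=> i; have [d1 d2] := hw (p, i); split => // x; apply: D1_eq (d2 x) _.
by rewrite lin4 lin_bool; case: p {d1 d2} => /=; ring.
Qed.

Lemma no_accumulation mu0 : exists2 e, 0 < e & forall mu w w1, mu != mu0 -> `|mu - mu0| < e ->
  persol mu w w1 -> forall i, w i 0 = 0 /\ w1 i 0 = 0.
Proof.
apply: contrapT => hN.
have {}hN n : exists m : R * (bool -> R -> R) * (bool -> R -> R),
    [/\ m.1.1 != mu0, `|m.1.1 - mu0| < n.+1%:R^-1, persol m.1.1 m.1.2 m.2 &
        energy m.1.2 m.2 0 = 1].
  apply: contrapT => h; apply: hN; exists n.+1%:R^-1; first by rewrite invr_gt0.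
  move=> mu w w1 ne lt hw; apply: contrapT => nz; apply: h.
  have e0 : 0 < energy w w1 0.
    rewrite lt_def energy_ge0 andbT; apply/eqP => E; apply: nz => i.
    have [] := energy_ge w w1 0 i; rewrite E => l1 l2.
    by split; apply/eqP; rewrite -sqrf_eq0 eq_le sqr_ge0 andbT.
  pose k := (Num.sqrt (energy w w1 0))^-1.
  exists (mu, (fun i x => k * w i x + 0 * w i x), (fun i x => k * w1 i x + 0 * w1 i x)); split => //=.
    case: hw => hw p0 p1; split; first exact: sol_lin.
    - by move=> i; rewrite p0.
    - by move=> i; rewrite p1.
  transitivity (k ^+ 2 * energy w w1 0).
    by rewrite /energy mulr_sumr; apply: eq_bigr => i _; ring.
  by rewrite /k exprVn sqr_sqrtr ?energy_ge0 // mulVf // gt_eqF.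
have /choice[m hm] := hN.
pose W n := (m n).1.2; pose W1 n := (m n).2.
pose p n (j : J) := if j.1 then W n j.2 0 else W1 n j.2 0.
have hp n j : `|p n j| <= 1.
  have [_ _ _ e1] := hm n; have [] := energy_ge (W n) (W1 n) 0 j.2; rewrite /W /W1 e1 => l1 l2.
  by rewrite -(@ler_pXn2r _ 2) ?nnegrE // real_normK ?num_real // expr1n /p; case: j.1.
have [q hq] := bolzano_weierstrass hp.
have [||z [z1 [hz z0 z10]]] := @ode2_exists R bool (K2 mu0) (fun _ _ => 0) (fun i => q (true, i)) (fun i => q (false, i)).
- by move=> i j; exact: (@K2_continuous R s c qs cq).
- by move=> i; exact: cont_cst.
have {}hz : sol mu0 z z1 by [].
have [cz cz1] := sol_cont hz.
have [M M1 hM] := K2_bound s c cq (`|mu0| + 1) L; have [M' M1' hM'] := Minv_bound s c.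
have [A A1 hA] := @bound_family R bool z 0 L cz.
have M0 : 0 <= M by lra.
have close eps : 0 < eps -> exists n, forall i x, 0 <= x <= L ->
    `|W n i x - z i x| < eps /\ `|W1 n i x - z1 i x| < eps.
  (* The energy of W n - z is at most C eta ^ 2: the 4 stems from the initial data, the other
     summand from the change of coefficients in [ode2_close]. *)
  move=> eps0; pose C := expR (erate bool M * L) * (4 + 2 * (2 * (M' * A)) ^+ 2).
  have C0 : 0 < C.
    rewrite mulr_gt0 ?expR_gt0 //; have : 0 <= (2 * (M' * A)) ^+ 2 by exact: sqr_ge0.
    by lra.
  pose eta := Num.min 1 (eps / (1 + C)).
  have eta0 : 0 < eta by rewrite lt_min ltr01 divr_gt0 //; lra.
  have eta1 : eta <= 1 by rewrite ge_min lexx.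
  have etaE : eta * (1 + C) <= eps by rewrite -ler_pdivlMr; [rewrite ge_min lexx orbT|lra].
  have [N hN1] : exists N : nat, N.+1%:R^-1 <= eta.
    exists (Num.bound eta^-1); rewrite invf_ple ?posrE //.
    apply: ltW; apply: lt_trans (archi_boundP _) _; first by rewrite invr_ge0 ltW.
    by rewrite ltr_nat.
  have [n Nn hn] := hq eta N eta0; exists n => i x /andP[x0 xL].
  have [ne lt [hw _ _] _] := hm n.
  have dmu : `|(m n).1.1 - mu0| <= eta.
    apply: le_trans (ltW lt) (le_trans _ hN1).
    by rewrite lef_pV2 ?posrE // ler_nat.
  have bmu : `|(m n).1.1| <= `|mu0| + 1.
    by have := ler_normD ((m n).1.1 - mu0) mu0; rewrite subrK; lra.
  have eM0 : 0 <= eta * M' by rewrite mulr_ge0 ?(ltW eta0) // (le_trans ler01).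
  have hd i0 j t : 0 <= t <= L -> `|K2 (m n).1.1 i0 j t - K2 mu0 i0 j t| <= eta * M'.
    by move=> _; rewrite K2_sub normrM distrC; apply: ler_pM.
  have hx : 0 <= x <= L by rewrite x0.
  have := ode2_close hw hz M0 eM0 (fun i j t => hM _ i j t bmu) hd hA hx.
  rewrite card_bool -/(W n) -/(W1 n).
  have en0 : energy (fun i x => W n i x - z i x) (fun i x => W1 n i x - z1 i x) 0 <= 4 * eta ^+ 2.
    have l1 i0 : (W n i0 0 - z i0 0) ^+ 2 <= eta ^+ 2.
      rewrite z0 -(real_normK (num_real (_ - _))) ler_pXn2r ?nnegrE ?(ltW eta0) //.
      exact: ltW (hn (true, i0)).
    have l2 i0 : (W1 n i0 0 - z1 i0 0) ^+ 2 <= eta ^+ 2.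
      rewrite z10 -(real_normK (num_real (_ - _))) ler_pXn2r ?nnegrE ?(ltW eta0) //.
      exact: ltW (hn (false, i0)).
    rewrite /energy big_bool /=.
    by have := l1 true; have := l1 false; have := l2 true; have := l2 false; lra.
  move=> le.
  have {}le : energy (fun i x => W n i x - z i x) (fun i x => W1 n i x - z1 i x) x <= C * eta ^+ 2.
    apply: le_trans le _; rewrite /C -mulrA; apply: ler_pM; rewrite ?expR_ge0 //.
    - by rewrite addr_ge0 ?energy_ge0 // mulr_ge0 // sqr_ge0.
    - rewrite ler_expR subr0 ler_wpM2l // addr_ge0 // mulr_ge0 //.
    - by lra.
  have lt2 : C * eta ^+ 2 < eps ^+ 2.
    apply: lt_le_trans (_ : (eta * (1 + C)) ^+ 2 <= _).
      rewrite exprMn [X in _ < X]mulrC ltr_pM2r ?exprn_gt0 //; nra.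
    by rewrite ler_pXn2r ?nnegrE ?(ltW eps0) // mulr_ge0 ?(ltW eta0) //; lra.
  have [l1 l2] := energy_ge (fun i x => W n i x - z i x) (fun i x => W1 n i x - z1 i x) x i.
  have lt3 := le_lt_trans le lt2.
  split; rewrite -(@ltr_pXn2r _ 2) ?nnegrE ?(ltW eps0) // real_normK ?num_real //.
    exact: le_lt_trans l1 lt3.
  exact: le_lt_trans l2 lt3.
have small (a : R) : (forall eps, 0 < eps -> `|a| <= eps) -> a = 0.
  move=> h; apply/eqP; rewrite -normr_le0 leNgt; apply/negP => a0.
  have : 0 < `|a| / 2 by lra.
  by move/h; lra.
have h0L : (0 : R) <= 0 <= L by rewrite lexx ltW.
have hLL : 0 <= L <= L by rewrite lexx ltW.
(* Periodicity passes to z, as some W n is arbitrarily close to it uniformly on [0, L], together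
   with the derivatives. *)
have zL i : z i L = z i 0 /\ z1 i L = z1 i 0.
  split; apply/eqP; rewrite -subr_eq0; apply/eqP; apply: small => eps eps0;
  have e2 : 0 < eps / 2 by lra.
    have [n hn] := close _ e2; have [_ _ [_ p0 _] _] := hm n.
    have [+ _] := hn i L hLL; have [+ _] := hn i 0 h0L; rewrite /W p0.
    by move=> h1 h2; exact: close_close h2 h1.
  have [n hn] := close _ e2; have [_ _ [_ _ p1] _] := hm n.
  have [_ +] := hn i L hLL; have [_ +] := hn i 0 h0L; rewrite /W1 p1.
  by move=> h1 h2; exact: close_close h2 h1.
have cd := dotf_continuous cz cz; have dd := prim_der cd.
(* z is orthogonal to each W n, whose eigenvalue differs from mu0, and it is approximated uniformly
   by such functions. *)
have int0 : prim (dotf z z) L = 0.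
  apply: small => eps eps0; have e2 : 0 < eps / (2 * A * L + 1).
    by rewrite divr_gt0 // addr_gt0 // !mulr_gt0 //; lra.
  have [n hn] := close _ e2; have [ne _ [hw p0 p1] _] := hm n.
  have O : prim (dotf (W n) z) L = 0.
    apply: (orthogonality s0 sE ne hw hz); rewrite /mform !p0 !p1.
    by have [-> ->] := zL true; have [-> ->] := zL false.
  have [cw cw1] := sol_cont hw.
  have cdw := dotf_continuous cw cz.
  have -> : prim (dotf z z) L = prim (fun x => 1 * dotf z z x + (- 1) * dotf (W n) z x) L.
    by rewrite prim_lin // O; ring.
  have cg : continuous (fun x => 1 * dotf z z x + (- 1) * dotf (W n) z x).
    by have h1 := cd; have h2 := cdw; cont_tac.
  have dg := prim_der cg.
  have [t /andP[t0 tL]] := MVT_le (ltW L0) (fun x _ => dg x).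
  rewrite prim0 !subr0 => ->; rewrite normrM (gtr0_norm L0) -ler_pdivlMr //.
  have ht : 0 <= t <= L by rewrite t0 tL.
  have -> : 1 * dotf z z t + -1 * dotf (W n) z t =
      - ((W n true t - z true t) * z true t + (W n false t - z false t) * z false t).
    by rewrite /dotf /dot; ring.
  rewrite normrN; apply: le_trans (ler_normD _ _) _; rewrite !normrM.
  have bd i : `|W n i t - z i t| * `|z i t| <= eps / (2 * A * L + 1) * A.
    by apply: ler_pM => //; [have [/ltW] := hn i t ht|exact: hA].
  apply: le_trans (lerD (bd true) (bd false)) _.
  rewrite ler_pdivlMr //.
  rewrite (_ : _ * L = eps * ((2 * A * L) / (2 * A * L + 1))); last by ring.
  have AL : 0 < 2 * A * L by rewrite !mulr_gt0 // (lt_le_trans ltr01).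
  rewrite -[leRHS]mulr1 ler_wpM2l ?(ltW eps0) // ler_pdivrMr ?mul1r ?lerDl //.
  by rewrite addr_gt0.
have zz i x : 0 <= x <= L -> z i x = 0.
  by apply: (prim_dot_eq0 L0 cz) => //; rewrite int0.
have zz1 := ode2_vanish L0 (@K2_continuous R s c qs cq mu0) hz zz.
have h4 : 0 < (1 / 4 : R) by lra.
(* z and its derivative vanish at 0, so the four squares that sum up to the energy 1 of some W n
   would each be less than 1 / 4. *)
have [n hn] := close _ h4; have [_ _ _ e1] := hm n.
have sq i : (W n i 0) ^+ 2 < 1 / 4 /\ (W1 n i 0) ^+ 2 < 1 / 4.
  have [] := hn i 0 h0L; rewrite zz // zz1 !subr0 !ltr_norml => /andP[? ?] /andP[? ?].
  by split; nra.
move: e1; rewrite /energy big_bool /=.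
have [] := sq true; have [] := sq false; rewrite /W /W1; lra.
Qed.

End ComplexSystem.

(** * Periodic solutions of forced systems *)

Section Fredholm.
Variables (R : realType) (I : finType) (K : I -> I -> R -> R) (L : R).
Hypotheses (cK : forall i j, continuous (K i j)) (L0 : 0 < L).
Hypothesis inj : forall w w1, ode2 K (fun _ _ => 0) w w1 ->
  (forall i, w i L = w i 0) -> (forall i, w1 i L = w1 i 0) ->
  forall i, w i 0 = 0 /\ w1 i 0 = 0.
Implicit Types (b w : I -> R -> R).
Local Notation J := (bool * I)%type.

(** The solution of w'' = K w + b with integrable b is sought as w = v + [pr2 b]; then v'' = K v + K
    [pr2 b] has continuous coefficients and forcing. *)
Definition pr1 (b : I -> R -> R) i := prim (b i).
Definition pr2 b i := prim (pr1 b i).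

Definition defect w w1 (e : J) : R :=
  if e.1 then w e.2 L - w e.2 0 else w1 e.2 L - w1 e.2 0.

Lemma data_basis (d : J) : exists z : (I -> R -> R) * (I -> R -> R),
  [/\ ode2 K (fun _ _ => 0) z.1 z.2, forall i, z.1 i 0 = (d == (true, i))%:R &
      forall i, z.2 i 0 = (d == (false, i))%:R].
Proof.
have [||w [w1 [h1 h2 h3]]] := @ode2_exists R I K (fun _ _ => 0)
  (fun i => (d == (true, i))%:R) (fun i => (d == (false, i))%:R).
- exact: cK.
- by move=> i; exact: cont_cst.
by exists (w, w1).
Qed.

Definition zb d := projT1 (cid (data_basis d)).

Lemma zbP d : [/\ ode2 K (fun _ _ => 0) (zb d).1 (zb d).2,
  forall i, (zb d).1 i 0 = (d == (true, i))%:R & forall i, (zb d).2 i 0 = (d == (false, i))%:R].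
Proof. exact: projT2 (cid (data_basis d)). Qed.

Definition comb (p : J -> R) i x := \sum_d p d * (zb d).1 i x.
Definition comb1 (p : J -> R) i x := \sum_d p d * (zb d).2 i x.

Lemma ode2_comb p : ode2 K (fun _ _ => 0) (comb p) (comb1 p).
Proof.
move=> i; split=> x.
  apply: D1_sum => d; have [h _ _] := zbP d; have [h1 _] := h i.
  by D1_solve; ring.
apply: D1_eq.
  apply: D1_sum => d; have [h _ _] := zbP d; have [_ h1] := h i.
  by apply: D1_mul; [exact: D1_cst|exact: h1].
rewrite addr0 /lin /comb; under [RHS]eq_bigr do rewrite mulr_sumr.
rewrite exchange_big /=; apply: eq_bigr => d _; rewrite mul0r add0r addr0 mulr_sumr.
by apply: eq_bigr => j _; ring.
Qed.

Lemma comb_0 p i : comb p i 0 = p (true, i).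
Proof.
rewrite /comb (bigD1 (true, i)) //= big1; last first.
  by move=> d dn; have [_ -> _] := zbP d; rewrite (negbTE dn) mulr0.
by have [_ -> _] := zbP (true, i); rewrite eqxx mulr1 addr0.
Qed.

Lemma comb1_0 p i : comb1 p i 0 = p (false, i).
Proof.
rewrite /comb1 (bigD1 (false, i)) //= big1; last first.
  by move=> d dn; have [_ _ ->] := zbP d; rewrite (negbTE dn) mulr0.
by have [_ _ ->] := zbP (false, i); rewrite eqxx mulr1 addr0.
Qed.

Definition Tmx : 'M[R]_#|{: J}| :=
  \matrix_(i, j) defect (zb (enum_val i)).1 (zb (enum_val i)).2 (enum_val j).

Lemma sum_enum (F : J -> R) : \sum_(i < #|{: J}|) F (enum_val i) = \sum_d F d.
Proof. by rewrite [RHS](reindex (@enum_val _ {: J})) //; apply: onW_bij; exact: enum_val_bij. Qed.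

Lemma defect_comb (v : 'rV[R]_#|{: J}|) e :
  defect (comb (fun d => v ord0 (enum_rank d))) (comb1 (fun d => v ord0 (enum_rank d))) e
  = (v *m Tmx) ord0 (enum_rank e).
Proof.
transitivity (\sum_d v ord0 (enum_rank d) * defect (zb d).1 (zb d).2 e).
  by rewrite /defect /comb /comb1; case: e.1; rewrite -sumrB; apply: eq_bigr => d _; rewrite mulrBr.
by rewrite -sum_enum mxE; apply: eq_bigr => j _; rewrite mxE enum_rankK enum_valK.
Qed.

(** A row vector killed by [Tmx] is the Cauchy data of a periodic solution, hence zero by [inj]. *)
Lemma Tmx_unit : Tmx \in unitmx.
Proof.
rewrite -row_free_unit; apply/inj_row_free => v hv.
pose p d := v ord0 (enum_rank d).
have d0 e : defect (comb p) (comb1 p) e = 0 by rewrite defect_comb hv mxE.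
have h := inj (ode2_comb p).
apply/rowP => k; rewrite mxE -(enum_valK k).
have [i|i|] := h _ _ (enum_val k).2.
- by have /eqP := d0 (true, i); rewrite /defect /= subr_eq0 => /eqP.
- by have /eqP := d0 (false, i); rewrite /defect /= subr_eq0 => /eqP.
rewrite comb_0 comb1_0 /p; case E: (enum_val k) => [[] i] /=; first by move=> -> _.
by move=> _ ->.
Qed.

Lemma forced b : (forall i, lint (b i)) -> exists y : (I -> R -> R) * (I -> R -> R),
  [/\ ode2 K (lin K (pr2 b)) y.1 y.2, forall i, y.1 i 0 = 0 & forall i, y.2 i 0 = 0].
Proof.
move=> lb; have c1 i : continuous (pr1 b i) := prim_continuous (lb i).
have c2 i : continuous (pr2 b i) := der_continuous (prim_der (c1 i)).
have [||w [w1 [h1 h2 h3]]] := @ode2_exists R I K (lin K (pr2 b)) (fun=> 0) (fun=> 0).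
- exact: cK.
- by move=> i; exact: (@lin_continuous R I K _ i cK c2).
by exists (w, w1).
Qed.

(** Periodicity of v + [pr2 b] and of its derivative; both primitives vanish at 0. *)
Definition periodic_forced b (v v1 : I -> R -> R) :=
  (forall i, v i L + pr2 b i L = v i 0) /\ (forall i, v1 i L + pr1 b i L = v1 i 0).

Lemma fredholm_exists b : (forall i, lint (b i)) ->
  exists v v1, ode2 K (lin K (pr2 b)) v v1 /\ periodic_forced b v v1.
Proof.
move=> lb; have [[y y1] /= [hy y0 y10]] := forced lb.
pose dv : 'rV[R]_#|{: J}| := \row_k defect (fun i x => y i x + pr2 b i x) (fun i x => y1 i x + pr1 b i x) (enum_val k).
(* The homogeneous solution has to cancel the defect of the particular solution with zero data. *)
pose v := - dv *m invmx Tmx; pose p d := v ord0 (enum_rank d).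
exists (fun i x => 1 * y i x + 1 * comb p i x), (fun i x => 1 * y1 i x + 1 * comb1 p i x); split.
  have := ode2_lin 1 1 hy (ode2_comb p).
  by rewrite (_ : (fun i x => _) = lin K (pr2 b)) //; apply/funext => i; apply/funext => x; ring.
have E e : defect (comb p) (comb1 p) e = - defect (fun i x => y i x + pr2 b i x) (fun i x => y1 i x + pr1 b i x) e.
  by rewrite defect_comb /v mulmxKV ?Tmx_unit // !mxE enum_rankK.
split=> i.
  by have := E (true, i); rewrite /defect /= y0 /pr2 prim0; lra.
by have := E (false, i); rewrite /defect /= y10 /pr1 prim0; lra.
Qed.

(** The extra forcing e, zero on [0, L], admits functions v that satisfy the intended equation only
    there. *)
Lemma fredholm_bound : exists2 C : R, 0 <= C & forall b (e v v1 : I -> R -> R), (forall i, lint (b i)) ->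
  (forall i x, 0 <= x <= L -> e i x = 0) ->
  ode2 K (fun i x => lin K (pr2 b) i x + e i x) v v1 -> periodic_forced b v v1 ->
  forall i x, 0 <= x <= L -> `|v i x + pr2 b i x| <= C * \sum_j prim (fun t => `|b j t|) L.
Proof.
have [M M1 hM] := @bound_family R (I * I)%type (fun p => K p.1 p.2) 0 L (fun p => @cK p.1 p.2).
have M0 : 0 <= M by lra.
have hL := L0.
have cz d i : continuous ((zb d).1 i) by have [h _ _] := zbP d; exact: der_continuous (h i).1.
have [Z Z1 hZ] := @bound_family R (J * I)%type (fun q => (zb q.1).1 q.2) 0 L (fun q => @cz q.1 q.2).
pose Q := \sum_(i < #|{: J}|) \sum_j `|invmx Tmx i j|.
have Q0 : 0 <= Q by apply: sumr_ge0 => i _; apply: sumr_ge0.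
pose cy := Num.sqrt (expR (erate I M * L) * (#|I|%:R * (#|I|%:R * (M * L)) ^+ 2)).
have cy0 : 0 <= cy := sqrtr_ge0 _.
pose N := #|{: J}|%:R : R; have N0 : 0 <= N := ler0n _ _.
(* [cy] bounds the forced solution with zero data and L the second primitive. The last term bounds
   the homogeneous part: its data come from a defect of size cy + L + 1 through the inverse of
   [Tmx], with entries bounded by Q, and Z bounds the basis. *)
pose C := cy + L + N * (Q * (cy + L + 1) * N) * Z; exists C.
  have h1 : 0 <= Q * (cy + L + 1) by rewrite mulr_ge0 //; lra.
  have : 0 <= N * (Q * (cy + L + 1) * N) * Z by rewrite !mulr_ge0 //; lra.
  by rewrite /C; lra.
move=> b e v v1 lb ez hv [pv pv1] i x hx.
set B := \sum_j _.
have B0 : 0 <= B.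
  apply: sumr_ge0 => j _; rewrite -[leLHS](prim0 (fun t => `|b j t|)).
  rewrite -subr_ge0 primB //; [exact: Rintegral_ge0|exact: lint_norm|exact: ltW].
have mono j t : 0 <= t <= L -> prim (fun t => `|b j t|) t <= B.
  move=> /andP[t0 tL]; have lbn := lint_norm (lb j).
  apply: le_trans (_ : prim (fun t => `|b j t|) L <= _).
    by rewrite -subr_ge0 primB //; exact: Rintegral_ge0.
  rewrite /B (bigD1 j) //= lerDl sumr_ge0 // => k _.
  rewrite -[leLHS](prim0 (fun t => `|b k t|)) -subr_ge0 primB; first exact: Rintegral_ge0.
  - exact: lint_norm.
  - exact: ltW.
have g1 j t : 0 <= t <= L -> `|pr1 b j t| <= B.
  move=> ht; have /andP[t0 _] := ht; apply: le_trans (mono j t ht).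
  have := prim_norm_le (lb j) t0; by rewrite !prim0 !subr0.
have c1 j : continuous (pr1 b j) := prim_continuous (lb j).
have g2 j t : 0 <= t <= L -> `|pr2 b j t| <= L * B.
  move=> /andP[t0 tL]; have [c /andP[c0 ct]] := MVT_le t0 (fun x _ => prim_der (c1 j) x).
  rewrite prim0 !subr0 /pr2 => ->; rewrite normrM mulrC; apply: ler_pM => //.
    by rewrite ger0_norm.
  by apply: g1; rewrite c0 (le_trans ct).
have [[y y1] /= [hy y0 y10]] := forced lb.
have by1 j t : 0 <= t <= L -> `|y j t| <= cy * B /\ `|y1 j t| <= cy * B.
  move=> ht; have hf k u : 0 <= u <= L -> `|lin K (pr2 b) k u| <= #|I|%:R * (M * (L * B)).
    move=> hu; apply: lin_le => //; first by move=> k' j'; exact: (hM (k', j')).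
    by move=> j'; exact: g2.
  have := energy_bound hy M0 (fun i j => hM (i, j)) hf ht.
  have -> : energy y y1 0 = 0 by rewrite /energy big1 // => k _; rewrite y0 y10 expr0n addr0.
  rewrite add0r subr0 => le.
  have {}le : energy y y1 t <= (cy * B) ^+ 2.
    apply: le_trans le _; rewrite [(cy * B) ^+ 2]exprMn /cy sqr_sqrtr; last by rewrite mulr_ge0 ?expR_ge0 // mulr_ge0 // ?ler0n // sqr_ge0.
    apply: le_trans (_ : expR (erate I M * L) * (#|I|%:R * (#|I|%:R * (M * (L * B))) ^+ 2) <= _).
      apply: ler_wpM2r; first by rewrite mulr_ge0 ?ler0n ?sqr_ge0.
      rewrite ler_expR; apply: ler_wpM2l; last by case/andP: ht.
      by rewrite addr_ge0 // mulr_ge0 ?ler0n.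
    by rewrite le_eqVlt; apply/orP; left; apply/eqP; ring.
  have [l1 l2] := energy_ge y y1 t j.
  have cB : 0 <= cy * B by rewrite mulr_ge0.
  split; rewrite -(@ler_pXn2r _ 2) ?nnegrE // real_normK ?num_real //.
    exact: le_trans l1 le.
  exact: le_trans l2 le.
pose p (d : J) := if d.1 then v d.2 0 else v1 d.2 0.
have E := ode2_unique cK hv (ode2_lin 1 1 hy (ode2_comb p)).
have {}E j t : 0 <= t <= L -> v j t = 1 * y j t + 1 * comb p j t /\ v1 j t = 1 * y1 j t + 1 * comb1 p j t.
  apply: E.
  - by move=> k u hu; rewrite ez //; ring.
  - by move=> k; rewrite y0 comb_0 /p /=; ring.
  - by move=> k; rewrite y10 comb1_0 /p /=; ring.
have hLL : 0 <= L <= L by rewrite lexx ltW.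
pose pv' : 'rV[R]_#|{: J}| := \row_k p (enum_val k).
have pE : p = fun d => pv' ord0 (enum_rank d) by apply/funext => d; rewrite mxE enum_rankK.
have dE k : `|(pv' *m Tmx) ord0 k| <= (cy + L + 1) * B.
  rewrite -(enum_valK k) -defect_comb -pE /defect.
  case Ek : (enum_val k) => [[] j] /=.
    have [e1 _] := E j L hLL; have := pv j; have := (by1 j L hLL).1; have := g2 j L hLL.
    rewrite comb_0 /p /= e1 !ler_norml => /andP[? ?] /andP[? ?] ?; apply/andP; split; lra.
  have [_ e1] := E j L hLL; have := pv1 j; have := (by1 j L hLL).2; have := g1 j L hLL.
  have LB : 0 <= L * B by rewrite mulr_ge0 // ltW.
  rewrite comb1_0 /p /= e1 !ler_norml => /andP[? ?] /andP[? ?] ?; apply/andP; split; lra.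
have cB : 0 <= (cy + L + 1) * B by rewrite mulr_ge0 //; lra.
have pB d : `|p d| <= Q * ((cy + L + 1) * B) * N.
  rewrite pE /= -[pv'](mulmxK Tmx_unit) mxE.
  apply: le_trans (ler_norm_sum _ _ _) _.
  apply: le_trans (_ : \sum_(j < #|{: J}|) Q * ((cy + L + 1) * B) <= _).
    apply: ler_sum => j _; rewrite normrM mulrC; apply: ler_pM => //.
    rewrite /Q (bigD1 j) //= (bigD1 (enum_rank d)) //= -addrA lerDl.
    by rewrite addr_ge0 // sumr_ge0 // => *; exact: sumr_ge0.
  by rewrite sumr_const card_ord -[leLHS]mulr_natr.
have [e1 _] := E i x hx; rewrite e1 !mul1r.
have h3 : `|comb p i x| <= N * (Q * ((cy + L + 1) * B) * N * Z).
  apply: le_trans (ler_norm_sum _ _ _) _.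
  apply: le_trans (_ : \sum_(j : J) Q * ((cy + L + 1) * B) * N * Z <= _).
    by apply: ler_sum => j _; rewrite normrM; apply: ler_pM => //; exact: (hZ (j, i)).
  by rewrite sumr_const -[leLHS]mulr_natl.
have := (by1 i x hx).1; have := g2 i x hx; move: h3.
rewrite /C !ler_norml => /andP[? ?] /andP[? ?] /andP[? ?]; apply/andP; split; lra.
Qed.

End Fredholm.

(** * Square-integrable functions *)

Section SquareIntegrable.
Variables (R : realType) (L : R).
Hypothesis L0 : 0 < L.
Implicit Types (f g h : R -> R).
Local Notation mu := (@lebesgue_measure R).
Local Notation igb := (@igb R L).
Local Notation aeL := (@aeL R L).

Definition l2 f := measurable_fun setT f /\ igb (fun x => f x ^+ 2).

Lemma igb_le f g : measurable_fun setT f -> igb g ->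
  (forall x, 0 <= x <= L -> `|f x| <= g x) -> igb f.
Proof.
move=> mf ig h; apply: (@le_integrable _ _ _ mu _ _ _ (EFin \o g)) => //.
  by apply/measurable_EFinP; exact: measurable_funTS.
move=> x /inL hx /=; rewrite lee_fin; apply: le_trans (h x hx) _; exact: ler_norm.
Qed.

Lemma l2_igb f : l2 f -> igb f.
Proof.
move=> [mf f2]; apply: (igb_le (g := fun x => 1 + f x ^+ 2)) => //.
  by apply: igbD => //; apply: igb_cont; exact: cont_cst.
move=> x _; rewrite -(real_normK (num_real (f x))); have := sqr_ge0 (`|f x| - 1 / 2); lra.
Qed.

Lemma l2_le f g : measurable_fun setT f -> l2 g -> (forall x, 0 <= x <= L -> `|f x| <= `|g x|) -> l2 f.
Proof.
move=> mf [mg g2] h; split => //; apply: (igb_le (g := fun x => g x ^+ 2)) => //.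
  exact: measurable_funX.
move=> x hx; rewrite ger0_norm ?sqr_ge0 // -(real_normK (num_real (f x))) -(real_normK (num_real (g x))).
by rewrite ler_pXn2r ?nnegrE // h.
Qed.

Lemma l2_cont f : continuous f -> l2 f.
Proof.
move=> cf; split; first exact: continuous_measurable_fun.
by apply: igb_cont; exact: cont_exp.
Qed.

Lemma l2D f g : l2 f -> l2 g -> l2 (fun x => f x + g x).
Proof.
move=> [mf f2] [mg g2]; split; first exact: measurable_funD.
apply: (igb_le (g := fun x => 2 * f x ^+ 2 + 2 * g x ^+ 2)).
- by apply: measurable_funX; exact: measurable_funD.
- by apply: igbD; exact: igbZ.
by move=> x _; rewrite ger0_norm ?sqr_ge0 //; have := sqr_ge0 (f x - g x); lra.
Qed.

Lemma l2M h f : continuous h -> l2 f -> l2 (fun x => h x * f x).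
Proof.
move=> ch [mf f2]; split.
  by apply: measurable_funM => //; exact: continuous_measurable_fun.
rewrite (_ : (fun x => _) = (fun x => f x ^+ 2 * h x ^+ 2)).
  by apply: igbM => //; exact: cont_exp.
by apply/funext => x; rewrite exprMn mulrC.
Qed.

Lemma l2Z (c : R) f : l2 f -> l2 (fun x => c * f x).
Proof. by apply: l2M; exact: cont_cst. Qed.

Lemma l2_res f : l2 f -> l2 (res L f).
Proof.
move=> [mf f2]; apply: (l2_le (g := f)) => //.
  rewrite resE; apply/(measurable_restrictT _ _).1 => //; exact: measurable_funTS.
by move=> x hx; rewrite res_in.
Qed.

(** Elements of [L2per] are periodic at every point, so functions constructed on [0, L[ are extended
    by composition with this reduction modulo L. *)
Definition perx (x : R) : R := x - L * (Num.floor (x / L))%:~R.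

Lemma perx_periodic x : perx (x + L) = perx x.
Proof.
have n0 : L != 0 by rewrite gt_eqF.
rewrite /perx mulrDl divff //.
have -> : Num.floor (x / L + 1) = Num.floor (x / L) + 1.
  apply: floor_def; have /andP[h1 h2] := floor_itv (x / L).
  by rewrite !intrD in h2 *; apply/andP; split; lra.
by rewrite intrD; ring.
Qed.

Lemma perx_in x : 0 <= x < L -> perx x = x.
Proof.
move=> /andP[x0 xL]; rewrite /perx (_ : Num.floor (x / L) = 0) ?mulr0 ?subr0 //.
apply: floor_def; rewrite add0r; apply/andP; split; first by rewrite divr_ge0 // ltW.
by rewrite ltr_pdivrMr // mul1r.
Qed.

Lemma perx_L : perx L = 0.
Proof. by rewrite -[L in perx L]add0r perx_periodic perx_in // lexx. Qed.

Lemma perx_itv x : 0 <= perx x < L.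
Proof.
have /andP[h1 h2] := floor_itv (x / L).
move: h1 h2; rewrite ler_pdivlMr // ltr_pdivrMr // intrD /perx => h1 h2.
by apply/andP; split; lra.
Qed.

Lemma perx_measurable : measurable_fun setT perx.
Proof.
apply: measurable_funB; first exact: measurable_id.
apply: nondecreasing_measurable => // x y xy.
by rewrite ler_pM2l // ler_int le_floor // ler_pM2r // invr_gt0.
Qed.

Lemma periodic_perx (T : Type) (f : R -> T) x : Defs.periodic L f -> f (perx x) = f x.
Proof.
move=> pf; have pn (n : nat) y : f (y + n%:R * L) = f y.
  elim: n => [|n IH]; first by rewrite mul0r addr0.
  by rewrite -natr1 mulrDl mul1r addrA pf.
rewrite /perx; case: (Num.floor _) => n.
  by rewrite -(pn n) mulrC -addrA addNr addr0.
by rewrite NegzE mulrNz mulrN opprK mulrC pn.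
Qed.

Lemma periodic_eq (T : Type) (f g : R -> T) : Defs.periodic L f -> Defs.periodic L g ->
  (forall x, 0 <= x <= L -> f x = g x) -> f = g.
Proof.
move=> pf pg h; apply/funext => x; rewrite -(periodic_perx x pf) -(periodic_perx x pg).
by apply: h; have /andP[h1 h2] := perx_itv x; rewrite h1 ltW.
Qed.

Lemma l2_per f : l2 f -> l2 (fun x => f (perx x)).
Proof.
move=> [mf f2]; have mp : measurable_fun setT (fun x => f (perx x)).
  exact: measurableT_comp mf perx_measurable.
(* At the end point L the reduction yields f 0 instead of f L, hence the second summand. *)
split=> //; apply: (igb_le (g := fun x => f x ^+ 2 + f 0 ^+ 2)).
- exact: measurable_funX.
- by apply: igbD => //; apply: igb_cont; exact: cont_cst.
move=> x /andP[x0 xL]; rewrite ger0_norm ?sqr_ge0 //.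
move: xL; rewrite le_eqVlt => /orP[/eqP ->|xL]; first by rewrite perx_L lerDr sqr_ge0.
by rewrite perx_in ?x0 // lerDl sqr_ge0.
Qed.

Lemma per_ae f : aeL (fun x => f (perx x) = f x).
Proof. by apply: (@aeL_off R L 0) => x /andP[x0 xL] _; rewrite perx_in // xL ltW. Qed.

Lemma prim_ae f g x : lint f -> lint g -> aeL (fun x => f x = g x) -> 0 <= x <= L ->
  prim f x = prim g x.
Proof.
move=> lf lg h /andP[x0 xL]; rewrite /prim x0; congr fine; apply: ae_eq_integral => //.
- exact: measurable_int (lf 0 x).
- exact: measurable_int (lg 0 x).
rewrite /ae_eq; apply: (@filterS _ _ (@aeF R)) h => t h1 ht /=; rewrite h1 //.
by apply/inL; move: ht; rewrite /= in_itv /= => /andP[-> tx]; rewrite (le_trans tx xL).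
Qed.

Lemma prim_res f x : lint f -> 0 <= x <= L -> prim (res L f) x = prim f x.
Proof.
move=> lf hx; apply: prim_ae => //; first by apply: res_lint; exact: lf.
by apply: aeL_all => t ht; rewrite res_in.
Qed.

Lemma continuous_ae0 f : continuous f -> aeL (fun x => f x = 0) -> forall x, 0 <= x <= L -> f x = 0.
Proof.
move=> cf h.
have cf2 : continuous (fun x => f x ^+ 2) by apply: cont_exp.
have i0 : prim (fun x => f x ^+ 2) L = prim (fun=> 0) L.
  apply: prim_ae; [exact: continuous_lint|by apply: continuous_lint; exact: cont_cst| |by rewrite lexx ltW].
  by apply: aeL_imp h => x _ ->; rewrite expr0n.
have le : prim (fun x => f x ^+ 2) L <= prim (fun x => f x ^+ 2) 0 by rewrite i0 prim_zero prim0.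
move=> x hx; apply/eqP; rewrite -sqrf_eq0; apply/eqP.
exact: (der_ge0_eq0 L0 (prim_der cf2) cf2 (fun t _ => sqr_ge0 _) le hx).
Qed.

Lemma cauchy_schwarz_1 f : l2 f ->
  (\int[mu]_(x in `[0, L]) `|f x|) ^+ 2 <= L * \int[mu]_(x in `[0, L]) (f x ^+ 2).
Proof.
move=> hf; have hf1 := igb_norm (l2_igb hf); have [mf f2] := hf.
set I := \int[mu]_(x in `[0, L]) `|f x|; set N := \int[mu]_(x in _) _.
(* With t the mean of |f|, the integral of (|f| - t) ^ 2 is the defect in the inequality divided by
   L. *)
pose t := I / L.
have : 0 <= \int[mu]_(x in `[0, L]) ((`|f x| - t) ^+ 2).
  by apply: Rintegral_ge0 => x _; exact: sqr_ge0.
have ic : igb (fun=> t ^+ 2) by apply: igb_cont; exact: cont_cst.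
have -> : \int[mu]_(x in `[0, L]) ((`|f x| - t) ^+ 2) = N - (2 * t) * I + t ^+ 2 * L.
  rewrite -(Rint_cst L0) -RintegralZl // -RintegralB //; last exact: igbZ.
  rewrite -RintegralD //; last by apply: igbB => //; exact: igbZ.
  apply: eq_Rintegral => x _; rewrite -[f x ^+ 2](real_normK (num_real _)); ring.
have -> : N - 2 * t * I + t ^+ 2 * L = (L * N - I ^+ 2) / L by rewrite /t; field; rewrite gt_eqF.
by rewrite pmulr_lge0 ?invr_gt0 // subr_ge0.
Qed.

End SquareIntegrable.

(** * Complex-valued periodic functions *)

Section ComplexParts.
Variable R : realType.
Implicit Types (z : R[i]) (p : bool).

Definition cpart p z : R := if p then complex.Re z else complex.Im z.

Lemma cpartD p z z' : cpart p (z + z') = cpart p z + cpart p z'.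
Proof. by case: p; case: z; case: z'. Qed.

Lemma cpartN p z : cpart p (- z) = - cpart p z.
Proof. by case: p; case: z. Qed.

Lemma cpartB p z z' : cpart p (z - z') = cpart p z - cpart p z'.
Proof. by rewrite cpartD cpartN. Qed.

Lemma cpartM p (m n : R) z : cpart p ((m +i* n) * z) = m * cpart p z - (if p then n else - n) * cpart (~~ p) z.
Proof. by case: p; case: z => a b; rewrite /cpart /=; ring. Qed.

Lemma cpartMl p (m : R) z : cpart p (m%:C * z) = m * cpart p z.
Proof. by rewrite cpartM; case: p; ring. Qed.

Lemma cpartMr p (m : R) z : cpart p (z * m%:C) = cpart p z * m.
Proof. by rewrite mulrC cpartMl mulrC. Qed.

Lemma cpart_eq z z' : (forall p, cpart p z = cpart p z') -> z = z'.
Proof. by move=> h; case: z z' h => a b [a' b'] h; have /= -> := h true; have /= -> := h false. Qed.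

Lemma cpart0 p : cpart p 0 = 0.
Proof. by case: p. Qed.

End ComplexParts.

Section ComplexWeak.
Variables (R : realType) (L : R).
Hypothesis L0 : 0 < L.
Implicit Types (f g h : R -> R[i]).
Local Notation mu := (@lebesgue_measure R).
Local Notation igb := (@igb R L).
Local Notation aeL := (@aeL R L).

Lemma L2perP f : L2per L f <-> Defs.periodic L f /\ forall p, l2 L (fun x => cpart p (f x)).
Proof.
have sq x : sqmod (f x) = cpart true (f x) ^+ 2 + cpart false (f x) ^+ 2 by [].
split=> [[pf m1 m2 i]|[pf hl]].
  have ig : igb (fun x => sqmod (f x)) by exact: i.
  split=> // -[]; split=> //; apply: (igb_le _ ig); try exact: measurable_funX.
    by move=> x _; rewrite ger0_norm ?sqr_ge0 // sq lerDl sqr_ge0.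
  by move=> x _; rewrite ger0_norm ?sqr_ge0 // sq lerDr sqr_ge0.
have [m1 i1] := hl true; have [m2 i2] := hl false; split => //.
exact: igbD i1 i2.
Qed.

Lemma cintP f (a : bool -> R) : (forall p, \int[mu]_(x in `[0, L]) cpart p (f x) = a p) ->
  cint L f = a true +i* a false.
Proof. by move=> h; rewrite /cint -(h true) -(h false). Qed.

Lemma is_wderivP f g : is_wderiv L f g <-> L2per L g /\ forall p psi, test_fun L psi ->
  \int[mu]_(x in `[0, L]) (cpart p (f x) * derive1 psi x) = - \int[mu]_(x in `[0, L]) (cpart p (g x) * psi x).
Proof.
have E h psi : cint L (fun x => h x * (psi x)%:C) =
    (\int[mu]_(x in `[0, L]) (cpart true (h x) * psi x)) +i* (\int[mu]_(x in `[0, L]) (cpart false (h x) * psi x)).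
  apply: (cintP (a := fun p => \int[mu]_(x in `[0, L]) (cpart p (h x) * psi x))) => p.
  by apply: eq_Rintegral => x _; rewrite cpartMr.
split=> [[lg h]|[lg h]]; split => //.
  by move=> p psi tp; have := h psi tp; rewrite !E => -[h1 h2]; case: p.
by move=> psi tp; rewrite !E (h true psi tp) (h false psi tp).
Qed.

Lemma wderiv_rep f g : L2per L f -> is_wderiv L f g <-> L2per L g /\ forall p,
  prim (res L (fun x => cpart p (g x))) L = 0 /\
  exists q : R, aeL (fun x => cpart p (f x) = q + prim (res L (fun x => cpart p (g x))) x).
Proof.
move=> /L2perP[pf lf]; split.
  move=> /is_wderivP[hg h]; split=> // p; have /L2perP[_ lg] := hg.
  by apply: (weak_rep L0) (h p); exact: l2_igb.
move=> [hg h]; apply/is_wderivP; split => // p psi tp; have /L2perP[_ lg] := hg.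
have [g0 [q hq]] := h p.
by apply: (weak_of_rep L0 _ _ g0 hq tp); exact: l2_igb.
Qed.

Lemma wderiv_unique f g g' : is_wderiv L f g -> is_wderiv L f g' ->
  forall p, aeL (fun x => cpart p (g x) = cpart p (g' x)).
Proof.
move=> /is_wderivP[/L2perP[_ lg] hg] /is_wderivP[/L2perP[_ lg'] hg'] p.
have ig := l2_igb (lg p); have ig' := l2_igb (lg' p).
apply: (aeL_imp (P := fun x => cpart p (g x) - cpart p (g' x) = 0)).
  by move=> x _ /eqP; rewrite subr_eq0 => /eqP.
apply: (dubois_reymond L0); first exact: igbB.
move=> psi tp; have /test_funP[_ sp] := tp; have cp := smooth_continuous sp.
transitivity (\int[mu]_(x in `[0, L]) (cpart p (g x) * psi x) - \int[mu]_(x in `[0, L]) (cpart p (g' x) * psi x)).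
  rewrite -RintegralB //; [|exact: igbM|exact: igbM].
  by apply: eq_Rintegral => x _; rewrite mulrBl.
have := hg p psi tp; rewrite (hg' p psi tp) => /eqP; rewrite eqr_opp => /eqP ->.
by rewrite subrr.
Qed.

Lemma wderiv_congr f f' g : L2per L f -> L2per L f' ->
  (forall p, aeL (fun x => cpart p (f x) = cpart p (f' x))) -> is_wderiv L f g -> is_wderiv L f' g.
Proof.
move=> lf lf' h /(wderiv_rep _ lf)[lg hg]; apply/(wderiv_rep _ lf'); split => // p.
have [g0 [q hq]] := hg p; split => //; exists q.
by apply: aeL_imp (aeL_and (h p) hq) => x _ [<-].
Qed.

Lemma wderivP f g : is_wderiv L f g -> is_wderiv L f (wderiv L f).
Proof. by move=> h; apply: (xgetPex (cst 0)); exists g. Qed.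

(** [wderiv] chooses an arbitrary representative, so its second application acts on a function equal
    to g only almost everywhere; [wderiv_congr] transports h to it. *)
Lemma wderiv2_spec f g h : is_wderiv L f g -> is_wderiv L g h ->
  [/\ is_wderiv L f (wderiv L f), is_wderiv L (wderiv L f) (wderiv L (wderiv L f)) &
      forall p, aeL (fun x => cpart p (wderiv L (wderiv L f) x) = cpart p (h x))].
Proof.
move=> hg hh; have h1 := wderivP hg; have lg := hg.1; have lg1 := h1.1.
have h2 := wderiv_congr lg lg1 (wderiv_unique hg h1) hh.
have h3 := wderivP h2; split => //; exact: wderiv_unique h3 h2.
Qed.

Lemma H2perP f : H2per L f -> [/\ L2per L f, is_wderiv L f (wderiv L f) &
  is_wderiv L (wderiv L f) (wderiv L (wderiv L f))].
Proof. by move=> [lf [g [h [hg hh]]]]; have [] := wderiv2_spec hg hh. Qed.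

Local Notation J := (bool * bool)%type.

Definition ext (a : J -> R -> R) (i : bool) (x : R) : R[i] :=
  a (true, i) (perx L x) +i* a (false, i) (perx L x).

Lemma cpart_ext a i p x : cpart p (ext a i x) = a (p, i) (perx L x).
Proof. by case: p. Qed.

Lemma cpart_ext_ae a i p : aeL (fun x => cpart p (ext a i x) = a (p, i) x).
Proof.
by apply: aeL_imp (per_ae L0 (a (p, i))) => x _; rewrite cpart_ext.
Qed.

Lemma L2per_ext a i : (forall j, l2 L (a j)) -> L2per L (ext a i).
Proof.
move=> h; apply/L2perP; split; first by move=> x; rewrite /ext perx_periodic.
move=> p; rewrite (_ : (fun x => _) = fun x => a (p, i) (perx L x)); first exact: l2_per.
by apply/funext => x; rewrite cpart_ext.
Qed.

Lemma wderiv_ext a a1 i : (forall j, l2 L (a j)) -> (forall j, l2 L (a1 j)) ->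
  (forall j, prim (res L (a1 j)) L = 0) ->
  (forall j x, 0 <= x <= L -> a j x = a j 0 + prim (res L (a1 j)) x) ->
  is_wderiv L (ext a i) (ext a1 i).
Proof.
move=> la la1 a10 h; apply/wderiv_rep; first exact: L2per_ext.
split; first exact: L2per_ext.
move=> p; have /L2perP[_ l1] := L2per_ext i la1.
have E x : 0 <= x <= L -> prim (res L (fun x => cpart p (ext a1 i x))) x = prim (res L (a1 (p, i))) x.
  apply: prim_ae => //; [exact: res_lint (l2_igb (l1 p))|exact: res_lint (l2_igb (la1 _))|].
  by apply: aeL_imp (cpart_ext_ae a1 i p) => t ht; rewrite !res_in.
split; first by rewrite E ?a10 // lexx ltW.
exists (a (p, i) 0); apply: aeL_imp (cpart_ext_ae a i p) => x hx ->.
by rewrite E // -h.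
Qed.

End ComplexWeak.

(** * Weak and classical solutions *)

Section Operator.
Variables (R : realType) (s c L : R) (qs phi : R -> R).
Hypotheses (s0 : 0 < s) (sE : s = 5 - 4 * c ^+ 2) (L0 : 0 < L) (cq : continuous qs).
Hypothesis phiE : forall x, 1 - 3 * phi x ^+ 2 - 5 * phi x ^+ 4 = s * qs x + c ^+ 2.
Local Notation mu := (@lebesgue_measure R).
Local Notation J := (bool * bool)%type.
Local Notation igb := (@igb R L).
Local Notation aeL := (@aeL R L).
Local Notation K4 := (@K4 R s c qs).
Local Notation Minv := (@Minv R s c).
Local Notation D := (opD L phi c).
Implicit Types (U : vfun R) (F : J -> R -> R).

Definition comp U (j : J) (x : R) : R := cpart j.1 ((if j.2 then U.1 else U.2) x).
Definition comp2 U (j : J) (x : R) : R := cpart j.1 (wderiv L (wderiv L (if j.2 then U.1 else U.2)) x).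
(** Minus the inverse of M applied to F, because (D - lam) U = F reads M U'' = (N - lam) U - F, with
    N taken at eigenvalue zero. *)
Definition force F (j : J) (x : R) : R :=
  - (Minv j.2 true * F (j.1, true) x + Minv j.2 false * F (j.1, false) x).

Lemma comp_shifted m n U p x :
  comp (shifted D (m +i* n) U) (p, true) x =
    - 5 * comp2 U (p, true) x + (s * qs x + c ^+ 2) * comp U (p, true) x
    + (- 4 * c * comp2 U (p, false) x + c * comp U (p, false) x)
    - (m * comp U (p, true) x - (if p then n else - n) * comp U (~~ p, true) x) /\
  comp (shifted D (m +i* n) U) (p, false) x =
    (- 4 * c * comp2 U (p, true) x + c * comp U (p, true) x)
    + (- 4 * comp2 U (p, false) x + comp U (p, false) x)
    - (m * comp U (p, false) x - (if p then n else - n) * comp U (~~ p, false) x).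
Proof.
have nE (k : nat) : - k%:R = (- k%:R : R)%:C :> R[i] by rewrite rmorphN rmorph_nat.
rewrite /comp /comp2 /= !nE !(cpartB, cpartD, cpartMl, cpartM) phiE; split; reflexivity.
Qed.

Lemma shifted_force m n U j x : comp2 U j x =
  lin (K4 m n) (comp U) j x + force (comp (shifted D (m +i* n) U)) j x.
Proof.
have s1 : s != 0 by rewrite gt_eqF.
have e5 : 5 = s + 4 * c ^+ 2 by have := sE; lra.
case: j => p i; rewrite lin4 /force /=.
have [-> ->] := comp_shifted m n U p x.
rewrite /K2 /Minv /Nmat; case: i => /=; rewrite ?e5;
move: (comp2 U (p, true) x) (comp2 U (p, false) x) (comp U (p, true) x) (comp U (p, false) x) => a1 a2 a3 a4;
move: (comp U (~~ p, true) x) (comp U (~~ p, false) x) (qs x) (if p then n else - n) => a5 a6 a7 a8; by field.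
Qed.

Lemma force_inj m n U F x :
  (forall j, comp2 U j x = lin (K4 m n) (comp U) j x + force F j x) ->
  forall j, comp (shifted D (m +i* n) U) j x = F j x.
Proof.
move=> h [p i]; have s1 : s != 0 by rewrite gt_eqF.
have e5 : 5 = s + 4 * c ^+ 2 by have := sE; lra.
have E i' : force (comp (shifted D (m +i* n) U)) (p, i') x = force F (p, i') x.
  by have := h (p, i'); rewrite (shifted_force m n) => /addrI.
(* Applying - M recovers G from [force G]. *)
have inv G : G (p, true) x = - (5 * force G (p, true) x + 4 * c * force G (p, false) x) /\
             G (p, false) x = - (4 * c * force G (p, true) x + 4 * force G (p, false) x).
  by rewrite /force /Minv /= e5; split; field.
have [h1 h2] := inv (comp (shifted D (m +i* n) U)); have [h3 h4] := inv F.
by case: i; [rewrite h1 h3 !E|rewrite h2 h4 !E].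
Qed.

Lemma aeL_forall (P : J -> R -> Prop) : (forall j, aeL (P j)) -> aeL (fun x => forall j, P j x).
Proof.
move=> h; have h1 := aeL_and (h (true, true)) (h (true, false)).
have h2 := aeL_and (h (false, true)) (h (false, false)).
by apply: aeL_imp (aeL_and h1 h2) => x _ [[a1 a2] [a3 a4]] [[] []].
Qed.

Lemma prim_lintD (f g : R -> R) x : lint f -> lint g -> 0 <= x ->
  prim (fun t => f t + g t) x = prim f x + prim g x.
Proof. by move=> lf lg x0; rewrite /prim x0 RintegralD. Qed.

Lemma eq_lin m n (f g : J -> R -> R) j x : (forall i, f i x = g i x) ->
  lin (K4 m n) f j x = lin (K4 m n) g j x.
Proof. by move=> h; apply: eq_bigr => i _; rewrite h. Qed.

Lemma igb_force F j : (forall i, igb (F i)) -> igb (force F j).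
Proof.
move=> iF; rewrite (_ : force F j = fun x =>
  (- Minv j.2 true) * F (j.1, true) x + (- Minv j.2 false) * F (j.1, false) x).
  by apply: igbD; exact: igbZ.
by apply/funext => x; rewrite /force; ring.
Qed.

Lemma l2_force F j : (forall i, l2 L (F i)) -> l2 L (force F j).
Proof.
move=> iF; rewrite (_ : force F j = fun x =>
  (- Minv j.2 true) * F (j.1, true) x + (- Minv j.2 false) * F (j.1, false) x).
  by apply: l2D; exact: l2Z.
by apply/funext => x; rewrite /force; ring.
Qed.

Definition rforce F j := res L (force F j).

Lemma pr1_continuous (b : J -> R -> R) j : (forall j, lint (b j)) -> continuous (pr1 b j).
Proof. by move=> lb; exact: prim_continuous. Qed.

Lemma pr2_der (b : J -> R -> R) j : (forall j, lint (b j)) -> der (pr2 b j) (pr1 b j).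
Proof. by move=> lb; apply: prim_der; exact: (@pr1_continuous b). Qed.

(** The second primitive absorbs the merely integrable part of U'', and what remains is twice
    differentiable. The equation for it is known only on [0, L], while [ode2] speaks of the whole
    line; e is the discrepancy outside. *)
Lemma weak_classical m n U F : HH2per L U -> (forall j, igb (F j)) ->
  (forall j, aeL (fun x => comp (shifted D (m +i* n) U) j x = F j x)) ->
  exists e v v1, [/\ forall j x, 0 <= x <= L -> e j x = 0,
    ode2 (K4 m n) (fun j x => lin (K4 m n) (pr2 (rforce F)) j x + e j x) v v1,
    periodic_forced L (rforce F) v v1 &
    forall j, aeL (fun x => comp U j x = v j x + pr2 (rforce F) j x)].
Proof.
move=> [hU1 hU2] iF hF; set b := rforce F.
have lb j : lint (b j) by apply: res_lint; exact: igb_force.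
pose g (j : J) x := cpart j.1 (wderiv L (if j.2 then U.1 else U.2) x).
have spec (j : J) : exists pq : R * R, [/\ igb (g j), igb (comp2 U j),
    prim (res L (g j)) L = 0 /\ aeL (fun x => comp U j x = pq.1 + prim (res L (g j)) x) &
    prim (res L (comp2 U j)) L = 0 /\ aeL (fun x => g j x = pq.2 + prim (res L (comp2 U j)) x)].
  have hj : H2per L (if j.2 then U.1 else U.2) by case: j.2.
  have [lf hg hh] := H2perP L0 hj; have lg := hg.1; have lh := hh.1.
  have [_ /(_ j.1)[g0 [p hp]]] := (wderiv_rep L0 _ lf).1 hg.
  have [_ /(_ j.1)[h0 [q hq]]] := (wderiv_rep L0 _ lg).1 hh.
  exists (p, q); split; [| |exact: (conj g0 hp)|exact: (conj h0 hq)].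
    by have [_ /(_ j.1)/l2_igb] := (L2perP L _).1 lg.
  by have [_ /(_ j.1)/l2_igb] := (L2perP L _).1 lh.
have /choice[pq hpq] := spec.
have cK := @K4_continuous R s c qs cq m n.
pose w1 (j : J) x := (pq j).2 + prim (res L (comp2 U j)) x.
have lh j : lint (res L (comp2 U j)) by have [_ ih _ _] := hpq j; exact: res_lint.
have cw1 j : continuous (w1 j).
  by have h := prim_continuous (lh j); rewrite /w1; cont_tac.
pose w (j : J) x := (pq j).1 + prim (w1 j) x.
have cw j : continuous (w j).
  by have h := der_continuous (prim_der (cw1 j)); rewrite /w; cont_tac.
have clw j : continuous (lin (K4 m n) w j) by exact: (@lin_continuous R J _ w j cK cw).
have E1 j x : 0 <= x <= L -> prim (res L (g j)) x = prim (w1 j) x.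
  have [ig _ _ [_ hg]] := hpq j.
  apply: prim_ae; [exact: res_lint|exact: continuous_lint|].
  by apply: aeL_imp hg => t ht; rewrite res_in.
have fw : aeL (fun x => forall j, comp U j x = w j x).
  apply: aeL_forall => j; have [_ _ [_ hf] _] := hpq j.
  by apply: aeL_imp hf => x hx ->; rewrite /w E1.
have hh : aeL (fun x => forall j, comp2 U j x = lin (K4 m n) w j x + b j x).
  apply: aeL_imp (aeL_and fw (aeL_forall hF)) => x hx [e1 e2] j.
  rewrite (shifted_force m n) (eq_lin _ _ _ e1) /b /rforce res_in //.
  by congr (_ + _); rewrite /force !e2.
have E2 j x : 0 <= x <= L -> w1 j x = (pq j).2 + prim (lin (K4 m n) w j) x + pr1 b j x.
  move=> hx; rewrite /w1 -addrA; congr (_ + _).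
  have cl := continuous_lint (clw j).
  rewrite /pr1 -prim_lintD //; last by case/andP: hx.
  apply: prim_ae (hx) => //; first by move=> a a'; apply: (@integrableD _ _ _ _ _ _ (EFin \o _) (EFin \o _)); [|exact: cl|exact: lb].
  by apply: aeL_imp hh => t ht; rewrite res_in.
pose v1 j x := (pq j).2 + prim (lin (K4 m n) w j) x.
pose v j x := (pq j).1 + prim (v1 j) x.
have dv1 j : der (v1 j) (lin (K4 m n) w j).
  by have h := prim_der (clw j); move=> x; rewrite /v1; D1_solve; ring.
have cv1 j : continuous (v1 j) := der_continuous (dv1 j).
have dv j : der (v j) (v1 j).
  by have h := prim_der (cv1 j); move=> x; rewrite /v; D1_solve; ring.
have cp1 j : continuous (pr1 b j) by exact: (@pr1_continuous b).
have E3 j x : 0 <= x <= L -> w j x = v j x + pr2 b j x.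
  move=> hx; rewrite /w /v /pr2 -addrA; congr (_ + _).
  transitivity (prim (fun t => v1 j t + pr1 b j t) x); last exact: (primD x (cv1 j) (cp1 j)).
  have lv : lint (fun t => v1 j t + pr1 b j t) := continuous_lint (cont_add (cv1 j) (cp1 j)).
  apply: (prim_ae (continuous_lint (cw1 j)) lv _ hx).
  by apply: aeL_all => t ht; exact: E2.
have E4 j x : 0 <= x <= L -> lin (K4 m n) w j x = lin (K4 m n) v j x + lin (K4 m n) (pr2 b) j x.
  move=> hx; rewrite /lin -big_split /=; apply: eq_bigr => i _.
  by rewrite (E3 i x hx) mulrDr.
exists (fun j x => lin (K4 m n) w j x - lin (K4 m n) v j x - lin (K4 m n) (pr2 b) j x), v, v1.
have hLL : 0 <= L <= L by rewrite lexx ltW.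
split.
- move=> j x hx; apply/eqP; rewrite -addrA -opprD subr_eq0; apply/eqP; exact: E4.
- move=> j; split; first exact: dv.
  have aux (a1 a2 a3 : R) : a1 = a2 + (a3 + (a1 - a2 - a3)) by ring.
  by move=> x; apply: D1_eq (dv1 j x) _; exact: aux.
- split=> j; have [_ _ [g0 _] [h0 _]] := hpq j.
    have e1 : prim (w1 j) L = 0 by rewrite -(E1 j L hLL) g0.
    have e2 : prim (v1 j) 0 = 0 := prim0 _.
    transitivity (w j L); first exact: esym (E3 j L hLL).
    by change ((pq j).1 + prim (w1 j) L = (pq j).1 + prim (v1 j) 0); rewrite e1 e2.
  by have := E2 j L hLL; rewrite /w1 h0 /v1 prim0 => <-.
- by move=> j; apply: aeL_imp fw => x hx ->; rewrite E3.
Qed.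

(** [periodic_forced] keeps the periodic extension of v + [pr2] and of its derivative free of jumps
    at multiples of L, so that the derivatives on [0, L] extend to weak ones. *)
Lemma classical_weak m n F v v1 : (forall j, l2 L (F j)) ->
  ode2 (K4 m n) (lin (K4 m n) (pr2 (rforce F))) v v1 -> periodic_forced L (rforce F) v v1 ->
  exists U, [/\ HH2per L U, forall j, aeL (fun x => comp (shifted D (m +i* n) U) j x = F j x) &
    forall j x, 0 <= x <= L -> comp U j x = v j x + pr2 (rforce F) j x].
Proof.
move=> lF hv [pv pv1]; set b := rforce F in hv pv pv1 *.
have l2b j : l2 L (b j) by apply: l2_res; exact: l2_force.
have lb j : lint (b j) by apply: res_lint; apply: igb_force => i; exact: l2_igb.
have cK := @K4_continuous R s c qs cq m n.
pose w j x := v j x + pr2 b j x; pose w1 j x := v1 j x + pr1 b j x.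
have dw j : der (w j) (w1 j).
  by have [d1 _] := hv j; have d2 := @pr2_der b j lb; move=> x; rewrite /w; D1_solve.
have cw j : continuous (w j) := der_continuous (dw j).
have cw1 j : continuous (w1 j).
  have c1 := der_continuous (hv j).2; have c2 := @pr1_continuous b j lb; by rewrite /w1; cont_tac.
have clw j : continuous (lin (K4 m n) w j) by exact: (@lin_continuous R J _ w j cK cw).
have dv1 j : der (v1 j) (lin (K4 m n) w j).
  move=> x; apply: D1_eq ((hv j).2 x) _; rewrite -big_split /=; apply: eq_bigr => i _.
  by rewrite mulrDr.
pose h j x := lin (K4 m n) w j x + b j x.
have lh j : lint (h j).
  by move=> a a'; apply: (@integrableD _ _ _ _ _ _ (EFin \o _) (EFin \o _)); [|exact: continuous_lint (clw j) _ _|exact: lb].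
have l2w j : l2 L (w j) by exact: l2_cont.
have l2w1 j : l2 L (w1 j) by exact: l2_cont.
have l2h j : l2 L (h j) by apply: l2D => //; exact: l2_cont.
have wE j x : w j x = w j 0 + prim (w1 j) x.
  by rewrite -(prim_unique x (cw1 j) (dw j)); ring.
have w1E j x : 0 <= x -> w1 j x = w1 j 0 + prim (h j) x.
  move=> x0; rewrite /h prim_lintD //; last exact: continuous_lint.
  rewrite -(prim_unique x (clw j) (dv1 j)) /w1 /pr1 prim0; ring.
have hLL : 0 <= L <= L by rewrite lexx ltW.
have lw1 j : lint (w1 j) := continuous_lint (cw1 j).
have W1 i : is_wderiv L (ext L w i) (ext L w1 i).
  apply: wderiv_ext => // j => [|x hx]; rewrite prim_res //.
  have := wE j L; rewrite {1}/w pv /w /pr2 prim0 addr0 => /eqP.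
  by rewrite -[X in X == _]addr0 (inj_eq (addrI _)) eq_sym => /eqP.
have W2 i : is_wderiv L (ext L w1 i) (ext L h i).
  apply: wderiv_ext => // j => [|x hx]; rewrite prim_res //; last by apply: w1E; case/andP: hx.
  have := w1E j L (ltW L0); rewrite {1}/w1 pv1 /w1 /pr1 prim0 addr0 => /eqP.
  by rewrite -[X in X == _]addr0 (inj_eq (addrI _)) eq_sym => /eqP.
pose U : vfun R := (ext L w true, ext L w false).
have Ui (i : bool) : (if i then U.1 else U.2) = ext L w i by case: i.
have wp (j : J) x : 0 <= x <= L -> w j (perx L x) = w j x.
  move=> /andP[x0]; rewrite le_eqVlt => /orP[/eqP ->|xL]; last by rewrite perx_in // x0.
  by rewrite perx_L // /w pv /pr2 prim0 addr0.
have cU j x : 0 <= x <= L -> comp U j x = w j x.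
  by move=> hx; rewrite /comp Ui cpart_ext -surjective_pairing wp.
exists U; split.
- have h2 i : H2per L (ext L w i) by split; [exact: L2per_ext|exists (ext L w1 i), (ext L h i)].
  by split; exact: h2.
- have c2 : aeL (fun x => forall j, comp2 U j x = h j x).
    apply: aeL_forall => j; rewrite /comp2 Ui.
    have [_ _ /(_ j.1) hae] := wderiv2_spec L0 (W1 j.2) (W2 j.2).
    apply: aeL_imp (aeL_and hae (cpart_ext_ae L0 h j.2 j.1)) => x _ [-> ->].
    by rewrite -surjective_pairing.
  move=> j; apply: aeL_imp c2 => x hx e; apply: force_inj => i; rewrite e /h.
  by rewrite /b /rforce res_in //; congr (_ + _); apply: eq_lin => k; rewrite cU.
- by move=> j x hx; rewrite cU.
Qed.

End Operator.

(** * Spectrum and resolvent *)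

Section Spectral.
Variables (R : realType) (s c L : R) (qs phi : R -> R).
Hypotheses (s0 : 0 < s) (sE : s = 5 - 4 * c ^+ 2) (L0 : 0 < L) (cq : continuous qs).
Hypothesis phiE : forall x, 1 - 3 * phi x ^+ 2 - 5 * phi x ^+ 4 = s * qs x + c ^+ 2.
Local Notation mu := (@lebesgue_measure R).
Local Notation J := (bool * bool)%type.
Local Notation igb := (@igb R L).
Local Notation aeL := (@aeL R L).
Local Notation K4 := (@K4 R s c qs).
Local Notation percsol := (@percsol R s c L qs).
Local Notation persol := (@persol R s c L qs).
Local Notation D := (opD L phi c).
Local Notation rforce := (@rforce R s c L).
Implicit Types (U V : vfun R) (F : J -> R -> R).

Lemma vae_eqP U V : vae_eq L U V <-> forall j, aeL (fun x => comp U j x = comp V j x).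
Proof.
split=> [[h1 h2] [p i]|h].
  by rewrite /comp; case: i; [apply: aeL_imp h1|apply: aeL_imp h2] => x _ /= ->.
by split; [have h1 := h (true, true); have h2 := h (false, true)
          |have h1 := h (true, false); have h2 := h (false, false)];
  apply: (aeL_imp _ (aeL_and h1 h2)) => x _ [e1 e2]; apply: cpart_eq => -[].
Qed.

Lemma comp_vzero j x : comp (vzero R) j x = 0.
Proof. by rewrite /comp; case: j => p [] /=; exact: cpart0. Qed.

Lemma vae_shifted lam U : vae_eq L (shifted D lam U) (vzero R) <-> vae_eq L (D U) (vscale lam U).
Proof.
split=> -[h1 h2]; split.
- by apply: (aeL_imp _ h1) => x _ /eqP; rewrite subr_eq0 => /eqP.
- by apply: (aeL_imp _ h2) => x _ /eqP; rewrite subr_eq0 => /eqP.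
- by apply: (aeL_imp _ h1) => x _ e; apply/eqP; rewrite subr_eq0; apply/eqP.
- by apply: (aeL_imp _ h2) => x _ e; apply/eqP; rewrite subr_eq0; apply/eqP.
Qed.

Lemma rforce0 : rforce (fun _ _ => 0) = fun _ _ => 0.
Proof.
apply/funext => j; apply/funext => x; rewrite /rforce /res /force !mulr0 addr0 oppr0.
by case: ifP.
Qed.

Lemma pr_zero : pr1 (fun (_ : J) _ => 0) = (fun _ _ => 0 : R) /\ pr2 (fun (_ : J) _ => 0) = (fun _ _ => 0 : R).
Proof.
have h : pr1 (fun (_ : J) _ => 0) = (fun _ _ => 0 : R).
  by apply/funext => j; apply/funext => x; rewrite /pr1 prim_zero.
by split=> //; rewrite /pr2 h; apply/funext => j; apply/funext => x; rewrite prim_zero.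
Qed.

Lemma lin_zero m n j x : lin (K4 m n) (fun _ _ => 0) j x = 0.
Proof. by rewrite /lin big1 // => i _; rewrite mulr0. Qed.

Lemma igb0 : igb (fun=> 0). Proof. by apply: igb_cont; exact: cont_cst. Qed.

Lemma eigen_classical m n U : HH2per L U -> vae_eq L (shifted D (m +i* n) U) (vzero R) ->
  exists w w1, percsol m n (fun _ _ => 0) w w1 /\ forall j, aeL (fun x => comp U j x = w j x).
Proof.
move=> hU /vae_eqP hz.
have hz0 j : aeL (fun x => comp (shifted D (m +i* n) U) j x = 0).
  by apply: aeL_imp (hz j) => x _ ->; exact: comp_vzero.
have [e [v [v1 [ez hv hp hae]]]] :=
  weak_classical s0 sE L0 cq phiE hU (fun j : J => igb0) hz0.
move: hv hp hae; rewrite rforce0 => hv [pv pv1] hae.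
have [p1 p2] := pr_zero.
(* v solves the homogeneous equation only on [0, L]; the solution with the same data at 0 solves it
   everywhere and agrees with v there. *)
have [||w [w1 [hw w0 w10]]] := @ode2_exists R J (K4 m n) (fun _ _ => 0) (fun i => v i 0) (fun i => v1 i 0).
- exact: (@K4_continuous R s c qs cq m n).
- by move=> i; exact: cont_cst.
have E j x : 0 <= x <= L -> w j x = v j x /\ w1 j x = v1 j x.
  apply: (ode2_unique (@K4_continuous R s c qs cq m n) hw hv _ w0 w10).
  by move=> i t ht; rewrite p2 lin_zero ez // addr0.
have hLL : 0 <= L <= L by rewrite lexx ltW.
exists w, w1; split.
  split=> // j; have [e1 e2] := E j L hLL.
    by rewrite e1 w0 -pv p2 addr0.
  by rewrite e2 w10 -pv1 p1 addr0.
move=> j; apply: aeL_imp (hae j) => x hx ->.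
by have [-> _] := E j x hx; rewrite p2 addr0.
Qed.

Lemma eigen_weak m n w w1 : percsol m n (fun _ _ => 0) w w1 ->
  exists U, [/\ HH2per L U, vae_eq L (shifted D (m +i* n) U) (vzero R) &
    forall j x, 0 <= x <= L -> comp U j x = w j x].
Proof.
move=> [hw pw pw1]; have [p1 p2] := pr_zero.
have l0 : l2 L (fun=> 0 : R) by apply: l2_cont; exact: cont_cst.
have hw' : ode2 (K4 m n) (lin (K4 m n) (pr2 (rforce (fun _ _ => 0)))) w w1.
  rewrite rforce0 p2 (_ : lin _ _ = fun _ _ => 0) //.
  by apply/funext => j; apply/funext => x; exact: lin_zero.
have hp : periodic_forced L (rforce (fun _ _ => 0)) w w1.
  by rewrite rforce0; split=> i; rewrite ?p1 ?p2 addr0.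
have [U [hU hz hc]] := classical_weak s0 sE L0 cq phiE (fun j : J => l0) hw' hp.
exists U; split => //.
  by apply/vae_eqP => j; apply: aeL_imp (hz j) => x _ ->; rewrite comp_vzero.
by move=> j x hx; rewrite hc // rforce0 p2 addr0.
Qed.

Lemma L2_comp U j : L2per L U.1 -> L2per L U.2 -> l2 L (comp U j).
Proof.
by case: j => p i /L2perP[_ h1] /L2perP[_ h2]; rewrite /comp /=; case: i.
Qed.

Lemma l2_comp2 U j : HH2per L U -> l2 L (comp U j) /\ l2 L (comp2 L U j).
Proof.
move=> [h1 h2]; have [a1 a2 a3] := H2perP L0 h1; have [b1 b2 b3] := H2perP L0 h2.
split; first exact: L2_comp.
have [_ h3] := (L2perP L _).1 a3.1; have [_ h4] := (L2perP L _).1 b3.1.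
by case: j => p i; case: i; [exact: (h3 p)|exact: (h4 p)].
Qed.

Lemma l2_shifted m n U j : HH2per L U -> l2 L (comp (shifted D (m +i* n) U) j).
Proof.
move=> hU; have l1 i := (l2_comp2 i hU).1; have l2' i := (l2_comp2 i hU).2.
have cA : continuous (fun x => s * qs x + c ^+ 2) by have h := cq; cont_tac.
have lN f : l2 L f -> l2 L (fun x => - f x).
  by move=> h; rewrite (_ : (fun x => - f x) = fun x => -1 * f x); [exact: l2Z|apply/funext => x; rewrite mulN1r].
case: j => p i; case: i.
  rewrite (_ : comp _ _ = fun x => - 5 * comp2 L U (p, true) x + (s * qs x + c ^+ 2) * comp U (p, true) x
    + (- 4 * c * comp2 L U (p, false) x + c * comp U (p, false) x)
    + - (m * comp U (p, true) x + - ((if p then n else - n) * comp U (~~ p, true) x))).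
    apply: l2D; last by apply: (lN _); apply: l2D; [|apply: (lN _)]; apply: l2Z; exact: l1.
    apply: l2D; last by apply: l2D; apply: l2Z; [exact: l2'|exact: l1].
    by apply: l2D; [apply: l2Z; exact: l2'|apply: (l2M cA); exact: l1].
  by apply/funext => x; have [-> _] := comp_shifted L phiE m n U p x.
rewrite (_ : comp _ _ = fun x => (- 4 * c * comp2 L U (p, true) x + c * comp U (p, true) x)
    + (- 4 * comp2 L U (p, false) x + comp U (p, false) x)
    + - (m * comp U (p, false) x + - ((if p then n else - n) * comp U (~~ p, false) x))).
  apply: l2D; last by apply: (lN _); apply: l2D; [|apply: (lN _)]; apply: l2Z; exact: l1.
  apply: l2D; first by apply: l2D; apply: l2Z; [exact: l2'|exact: l1].
  by apply: l2D; [apply: l2Z; exact: l2'|exact: l1].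
by apply/funext => x; have [_ ->] := comp_shifted L phiE m n U p x.
Qed.

Definition sqsum F x : R := F (true, true) x ^+ 2 + F (true, false) x ^+ 2
  + (F (false, true) x ^+ 2 + F (false, false) x ^+ 2).

Lemma vnormE U : vnorm L U = Num.sqrt (\int[mu]_(x in `[0, L]) sqsum (comp U) x).
Proof.
by congr Num.sqrt; apply: eq_Rintegral => x _; rewrite /sqsum /comp /sqmod /=; ring.
Qed.

Lemma igb_sqsum F : (forall j, l2 L (F j)) -> igb (sqsum F).
Proof.
move=> h; have h1 j : igb (fun x => F j x ^+ 2) by have [] := h j.
by do ![apply: igbD].
Qed.

Lemma rforce_bound : exists2 M : R, 0 <= M & forall F, (forall j, l2 L (F j)) ->
  (\sum_j prim (fun t => `|rforce F j t|) L) ^+ 2 <= M * \int[mu]_(x in `[0, L]) sqsum F x.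
Proof.
have [M' M1 hM] := Minv_bound s c.
(* Each of the four components contributes 2 M' ^ 2 L, and the square of a sum of four terms is at
   most 4 times the sum of their squares. *)
exists (32 * M' ^+ 2 * L); first by rewrite mulr_ge0 ?(ltW L0) // mulr_ge0 // sqr_ge0.
move=> F lF; have iS := igb_sqsum lF; set S := \int[mu]_(x in _) _.
have bj j : (prim (fun t => `|rforce F j t|) L) ^+ 2 <= 2 * M' ^+ 2 * L * S.
  have lb : l2 L (rforce F j) by apply: l2_res; exact: l2_force.
  have ln : lint (fun t => `|rforce F j t|).
    apply: lint_norm; apply: res_lint; apply: igb_force => i; exact: l2_igb.
  rewrite primL //; apply: le_trans (cauchy_schwarz_1 L0 lb) _.
  rewrite (_ : 2 * M' ^+ 2 * L * S = L * (2 * M' ^+ 2 * S)); last by ring.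
  apply: ler_wpM2l; first exact: ltW.
  rewrite /S -RintegralZl //; apply: le_Rintegral => //.
  - by have [_ ib] := lb.
  - exact: igbZ.
  move=> x /inL hx; rewrite /rforce res_in // /force sqrrN.
  set a := F (j.1, true) x; set b := F (j.1, false) x.
  have hab : a ^+ 2 + b ^+ 2 <= sqsum F x.
    rewrite /sqsum /a /b; case: j.1.
      by rewrite lerDl addr_ge0 // sqr_ge0.
    by rewrite lerDr addr_ge0 // sqr_ge0.
  have M0 : 0 <= M' by lra.
  have q k : Minv s c j.2 k ^+ 2 <= M' ^+ 2.
    by rewrite -(real_normK (num_real (Minv s c j.2 k))) ler_pXn2r ?nnegrE.
  have [q1 q2] := (q true, q false).
  apply: le_trans (_ : 2 * M' ^+ 2 * (a ^+ 2 + b ^+ 2) <= _); last first.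
    by apply: ler_wpM2l => //; rewrite mulr_ge0 // sqr_ge0.
  move: (Minv s c j.2 true) (Minv s c j.2 false) q1 q2 => k1 k2 q1 q2.
  have t1 : 0 <= (M' ^+ 2 - k1 ^+ 2) * a ^+ 2 by rewrite mulr_ge0 ?sqr_ge0 // subr_ge0.
  have t2 : 0 <= (M' ^+ 2 - k2 ^+ 2) * b ^+ 2 by rewrite mulr_ge0 ?sqr_ge0 // subr_ge0.
  by have := sqr_ge0 (k1 * a - k2 * b); lra.
rewrite big_bool2.
have := bj (true, true); have := bj (true, false); have := bj (false, true); have := bj (false, false).
move: (prim _ L) (prim _ L) (prim _ L) (prim _ L) => x1 x2 x3 x4.
set Q := 2 * M' ^+ 2 * L * S => h1 h2 h3 h4.
have -> : 32 * M' ^+ 2 * L * S = 16 * Q by rewrite /Q; ring.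
have := sqr_ge0 (x1 - x2); have := sqr_ge0 (x1 - x3); have := sqr_ge0 (x1 - x4).
have := sqr_ge0 (x2 - x3); have := sqr_ge0 (x2 - x4); have := sqr_ge0 (x3 - x4).
by lra.
Qed.

Lemma not_eigenvalue_resolvent m n : ~ is_eigenvalue L D (m +i* n) ->
  resolvent_set L D (m +i* n).
Proof.
move=> ne; have cK := @K4_continuous R s c qs cq m n.
have inj0 U : HH2per L U -> vae_eq L (shifted D (m +i* n) U) (vzero R) -> vae_eq L U (vzero R).
  move=> hU hz; apply: contrapT => nz; apply: ne; exists U; split => //; exact/vae_shifted.
have inj w w1 : ode2 (K4 m n) (fun _ _ => 0) w w1 -> (forall i, w i L = w i 0) ->
    (forall i, w1 i L = w1 i 0) -> forall i, w i 0 = 0 /\ w1 i 0 = 0.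
  move=> hw p0 p1; have [U [hU hz hc]] := eigen_weak (And3 hw p0 p1).
  have /vae_eqP hU0 := inj0 U hU hz.
  have wz j x : 0 <= x <= L -> w j x = 0.
    apply: (continuous_ae0 L0 (der_continuous (hw j).1)).
    by apply: aeL_imp (hU0 j) => t ht; rewrite hc // comp_vzero.
  by move=> i; split; [apply: wz; rewrite lexx ltW|exact: (ode2_vanish L0 cK hw wz)].
split => //.
- move=> F [l1 l2']; have lF j : l2 L (comp F j) := L2_comp j l1 l2'.
  have lb j : lint (rforce (comp F) j).
    by apply: res_lint; apply: igb_force => i; exact: l2_igb.
  have [v [v1 [hv hp]]] := fredholm_exists cK inj lb.
  have [U [hU hs _]] := classical_weak s0 sE L0 cq phiE lF hv hp.
  by exists U => //; exact/vae_eqP.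
have [C C0 hC] := fredholm_bound cK L0 inj.
have [M M0 hM] := rforce_bound.
(* Each of the four components is at most C B on [0, L], so the squared norm of U is at most 4 C ^ 2
   L B ^ 2, and B ^ 2 is bounded by M times the squared norm of the right-hand side. *)
exists (Num.sqrt (4 * C ^+ 2 * M * L)) => U hU.
pose F := comp (shifted D (m +i* n) U).
have lF j : l2 L (F j) := l2_shifted m n j hU.
have lb j : lint (rforce F j).
  by apply: res_lint; apply: igb_force => i; exact: l2_igb.
have iF j : igb (F j) := l2_igb (lF j).
have hF j : aeL (fun x => comp (shifted D (m +i* n) U) j x = F j x) by exact: aeL_all.
have [e [v [v1 [ez hv hp hae]]]] := weak_classical s0 sE L0 cq phiE hU iF hF.
have {}hC := hC _ _ _ _ lb ez hv hp; have {}hM := hM F lF.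
move: hC hM; set B := \sum_j _ => hC hM.
have S0 : 0 <= \int[mu]_(x in `[0, L]) sqsum F x.
  by apply: Rintegral_ge0 => x _; rewrite /sqsum !addr_ge0 // sqr_ge0.
rewrite !vnormE -/F -sqrtrM; last by rewrite !mulr_ge0 ?sqr_ge0 // ltW.
apply: ler_wsqrtr; rewrite -/F.
have iU : igb (sqsum (comp U)) by apply: igb_sqsum => j; have [] := l2_comp2 j hU.
pose W j x := v j x + pr2 (rforce F) j x.
have cW j : continuous (W j).
  apply: cont_add; first exact: der_continuous (hv j).1.
  exact: der_continuous (pr2_der j lb).
have iW : igb (sqsum W) by apply: igb_sqsum => j; exact: l2_cont.
have ic : igb (fun=> 4 * (C * B) ^+ 2) by apply: igb_cont; exact: cont_cst.
rewrite (Rint_ae iU iW); last first.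
  by apply: (aeL_imp _ (aeL_forall hae)) => x hx E; rewrite /sqsum !E.
apply: le_trans (_ : \int[mu]_(x in `[0, L]) (4 * (C * B) ^+ 2) <= _).
  apply: le_Rintegral => // x /inL hx.
  have b j : W j x ^+ 2 <= (C * B) ^+ 2.
    have h := hC j x hx; rewrite -(real_normK (num_real (W j x))).
    by rewrite ler_pXn2r ?nnegrE // (le_trans _ h).
  have aux (t : R) : 4 * t = t + t + (t + t) by ring.
  by rewrite aux; exact: lerD (lerD (b _) (b _)) (lerD (b _) (b _)).
rewrite (Rint_cst L0).
have -> : 4 * (C * B) ^+ 2 * L = 4 * C ^+ 2 * L * B ^+ 2 by ring.
have -> : 4 * C ^+ 2 * M * L * \int[mu]_(x in `[0, L]) sqsum F x =
  4 * C ^+ 2 * L * (M * \int[mu]_(x in `[0, L]) sqsum F x) by ring.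
by apply: ler_wpM2l => //; rewrite !mulr_ge0 ?sqr_ge0 // ltW.
Qed.

Definition nontrivial (w : bool -> R -> R) := exists i x, 0 <= x <= L /\ w i x != 0.

Lemma eigenvalue_parts m n : is_eigenvalue L D (m +i* n) ->
  exists w w1, percsol m n (fun _ _ => 0) w w1 /\ exists p, nontrivial (fun i => w (p, i)).
Proof.
move=> [U [hU nz /vae_shifted hz]]; have [w [w1 [hw hae]]] := eigen_classical hU hz.
exists w, w1; split => //; apply: contrapT => h; apply: nz; apply/vae_eqP => -[p i].
apply: aeL_imp (hae (p, i)) => x hx ->; rewrite comp_vzero.
apply/eqP; apply/negPn/negP => ne; apply: h; exists p, i, x; split => //.
Qed.

Lemma eigenvalue_real m n : is_eigenvalue L D (m +i* n) -> n = 0.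
Proof.
move=> /eigenvalue_parts[w [w1 [hw [p [i [x [hx /eqP ne]]]]]]].
apply: contrapT => /eqP n0; apply: ne.
exact: (nonreal_percsol s0 sE L0 n0 hw).
Qed.

Lemma eigenvalue_persol m : is_eigenvalue L D (m +i* 0) ->
  exists w w1, persol m w w1 /\ nontrivial w.
Proof.
move=> /eigenvalue_parts[w [w1 [hw [p hp]]]].
by exists (fun i => w (p, i)), (fun i => w1 (p, i)); split => //; exact: percsol_real hw p.
Qed.

Lemma persol_percsol m w w1 : persol m w w1 ->
  percsol m 0 (fun _ _ => 0) (fun j x => if j.1 then w j.2 x else 0) (fun j x => if j.1 then w1 j.2 x else 0).
Proof.
move=> [hw p0 p1]; split; [|by case=> [[] i] /=|by case=> [[] i] /=].
case=> [[] i]; split=> x.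
- exact: (sol_der i hw).
- apply: D1_eq (sol_der1 i hw x) _; rewrite lin4 /=.
  have aux (a b t : R) : a + b = a + b + 0 * t + 0 by ring.
  exact: aux.
- exact: D1_cst.
- apply: D1_eq (D1_cst 0 x) _; rewrite lin4 /=; ring.
Qed.

Lemma eigen_of_persol m w w1 : persol m w w1 -> nontrivial w ->
  exists U, eigenfunction L D (m +i* 0) U /\
    forall i x, 0 <= x <= L -> (if i then U.1 else U.2) x = (w i x)%:C.
Proof.
move=> hw [i [x [hx nz]]]; have hc := persol_percsol hw.
have [U [hU hz hUw]] := eigen_weak hc; exists U; split; last first.
  move=> k t ht; apply: cpart_eq => p; have := hUw (p, k) t ht; rewrite /comp /= => ->.
  by case: p.
split => //; last exact/vae_shifted.
move=> /vae_eqP h0; move/eqP: nz; apply.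
have [cw _] := sol_cont (let: And3 h _ _ := hw in h).
apply: (continuous_ae0 L0 (cw i) _ hx).
by apply: aeL_imp (h0 (true, i)) => t ht; rewrite hUw // comp_vzero.
Qed.

(** Real and imaginary parts of an eigenfunction solve the real system. They are multiples a and b
    of w, whence the complex factor a + i b. *)
Lemma simple_of_persol m w w1 : persol m w w1 -> nontrivial w ->
  (forall v v1, persol m v v1 -> exists a : R, forall i x, 0 <= x <= L -> v i x = a * w i x) ->
  simple_eigenvalue L D (m +i* 0).
Proof.
move=> hw nz h; have [U [hU Uw]] := eigen_of_persol hw nz.
exists U => // V [hV _ /vae_shifted hz]; have [v [v1 [hv hae]]] := eigen_classical hV hz.
have [a ha] := h _ _ (percsol_real hv true); have [b hb] := h _ _ (percsol_real hv false).
exists (a +i* b); apply/vae_eqP => -[p i]; apply: aeL_imp (hae (p, i)) => x hx ->.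
have -> : comp (vscale (a +i* b) U) (p, i) x = cpart p ((a +i* b) * (if i then U.1 else U.2) x).
  by rewrite /comp /=; case: i.
rewrite (Uw i x hx) cpartM.
by case: p => /=; [rewrite ha //|rewrite hb //]; rewrite /cpart /=; ring.
Qed.

End Spectral.

(** * The theorem *)

(** The bound on L implies L > 2 pi, so L ^ 4 / (L ^ 2 - 4 pi ^ 2) ^ 2 >= 1 and the outer square
    root is at most 2. *)
Lemma speed_lt1 (R : realType) (L c : R) :
  2 * pi * Num.sqrt (Num.sqrt 5 / (Num.sqrt 5 - 1)) < L ->
  c < 1 / 2 * Num.sqrt (5 - L ^+ 4 / (L ^+ 2 - 4 * pi ^+ 2) ^+ 2) -> c < 1.
Proof.
move=> hL hc; have p0 : 0 < pi :> R := pi_gt0 R.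
have s5 : 1 < Num.sqrt 5 :> R by rewrite -[X in X < _]sqrtr1 ltr_sqrt // ltr1n.
have q1 : 1 < Num.sqrt (Num.sqrt 5 / (Num.sqrt 5 - 1)) :> R.
  rewrite -[X in X < _]sqrtr1 ltr_sqrt; last by rewrite divr_gt0 //; lra.
  by rewrite ltr_pdivlMr; lra.
have hL2 : 2 * pi < L.
  by apply: lt_trans hL; rewrite -[X in X < _]mulr1 ltr_pM2l // mulr_gt0.
have d0 : 0 < L ^+ 2 - 4 * pi ^+ 2 by nra.
apply: lt_le_trans hc _; rewrite mul1r mulrC ler_pdivrMr // mul1r.
have -> : 2 = Num.sqrt (2 ^+ 2) :> R by rewrite sqrtr_sqr ger0_norm.
apply: ler_wsqrtr; rewrite lerBlDr -lerBlDl.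
have -> : 5 - 2 ^+ 2 = 1 :> R by ring.
rewrite ler_pdivlMr ?exprn_gt0 // mul1r.
rewrite (_ : L ^+ 4 = (L ^+ 2) ^+ 2); last by ring.
rewrite ler_pXn2r ?nnegrE ?sqr_ge0 ?(ltW d0) //.
by rewrite lerBlDr lerDl mulr_ge0 // sqr_ge0.
Qed.

Theorem lemma4p4 (R : realType) (L c a4 : R)
  (hL : 2 * pi * Num.sqrt (Num.sqrt 5 / (Num.sqrt 5 - 1)) < L)
  (hc0 : 0 < c)
  (hc1 : c < 1 / 2 * Num.sqrt (5 - L ^+ 4 / (L ^+ 2 - 4 * pi ^+ 2) ^+ 2))
  (ha4 : alpha4_min c < a4 < alpha4_max c)
  (hT : dnoidal_period a4 c = L) :
  let phi := dnoidal a4 c in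
  let D := opD L phi c in
  exists lam0 : R[i],
    [/\ [/\ lam0 < 0, simple_eigenvalue L D lam0 &
            forall lam : R[i], lam < 0 -> is_eigenvalue L D lam -> lam = lam0],
        simple_eigenvalue L D 0 /\
        eigenfunction L D 0
          (fun x => (derive1 phi x)%:C, fun x => (- c * derive1 phi x)%:C) &
        let S := spectrum L D `\` [set lam0; 0] in
        [/\ forall lam, S lam -> is_eigenvalue L D lam,
            (S : set (R[i]^o)) `<=` isolated (S : set (R[i]^o)) &
            exists2 delta : R, 0 < delta &
              forall lam, S lam -> delta%:C <= `|lam|]].
Proof.
move=> phi D; have c1 : c < 1 := speed_lt1 hL hc1; have c0 := hc0.
have L0 := L_gt0 c0 c1 ha4 hT.
have L4 : 0 < L / 4 < L / 2 by apply/andP; split; lra.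
have L4' : 0 <= L / 4 <= L by apply/andP; split; lra.
have s0 := ss_gt0 c0 c1.
have sE : ss c = 5 - 4 * c ^+ 2 by [].
have cq := @qs_continuous R c a4 c0 c1 ha4; have qsym := qs_reflect c0 c1 ha4 hT.
have du := dnoidal1_der c0 c1 ha4; have du1 := phi2_der c0 c1 ha4.
have dy := ysol_der c0 c1 ha4; have dy1 := ysol1_der c0 c1 ha4.
have u_0 := phi1_0 c0 c1 ha4.
have u_neg := fun x => @phi1_lt0 R L c a4 c0 c1 ha4 hT x.
have u1_0 := phi2_0 c0 c1 ha4; have u1_H := phi2_H c0 c1 ha4 hT.
have y_0 := ysol_0 c0 c1 ha4; have y1_0 := ysol1_0 c0 c1 ha4.
have y_H := ysol_H c0 c1 ha4 hT; have y1_H := ysol1_H c0 c1 ha4 hT; have y1_L := ysol1_L c0 c1 ha4 hT.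
have u_L : dnoidal1 c a4 L = 0 by rewrite -[L]add0r (phi1L c0 c1 ha4 hT).
have u1_L : dnoidal2 c a4 L = dnoidal2 c a4 0.
  by rewrite /dnoidal2 -[L in LHS]add0r (phiL c0 c1 ha4 hT).
have phiE x : 1 - 3 * phi x ^+ 2 - 5 * phi x ^+ 4 = ss c * qs c a4 x + c ^+ 2.
  by rewrite /qs /rr -/phi; field; rewrite gt_eqF.
have rE (m : R) : m +i* 0 = m%:C :> R[i] by [].
have hLL : 0 <= L <= L by rewrite lexx ltW.
have [mu0 [w [w1 [mu00 hw [i0 wi0]]]]] := negative_eigenvalue s0 sE L0 cq qsym dy dy1 y_0 y1_0 y1_H.
have h00 : (0 : R) <= 0 <= L by rewrite lexx ltW.
have nw : nontrivial L w by exists i0, 0.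
have npos v : nontrivial L v -> ~ (forall i x, 0 <= x <= L -> v i x = 0).
  by move=> [i [x [hx /eqP ne]]] h; apply: ne; exact: h.
have np := fun mu mu' v v1 z z1 => @negative_periodic R (ss c) c L (qs c a4) _ _ _ _ s0 sE L0 cq qsym
  du du1 dy dy1 u_0 u_neg u1_0 u1_H y_0 y1_0 y_H y1_H mu mu' v v1 z z1.
have kp := fun v v1 => @kernel_periodic R (ss c) c L (qs c a4) _ _ _ _ s0 sE L0 cq
  du du1 dy dy1 u_0 u1_0 y_0 y1_0 y1_L u1_L v v1.
pose k (i : bool) x := if i then dnoidal1 c a4 x else - c * dnoidal1 c a4 x.
pose k1 (i : bool) x := if i then dnoidal2 c a4 x else - c * dnoidal2 c a4 x.
have hk : persol (ss c) c L (qs c a4) 0 k k1.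
  split; [|by case; rewrite /k u_L u_0|by case; rewrite /k1 u1_L].
  have e5 : 5 = ss c + 4 * c ^+ 2 by rewrite sE; ring.
  have s1 : ss c != 0 by rewrite gt_eqF.
  case; split=> x; rewrite ?lin_bool /k /k1.
  - exact: du.
  - by apply: D1_eq (du1 x) _; rewrite /K2 /Minv /Nmat /=; field.
  - by D1_solve; ring.
  - have h1 := du1; D1_solve; rewrite /K2 /Minv /Nmat e5 /=; field; exact: s1.
have nk : nontrivial L k.
  exists true, (L / 4); split => //.
  by rewrite /k lt_eqF // u_neg.
have simple0 : simple_eigenvalue L D 0.
  apply: (simple_of_persol s0 sE L0 cq phiE hk nk) => v v1 [hv p0 p1].
  have [a ha] := kp v v1 hv p0 p1; exists a => i x hx; have [e1 e2] := ha x hx.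
  by case: i; rewrite /k ?e1 ?e2; ring.
have [lk [ek hlk]] := eigen_of_persol s0 sE L0 cq phiE hk nk.
have pd x : derive1 phi x = dnoidal1 c a4 x by rewrite (der_derive1 (phi_der c0 c1 ha4)).
have eigen0 : eigenfunction L D 0 (fun x => (derive1 phi x)%:C, fun x => (- c * derive1 phi x)%:C).
  (* The eigenfunction obtained agrees with (phi', - c phi') on [0, L]. Both are periodic at every
     point, hence equal as functions. *)
  have [[[l1 _] [l2 _]] _ _] := ek.
  have e1 : lk.1 = fun x => (derive1 phi x)%:C.
    apply: (periodic_eq L0 (let: And4 p _ _ _ := l1 in p)).
      by move=> x; rewrite !pd (phi1L c0 c1 ha4 hT).
    by move=> x hx; rewrite (hlk true x hx) pd.
  have e2 : lk.2 = fun x => (- c * derive1 phi x)%:C.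
    apply: (periodic_eq L0 (let: And4 p _ _ _ := l2 in p)).
      by move=> x; rewrite !pd (phi1L c0 c1 ha4 hT).
    by move=> x hx; rewrite (hlk false x hx) pd.
  by rewrite -e1 -e2 -surjective_pairing.
have real_of lam : is_eigenvalue L D lam -> lam = (complex.Re lam)%:C.
  by case: lam => m n /(eigenvalue_real s0 sE L0 cq phiE) ->.
have noacc mu : exists2 e, 0 < e & forall m, m != mu -> `|m - mu| < e -> ~ is_eigenvalue L D (m +i* 0).
  have [e e0 he] := no_accumulation s0 sE L0 cq mu; exists e => // m ne lt.
  move=> /(eigenvalue_persol s0 sE L0 cq phiE)[v [v1 [hv /npos nv]]]; apply: nv.
  have hz := he m v v1 ne lt hv; case: hv => hv _ _ i x hx.
  by have [] := ode2_zero (@K2_continuous R (ss c) c (qs c a4) cq m) hv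
    (fun i => (hz i).1) (fun i => (hz i).2) i hx.
exists (mu0 +i* 0); split.
- split.
  + by rewrite ltcE /= eqxx.
  + apply: (simple_of_persol s0 sE L0 cq phiE hw nw) => v v1 hv.
    have [a [b [ab /(_ erefl) h _]]] := np mu0 mu0 w w1 v v1 mu00 mu00 hw hv.
    have b0 : b != 0.
      apply/eqP => b0; move: ab; rewrite b0 eqxx orbF => a0.
      apply: (npos w nw) => i x hx; have := h i x hx; rewrite b0 mul0r addr0 => /eqP.
      by rewrite mulf_eq0 (negbTE a0) => /eqP.
    exists (- a / b) => i x hx; have := h i x hx => e.
    apply: (mulfI b0); have -> : b * (- a / b * w i x) = - (a * w i x) by field.
    by apply/eqP; rewrite -addr_eq0 addrC e.
  (* In the order of R[i], a negative number has zero imaginary part. *)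
  + case=> m n; rewrite ltcE /= => /andP[/eqP <- m0] /(eigenvalue_persol s0 sE L0 cq phiE)[v [v1 [hv nv]]].
    congr (_ +i* _); apply/eqP/negPn/negP => ne.
    have [a [b [ab _ /(_ ne) h]]] := np m mu0 v v1 w w1 m0 mu00 hv hw.
    case/orP: ab => nz.
      apply: (npos v nv) => i x hx; have [/eqP] := h i x hx.
      by rewrite mulf_eq0 (negbTE nz) => /eqP.
    apply: (npos w nw) => i x hx; have [_ /eqP] := h i x hx.
    by rewrite mulf_eq0 (negbTE nz) => /eqP.
- by [].
move=> S.
have Seig lam : S lam -> is_eigenvalue L D lam.
  move=> [hs _]; apply: contrapT => ne; apply: hs; case: lam ne => m n ne.
  exact: (not_eigenvalue_resolvent s0 sE L0 cq phiE ne).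
have nr (m : R) : `|m%:C| = `|m|%:C :> R[i].
  by rewrite normc_def /= expr0n addr0 sqrtr_sqr.
split => //.
- move=> lam hlam; split; first exact/mem_set.
  have lE := real_of lam (Seig lam hlam); set m := complex.Re lam in lE.
  have [e e0 he] := noacc m.
  (* All points of S are real eigenvalues, so a complex ball meets S only in a real interval. *)
  exists (ball (lam : R[i]^o) (e%:C : R[i])).
    by apply: nbhsx_ballx; rewrite ltcR.
  apply/seteqP; split=> [z [hz hS]|z ->]; last first.
    by split=> //; apply: ballxx; rewrite ltcR.
  have zE := real_of z (Seig z hS); move: hz; rewrite -ball_normE /=.
  rewrite {1}zE {1}lE -rmorphB nr ltcR distrC => hz.
  apply: contrapT => ne; apply: (he (complex.Re z) _ hz).
    by apply: contra_notN ne => /eqP ezm; rewrite zE lE ezm.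
  by rewrite rE -zE; exact: Seig.
(* Eigenvalues do not accumulate at 0, and 0 itself has been removed from S. *)
- have [e e0 he] := noacc 0; exists e => // lam hlam.
  have lE := real_of lam (Seig lam hlam); rewrite lE nr lecR leNgt; apply/negP => lt.
  apply: (he (complex.Re lam)); rewrite ?subr0 //; last by rewrite rE -lE; exact: Seig.
  apply/eqP => e00; case: hlam => _ /=; apply; right.
  by rewrite lE e00.
Qed.
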